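(* Let $\Omega\subset\mathbb{C}^n$ be a bounded domain, let $1<p<\infty$ and let $S$ be a compact subset of $\Omega$. There exists a constant $C>0$ depending on $p$ and $S$ (and on $\Omega$) such that $$|K_p(\zeta,z)-K_p(\zeta,z')|\le C|z-z'|,\qquad\forall\,\zeta,z,z'\in S.$$ The same conclusion also holds with $K_p(\cdot,\cdot)$ replaced by $m_p(\cdot,\cdot)$.
   Context: For a bounded domain $\Omega\subset\mathbb{C}^n$ and $1\le p<\infty$, let $A^p(\Omega)=\{f\in\mathcal{O}(\Omega):\|f\|_p^p=\int_\Omega|f|^p<\infty\}$. The $p$-Bergman kernel is $K_p(z):=\sup\{|f(z)|^p: f\in A^p(\Omega),\ \|f\|_p=1\}$. Let $m_p(z):=\inf\{\|f\|_p: f\in A^p(\Omega),\ f(z)=1\}$; it is known that this infimum is attained by a unique function $m_p(\cdot,z)\in A^p(\Omega)$, and $K_p(z)=m_p(z)^{-p}$. The function $(\zeta,z)\mapsto m_p(\zeta,z)$ is the value at $\zeta$ of the minimizer $m_p(\cdot,z)$, and the off-diagonal $p$-Bergman kernel is $K_p(\zeta,z):=K_p(z)\,m_p(\zeta,z)$, $\zeta,z\in\Omega$. *)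

(* Defs.v *)
From HB Require Import structures.
From mathcomp Require Import all_boot all_order all_algebra.
From mathcomp Require Import complex.
From mathcomp Require Import all_classical all_reals all_analysis.

Set Implicit Arguments.
Unset Strict Implicit.
Unset Printing Implicit Defensive.

Import Order.TTheory GRing.Theory Num.Theory.
Import numFieldNormedType.Exports.

Local Open Scope classical_set_scope.
Local Open Scope ring_scope.
Local Open Scope complex_scope.

(* The norm topology of [R[i]] as a normed space over itself, as [R[i]^o] has
   it; the library provides it only for abstract number fields. *)
HB.instance Definition _ (R : rcfType) := NormedModule.copy R[i] R[i]^o.

(* The product of two sigma-finite measures, under a name for which canonical
   structure inference finds the sigma-finite instance: the one of
   lebesgue_integral_fubini for [m1 \x m2] is hidden by its instance for
   subprobabilities. *)
Section prod_measure.
Context {d1 d2 : measure_display} {T1 : measurableType d1}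
  {T2 : measurableType d2} {R : realType}.
Variables (m1 : {sigma_finite_measure set T1 -> \bar R})
  (m2 : {sigma_finite_measure set T2 -> \bar R}).

Definition prod_measure : set (T1 * T2) -> \bar R := (m1 \x m2)%E.

HB.instance Definition _ := Measure.copy prod_measure (m1 \x m2)%E.

Let prod_measure_sigma_finite : sigma_finite [set: T1 * T2] prod_measure.
Proof.
have /sigma_finiteP[F [TF ndF Foo]] := sigma_finiteT m1.
have /sigma_finiteP[G [TG ndG Goo]] := sigma_finiteT m2.
exists (fun n => F n `*` G n).
  rewrite -setXTT TF TG predeqE => -[x y]; split.
    move=> [/= [n _ Fnx] [k _ Gky]]; exists (maxn n k) => //; split.
    - by move: x Fnx; exact/subsetPset/ndF/leq_maxl.
    - by move: y Gky; exact/subsetPset/ndG/leq_maxr.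
  by move=> [n _ []/= ? ?]; split; exists n.
move=> k; have [? ?] := Foo k; have [? ?] := Goo k.
split; first exact: measurableX.
by rewrite /prod_measure product_measure1E// lte_mul_pinfty// ge0_fin_numE.
Qed.

HB.instance Definition _ := Measure_isSigmaFinite.Build _ _ _ prod_measure
  prod_measure_sigma_finite.

End prod_measure.

Section tuple_measure.
Context {d : measure_display} {T : measurableType d} {R : realType}.
Variable m : {sigma_finite_measure set T -> \bar R}.

Definition tuple_cons n (x : T * n.-tuple T) : n.+1.-tuple T :=
  [tuple of x.1 :: x.2].

Definition tuple_uncons n (t : n.+1.-tuple T) : T * n.-tuple T :=
  (thead t, [tuple of behead t]).

Lemma tuple_consK n : cancel (@tuple_cons n) (@tuple_uncons n).
Proof.
by case=> a t; congr pair; apply: val_inj.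
Qed.

Lemma measurable_tuple_cons n : measurable_fun [set: _] (@tuple_cons n).
Proof. exact: measurable_cons. Qed.

Lemma measurable_tuple_uncons n : measurable_fun [set: _] (@tuple_uncons n).
Proof.
apply/measurable_fun_pairP; split; first exact: measurable_tnth.
exact: measurable_behead.
Qed.

Section cons_measure.
Variables (n : nat) (mu : {sigma_finite_measure set (n.-tuple T) -> \bar R}).

Definition cons_measure : set (n.+1.-tuple T) -> \bar R :=
  pushforward (prod_measure m mu) (@tuple_cons n).

Let cons_measure0 : cons_measure set0 = 0%E.
Proof. by rewrite /cons_measure /pushforward preimage_set0 measure0. Qed.

Let cons_measure_ge0 A : (0 <= cons_measure A)%E.
Proof. by rewrite /cons_measure /pushforward; exact: measure_ge0. Qed.

Let cons_measure_sigma_additive : semi_sigma_additive cons_measure.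
Proof.
move=> F mF tF mUF; rewrite /cons_measure /pushforward preimage_bigcup.
have mp (A : set (n.+1.-tuple T)) :
    measurable A -> measurable (@tuple_cons n @^-1` A).
  by move=> mA; rewrite -[X in measurable X]setTI; exact: measurable_tuple_cons.
apply: measure_semi_sigma_additive.
- by move=> k; apply: mp; exact: mF.
- apply/trivIsetP => i j _ _ ij; rewrite -preimage_setI.
  by move/trivIsetP : tF => /(_ _ _ _ _ ij) ->//; rewrite preimage_set0.
- by rewrite -preimage_bigcup; exact: mp.
Qed.

HB.instance Definition _ := isMeasure.Build _ _ _ cons_measure
  cons_measure0 cons_measure_ge0 cons_measure_sigma_additive.

Let cons_measure_sigma_finite : sigma_finite [set: n.+1.-tuple T] cons_measure.
Proof.
have [F TF Foo] := sigma_finiteT (prod_measure m mu).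
exists (fun k => @tuple_uncons n @^-1` F k).
  by rewrite -preimage_bigcup -TF preimage_setT.
move=> k; have [mFk Fkoo] := Foo k; split.
  by rewrite -[X in measurable X]setTI; exact: measurable_tuple_uncons.
rewrite /cons_measure /pushforward -comp_preimage.
by rewrite (_ : _ \o _ = id) ?preimage_id//; apply/funext/tuple_consK.
Qed.

HB.instance Definition _ := Measure_isSigmaFinite.Build _ _ _ cons_measure
  cons_measure_sigma_finite.

End cons_measure.

Fixpoint tuple_measure n : {sigma_finite_measure set (n.-tuple T) -> \bar R} :=
  match n with
  | 0%N => dirac [tuple]
  | k.+1 => cons_measure (tuple_measure k)
  end.

Lemma measurable_box n (A : 'I_n -> set T) : (forall i, measurable (A i)) ->
  measurable [set t : n.-tuple T | forall i, A i (tnth t i)].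
Proof.
move=> mA.
rewrite [X in measurable X](_ : _ =
    \bigcap_(i in [set: 'I_n]) ((@tnth n T)^~ i @^-1` A i)); last first.
  by apply/seteqP; split=> [t At i _|t At i]; exact: At.
apply: fin_bigcap_measurable => // i _.
by rewrite -[X in measurable X]setTI; exact: measurable_tnth.
Qed.

Lemma tuple_measure_box n (A : 'I_n -> set T) : (forall i, measurable (A i)) ->
  tuple_measure n [set t | forall i, A i (tnth t i)] =
  (\prod_(i < n) m (A i))%E.
Proof.
elim: n A => [|n IHn] A mA.
  by rewrite big_ord0 /= diracE mem_set// => -[].
rewrite big_ord_recl -IHn// /= /cons_measure /pushforward.
rewrite (_ : _ @^-1` _ = A ord0 `*`
    [set t : n.-tuple T | forall i, A (lift ord0 i) (tnth t i)]).
  by rewrite /prod_measure product_measure1E//; apply: (measurable_box (fun i => mA _)).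
have E (a : T) (t : n.-tuple T) i : tnth (tuple_cons (a, t)) (lift ord0 i) =
    tnth t i by rewrite tnthS.
apply/seteqP; split=> -[a t] /=.
  move=> At; split=> [|i]; first exact: (At ord0).
  by have := At (lift ord0 i); rewrite E.
by case=> Aa At i; case: (unliftP ord0 i) => [j|] ->; rewrite ?E.
Qed.

End tuple_measure.

Section bergman.
Context {R : realType} {n : nat}.

(* [normc] is the R-valued modulus of the complex field, whereas [`|w|] lives
   in R[i]. *)
Local Notation normc := Normc.normc.

Implicit Types (Omega : set 'rV[R[i]]_n) (p : R) (z zeta : 'rV[R[i]]_n)
  (f : 'rV[R[i]]_n -> R[i]).

(* The Euclidean norm on C^n; the norm [`|z|] of the library is the maximum
   norm, which defines the same topology and the same bounded sets. *)
Definition enorm z : R := Num.sqrt (\sum_(j < n) normc (z ord0 j) ^+ 2).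

Definition bounded_domain Omega :=
  [/\ open Omega, connected Omega, Omega !=set0 & bounded_set Omega].

(* Lebesgue measure on (R^2)^n. *)
Definition lebesgue2n : {sigma_finite_measure set
    (n.-tuple (measurableTypeR R * measurableTypeR R)) -> \bar R} :=
  tuple_measure (prod_measure lebesgue_measure lebesgue_measure) n.

Definition complex_of_tuple
    (t : n.-tuple (measurableTypeR R * measurableTypeR R)) : 'rV[R[i]]_n :=
  \row_j ((tnth t j).1 +i* (tnth t j).2).

(* Both sides are normed spaces over [R[i]], so that [differentiable] means
   Frechet differentiable with a C-linear differential. *)
Definition holomorphic Omega f := forall z, Omega z -> differentiable f z.

Definition pintegral p Omega f : \bar R :=
  (\int[lebesgue2n]_(t in complex_of_tuple @^-1` Omega)
     (normc (f (complex_of_tuple t)) `^ p)%:E)%E.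

Definition pbergman_space p Omega : set ('rV[R[i]]_n -> R[i]) :=
  [set f | holomorphic Omega f /\ (pintegral p Omega f < +oo)%E].

Definition pnorm p Omega f : R := fine (pintegral p Omega f) `^ p^-1.

Definition pbergman_kernel p Omega z : R :=
  sup [set normc (f z) `^ p | f in
        [set f | pbergman_space p Omega f /\ pnorm p Omega f = 1]].

Definition pbergman_min p Omega z : R :=
  inf [set pnorm p Omega f | f in
        [set f | pbergman_space p Omega f /\ f z = 1]].

Definition is_minimizer p Omega z f :=
  [/\ pbergman_space p Omega f, f z = 1 &
      pnorm p Omega f = pbergman_min p Omega z].

(* The minimizer at [z] is unique as a function on Omega; outside Omega, where
   its values carry no meaning, they depend on the choice made by [get]. *)
Definition minimizer p Omega zeta z : R[i] :=
  get (is_minimizer p Omega z) zeta.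

Definition pbergman_offdiag p Omega zeta z : R[i] :=
  (pbergman_kernel p Omega z)%:C * minimizer p Omega zeta z.

End bergman.

(* Main.v *)
(* Write m_z for the minimizer at z, k(z) = m_p(z)^p = ||m_z||_p^p, and
   u = (m_z' + m_z)/2, v = (m_z' - m_z)/2. By uniform convexity the defect
   Delta = ||m_z'||_p^p + ||m_z||_p^p - 2 ||u||_p^p dominates the integral of
   |v|^2, up to a constant, over any box on which |u| is bounded below, hence
   |v|^2 at the centre of the box. Conversely ||u||_p^p >= k(w) |u(w)|^p at w = z
   and w = z' gives
     Delta <= p (k(z') |v(z') - v(z)| + |k(z') - k(z)| |v(z)|),
   and k is locally Lipschitz because m_z is a competitor for k(z'). Near z we
   have |u| >= 1/2, so v = O(Delta^(1/2)) there and, v being holomorphic,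
   Delta = O(|z - z'| Delta^(1/2)), that is, Delta = O(|z - z'|^2).
   At zeta one cannot bound |u| below, since m_z may vanish; but it does not
   vanish on the boundary of a small square in some complex line through zeta.
   There v = O(Delta^(1/2)) = O(|z - z'|), and the maximum principle carries this
   to zeta. Constants are uniform by compactness, and K_p = 1/k. *)
Require Import Defs.
From HB Require Import structures.
From mathcomp Require Import all_boot all_order all_algebra.
From mathcomp Require Import complex.
From mathcomp Require Import all_classical all_reals all_analysis.
From mathcomp Require Import measurable_realfun.
From mathcomp Require Import ring lra.

Set Implicit Arguments.
Unset Strict Implicit.
Unset Printing Implicit Defensive.

Import Order.TTheory GRing.Theory Num.Theory.
Import numFieldNormedType.Exports.

Local Open Scope classical_set_scope.
Local Open Scope ring_scope.
Local Open Scope complex_scope.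

Local Notation normc := Normc.normc.

(** * The modulus and path integrals along segments *)

Section modulus.
Context {R : realType}.
Implicit Types (x y z : R[i]) (a b : R).

(** When p > 2 and u may vanish, the defect controls only |v|^p, and Delta = O(|z - z'|^2) would
    yield no more than v = O(|z - z'|^(2/p)); the lower bound on |u| is what raises the rate to
    Lipschitz. The weak control still has two tasks. It makes minimizing sequences locally uniformly
    Cauchy, so that minimizers exist. And it keeps m_z uniformly close to m_z0 near zeta0 when z is
    close to z0: one square, chosen for m_z0 and zeta0 alone, then serves every pair z, z' near z0
    and, after translation, every zeta near zeta0, which is the uniformity that the covering of S x
    S x S asks for. Away from the diagonal z = z' of that product the bound is immediate, since the
    minimizers are bounded on S. Rectangles replace discs throughout: Cauchy's formula then needs
    only integrals along axis-parallel segments, and boxes are products for Lebesgue measure on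
    (R^2)^n, so that integral bounds are obtained one coordinate at a time. The constants in
    Cauchy's estimates are not sharp; only their uniformity matters. *)

Lemma normc_ge0 x : 0 <= normc x.
Proof. by case: x => a b; exact: sqrtr_ge0. Qed.

Lemma normc_eq0 x : (normc x == 0) = (x == 0).
Proof.
apply/eqP/eqP => [|->]; first exact: Normc.eq0_normc.
exact: Normc.normc0.
Qed.

Lemma normc_gt0 x : (0 < normc x) = (x != 0).
Proof. by rewrite lt_def normc_ge0 andbT normc_eq0. Qed.

Lemma normcBC x y : normc (x - y) = normc (y - x).
Proof. by rewrite -normcN opprB. Qed.

Lemma le_normcB x y : normc (x - y) <= normc x + normc y.
Proof. by rewrite -(normcN y); exact: le_normcD. Qed.

Lemma normc_triangle y x z : normc (x - z) <= normc (x - y) + normc (y - z).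
Proof. by rewrite -[x - z](subrKA y); exact: le_normcD. Qed.

Lemma normc_real a : normc a%:C = `|a|.
Proof. by rewrite /= expr0n addr0 sqrtr_sqr. Qed.

Lemma normci : normc ('i : R[i]) = 1.
Proof. by rewrite /= expr0n expr1n add0r sqrtr1. Qed.

Lemma normc_imag a : normc ('i * a%:C) = `|a|.
Proof. by rewrite Normc.normcM normc_real normci mul1r. Qed.

Lemma ler_Re_normc x : `|complex.Re x| <= normc x.
Proof.
case: x => a b /=; rewrite -sqrtr_sqr ler_sqrt ?addr_ge0 ?sqr_ge0//.
by rewrite lerDl sqr_ge0.
Qed.

Lemma ler_Im_normc x : `|complex.Im x| <= normc x.
Proof.
case: x => a b /=; rewrite -sqrtr_sqr ler_sqrt ?addr_ge0 ?sqr_ge0//.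
by rewrite lerDr sqr_ge0.
Qed.

Lemma ler_normc_ReIm x : normc x <= `|complex.Re x| + `|complex.Im x|.
Proof.
rewrite {1}[x]complexE; apply: (le_trans (le_normcD _ _)).
by rewrite normc_real normc_imag.
Qed.

Lemma normcX x k : normc (x ^+ k) = normc x ^+ k.
Proof.
by elim: k => [|k IHk]; rewrite ?expr0 ?Normc.normc1// !exprS Normc.normcM IHk.
Qed.

Lemma ReB x y : complex.Re (x - y) = complex.Re x - complex.Re y.
Proof. by case: x y => ? ? []. Qed.

Lemma ImB x y : complex.Im (x - y) = complex.Im x - complex.Im y.
Proof. by case: x y => ? ? []. Qed.

Lemma ReD x y : complex.Re (x + y) = complex.Re x + complex.Re y.
Proof. by case: x y => ? ? []. Qed.

Lemma ImD x y : complex.Im (x + y) = complex.Im x + complex.Im y.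
Proof. by case: x y => ? ? []. Qed.

Lemma ReM x y : complex.Re (x * y) =
  complex.Re x * complex.Re y - complex.Im x * complex.Im y.
Proof. by case: x y => ? ? []. Qed.

Lemma ImM x y : complex.Im (x * y) =
  complex.Re x * complex.Im y + complex.Im x * complex.Re y.
Proof. by case: x y => ? ? []. Qed.

Lemma complexP x y :
  complex.Re x = complex.Re y -> complex.Im x = complex.Im y -> x = y.
Proof. by case: x y => ? ? [] ? ? /= -> ->. Qed.

End modulus.

Arguments Normc.normc : simpl never.

Section path_integral.
Context {R : realType}.
Implicit Types (g h : R -> R[i]) (a b c : R).

(** Continuity at the points of the segment, with [y] ranging over all of R and not only over the
    segment, so that splitting a segment needs no one-sided limits. *)
Definition pcont g a b := forall x, a <= x <= b -> forall e : R, 0 < e ->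
  exists2 d : R, 0 < d & forall y, `|y - x| < d -> normc (g y - g x) <= e.

Definition cint a b g : R[i] :=
  (\int[lebesgue_measure]_(x in `[a, b]) complex.Re (g x))%R +i*
  (\int[lebesgue_measure]_(x in `[a, b]) complex.Im (g x))%R.

Lemma pcont_within (L : R[i] -> R) g a b :
  (forall x y, `|L x - L y| <= normc (x - y)) -> pcont g a b ->
  {within `[a, b], continuous (L \o g)}.
Proof.
move=> Lle gc; apply: continuous_in_subspaceT => x /set_mem /=.
rewrite in_itv/= => xab; apply/cvgrPdist_le => e e0.
have [d d0 gd] := gc x xab _ e0.
near=> y; rewrite distrC; apply: (le_trans (Lle _ _)); apply: gd.
by rewrite distrC; near: y; apply: cvgr_dist_lt => //; exact: cvg_id.
Unshelve. all: by end_near. Qed.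

Lemma pcont_Re g a b : pcont g a b ->
  {within `[a, b], continuous (@complex.Re R \o g)}.
Proof. by apply: pcont_within => x y; rewrite -ReB ler_Re_normc. Qed.

Lemma pcont_Im g a b : pcont g a b ->
  {within `[a, b], continuous (@complex.Im R \o g)}.
Proof. by apply: pcont_within => x y; rewrite -ImB ler_Im_normc. Qed.

Lemma pcont_intRe g a b : pcont g a b ->
  lebesgue_measure.-integrable `[a, b] (EFin \o (@complex.Re R \o g)).
Proof.
move=> gc; apply: continuous_compact_integrable; first exact: segment_compact.
exact: pcont_Re.
Qed.

Lemma pcont_intIm g a b : pcont g a b ->
  lebesgue_measure.-integrable `[a, b] (EFin \o (@complex.Im R \o g)).
Proof.
move=> gc; apply: continuous_compact_integrable; first exact: segment_compact.
exact: pcont_Im.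
Qed.

Lemma pcontB g h a b : pcont g a b -> pcont h a b -> pcont (g \- h) a b.
Proof.
move=> gc hc x xab e e0; have e20 : 0 < e / 2 by lra.
have [d d0 gd] := gc _ xab _ e20; have [d' d'0 hd] := hc _ xab _ e20.
exists (Num.min d d'); first by rewrite lt_min d0.
move=> y; rewrite lt_min => /andP[/gd gy /hd hy] /=.
rewrite (_ : g y - h y - (g x - h x) = (g y - g x) - (h y - h x)); last by ring.
by apply: (le_trans (le_normcB _ _)); lra.
Qed.

Lemma pcont_cst k a b : pcont (fun=> k) a b.
Proof.
by move=> x xab e e0; exists 1 => // y _; rewrite subrr Normc.normc0 ltW.
Qed.

Lemma eq_cint a b g h : (forall x, a <= x <= b -> g x = h x) ->
  cint a b g = cint a b h.
Proof.
move=> gh; apply: complexP; apply: eq_Rintegral => x /set_mem /=;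
  by rewrite in_itv /= => xab; rewrite gh.
Qed.

Lemma cintB a b g h : pcont g a b -> pcont h a b ->
  cint a b (g \- h) = cint a b g - cint a b h.
Proof.
move=> gc hc; apply: complexP => /=.
  rewrite -RintegralB ?pcont_intRe//.
  by apply: eq_Rintegral => x _; rewrite ReB.
rewrite -RintegralB ?pcont_intIm//.
by apply: eq_Rintegral => x _; rewrite ImB.
Qed.

Lemma cintMl a b k g : pcont g a b ->
  cint a b (fun x => k * g x) = k * cint a b g.
Proof.
move=> gc; apply: complexP.
  rewrite ReM /= -!RintegralZl ?pcont_intRe ?pcont_intIm//.
  rewrite -RintegralB//.
  - by apply: eq_Rintegral => x _; rewrite ReM.
  - rewrite (_ : EFin \o _ = fun x => (complex.Re k)%:E * (complex.Re (g x))%:E)%E//.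
    by apply: integrableZl => //; exact: pcont_intRe.
  - rewrite (_ : EFin \o _ = fun x => (complex.Im k)%:E * (complex.Im (g x))%:E)%E//.
    by apply: integrableZl => //; exact: pcont_intIm.
rewrite ImM /= -!RintegralZl ?pcont_intRe ?pcont_intIm//.
rewrite -RintegralD//.
- by apply: eq_Rintegral => x _; rewrite ImM.
- rewrite (_ : EFin \o _ = fun x => (complex.Re k)%:E * (complex.Im (g x))%:E)%E//.
  by apply: integrableZl => //; exact: pcont_intIm.
- rewrite (_ : EFin \o _ = fun x => (complex.Im k)%:E * (complex.Re (g x))%:E)%E//.
  by apply: integrableZl => //; exact: pcont_intRe.
Qed.

Lemma Rintegral_itv_cst a b (r : R) : a <= b ->
  (\int[lebesgue_measure]_(x in `[a, b]) r)%R = r * (b - a).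
Proof.
move=> ab; rewrite Rintegral_cst//= lebesgue_measure_itv/= lte_fin.
move: ab; rewrite le_eqVlt => /predU1P[->|->]; rewrite ?ltxx ?subrr//.
Qed.

Lemma cint_cst a b k : a <= b -> cint a b (fun=> k) = k * (b - a)%:C.
Proof.
move=> ab; apply: complexP; rewrite ?ReM ?ImM /= Rintegral_itv_cst//; lra.
Qed.

(** The factor 2 comes from estimating real and imaginary parts separately. *)
Lemma le_cint a b g (M : R) : a <= b -> pcont g a b ->
  (forall x, a <= x <= b -> normc (g x) <= M) ->
  normc (cint a b g) <= 2 * M * (b - a).
Proof.
move=> ab gc gM.
have bnd (L : R[i] -> R) : (forall x, `|L x| <= normc x) ->
    lebesgue_measure.-integrable `[a, b] (EFin \o (L \o g)) ->
    `|(\int[lebesgue_measure]_(x in `[a, b]) L (g x))%R| <= M * (b - a).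
  move=> Lle Li; rewrite -Rintegral_itv_cst//.
  apply: (le_trans (le_normr_Rintegral _ Li)) => //.
  apply: le_Rintegral => //.
  - exact: (integrable_norm Li).
  - apply: continuous_compact_integrable; first exact: segment_compact.
    by apply: continuous_subspaceT => ?; exact: cvg_cst.
  - move=> x /=; rewrite in_itv/= => xab.
    by rewrite (le_trans (Lle _)) ?gM.
apply: (le_trans (ler_normc_ReIm _)) => /=.
rewrite -mulrA mulr_natl mulr2n; apply: lerD.
  exact: (bnd _ ler_Re_normc (pcont_intRe gc)).
exact: (bnd _ ler_Im_normc (pcont_intIm gc)).
Qed.

Lemma cint_split a b c g : a <= c <= b -> pcont g a b ->
  cint a b g = cint a c g + cint c b g.
Proof.
move=> /andP[ac cb] gc.
have split (f : R -> R) :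
    lebesgue_measure.-integrable `[a, b] (EFin \o f) ->
    (\int[lebesgue_measure]_(x in `[a, b]) f x =
     \int[lebesgue_measure]_(x in `[a, c]) f x +
     \int[lebesgue_measure]_(x in `[c, b]) f x)%R.
  move=> fi; have fi' : lebesgue_measure.-integrable `]c, b] (EFin \o f).
    apply: integrableS fi => // x /=; rewrite !in_itv/= => /andP[cx ->].
    by rewrite (ltW (le_lt_trans ac cx)).
  rewrite -(Rintegral_itv_obnd_cbnd fi').
  by rewrite -(@Rintegral_itvB _ f (BLeft a) (BRight b) c) ?bnd_simp// addrC subrK.
by apply: complexP => /=; apply: split; [exact: pcont_intRe|exact: pcont_intIm].
Qed.

End path_integral.

(** * Goursat's theorem on rectangles *)

Section goursat.
Context {R : realType}.
Implicit Types (F G : R[i] -> R[i]) (a b c d : R) (w : R[i]).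

Definition ccont F w := forall e : R, 0 < e ->
  exists2 r : R, 0 < r & forall h, normc h < r -> normc (F (w + h) - F w) <= e.

Definition cdiff F w := exists k : R[i], forall e : R, 0 < e ->
  exists2 r : R, 0 < r & forall h, normc h < r ->
    normc (F (w + h) - F w - k * h) <= e * normc h.

Lemma cdiff_cont F w : cdiff F w -> ccont F w.
Proof.
move=> [k Fk] e e0; have [r r0 Fr] := Fk 1 ltr01.
have k0 : 0 < normc k + 1 by rewrite ltr_wpDl ?normc_ge0.
exists (Num.min r (e / (normc k + 1))); first by rewrite lt_min r0 divr_gt0.
move=> h; rewrite lt_min => /andP[/Fr + he]; rewrite mul1r => Fh.
rewrite -[F (w + h) - F w](subrK (k * h)).
apply: (le_trans (le_normcD _ _)); rewrite Normc.normcM.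
apply: (@le_trans _ _ ((normc k + 1) * normc h)).
  by rewrite mulrDl mul1r addrC lerD2l.
by rewrite mulrC -ler_pdivlMr// ltW.
Qed.

Definition rect_cont F a b c d := forall x y : R, a <= x <= b -> c <= y <= d ->
  ccont F (x +i* y).

Lemma ccont_hpath F a b y : (forall x, a <= x <= b -> ccont F (x +i* y)) ->
  pcont (fun x => F (x +i* y)) a b.
Proof.
move=> Fc x xab e e0; have [r r0 Fr] := Fc x xab e e0.
exists r => // x' xx'; have := Fr (x' - x)%:C; rewrite normc_real => /(_ xx').
by rewrite (_ : x +i* y + (x' - x)%:C = x' +i* y)//; apply: complexP => /=; ring.
Qed.

Lemma ccont_vpath F a c d : (forall y, c <= y <= d -> ccont F (a +i* y)) ->
  pcont (fun y => F (a +i* y)) c d.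
Proof.
move=> Fc y ycd e e0; have [r r0 Fr] := Fc y ycd e e0.
exists r => // y' yy'; have := Fr ('i * (y' - y)%:C); rewrite normc_imag => /(_ yy').
by rewrite (_ : a +i* y + 'i * (y' - y)%:C = a +i* y')//; apply: complexP => /=; ring.
Qed.

(* The contour integral over the boundary of [a, b] x [c, d], with opposite
   sides grouped together. *)
Definition rint F a b c d : R[i] :=
  cint a b (fun x => F (x +i* c) - F (x +i* d)) +
  'i * cint c d (fun y => F (b +i* y) - F (a +i* y)).

(** Continuity is asked only at boundary points because the integrands of Cauchy's formula have a
    pole inside the rectangle. *)
Definition bdry_cont F a b c d := forall x y : R, a <= x <= b -> c <= y <= d ->
  [|| x == a, x == b, y == c | y == d] -> ccont F (x +i* y).

Lemma rect_cont_sub F a b c d a' b' c' d' : rect_cont F a b c d ->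
  a <= a' -> b' <= b -> c <= c' -> d' <= d -> rect_cont F a' b' c' d'.
Proof.
move=> Fc aa bb cc dd x y /andP[? ?] /andP[? ?]; apply: Fc.
  by rewrite (le_trans aa) ?(le_trans _ bb).
by rewrite (le_trans cc) ?(le_trans _ dd).
Qed.

Lemma rect_cont_bdry F a b c d : rect_cont F a b c d -> bdry_cont F a b c d.
Proof. by move=> Fc x y xab ycd _; exact: Fc. Qed.

Section continuous_on_boundary.
Variables (F : R[i] -> R[i]) (a b c d : R).
Hypotheses (ab : a <= b) (cd : c <= d) (Fc : bdry_cont F a b c d).

Lemma bdry_path : [/\ pcont (fun x => F (x +i* c)) a b,
  pcont (fun x => F (x +i* d)) a b, pcont (fun y => F (a +i* y)) c d &
  pcont (fun y => F (b +i* y)) c d].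
Proof.
split; (apply: ccont_hpath || apply: ccont_vpath) => t tP;
  by apply: Fc; rewrite ?lexx ?eqxx ?ab ?cd ?orbT.
Qed.

Lemma rintE : rint F a b c d =
  cint a b (fun x => F (x +i* c)) - cint a b (fun x => F (x +i* d)) +
  'i * (cint c d (fun y => F (b +i* y)) - cint c d (fun y => F (a +i* y))).
Proof.
by have [? ? ? ?] := bdry_path; rewrite /rint [in LHS]cintB ?[X in 'i * X]cintB.
Qed.

End continuous_on_boundary.

Lemma rint_hsplit F a b c d e : a <= e <= b -> c <= d ->
  (forall x y : R, a <= x <= b -> c <= y <= d ->
    [|| x == a, x == e, x == b, y == c | y == d] -> ccont F (x +i* y)) ->
  rint F a b c d = rint F a e c d + rint F e b c d.
Proof.
move=> /andP[ae eb] cd Fc; have ab := le_trans ae eb.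
have Fab : bdry_cont F a b c d.
  by move=> x y ? ? /or4P[] H; apply: Fc => //; rewrite H ?orbT.
have Fae : bdry_cont F a e c d.
  move=> x y /andP[ax xe] ? H; apply: Fc => //; first by rewrite ax (le_trans xe).
  by case/or4P: H => ->; rewrite ?orbT.
have Feb : bdry_cont F e b c d.
  move=> x y /andP[ex xb] ? H; apply: Fc => //; first by rewrite xb (le_trans ae).
  by case/or4P: H => ->; rewrite ?orbT.
have [? ? ? ?] := bdry_path ab cd Fab.
by rewrite !rintE// !(@cint_split _ a b e) ?ae ?eb//; ring.
Qed.

Lemma rint_vsplit F a b c d e : a <= b -> c <= e <= d ->
  (forall x y : R, a <= x <= b -> c <= y <= d ->
    [|| y == c, y == e, y == d, x == a | x == b] -> ccont F (x +i* y)) ->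
  rint F a b c d = rint F a b c e + rint F a b e d.
Proof.
move=> ab /andP[ce ed] Fc; have cd := le_trans ce ed.
have Fcd : bdry_cont F a b c d.
  by move=> x y ? ? /or4P[] H; apply: Fc => //; rewrite H ?orbT.
have Fce : bdry_cont F a b c e.
  move=> x y ? /andP[cy ye] H; apply: Fc => //; first by rewrite cy (le_trans ye).
  by case/or4P: H => ->; rewrite ?orbT.
have Fed : bdry_cont F a b e d.
  move=> x y ? /andP[ey yd] H; apply: Fc => //; first by rewrite yd (le_trans ce).
  by case/or4P: H => ->; rewrite ?orbT.
have [? ? ? ?] := bdry_path ab cd Fcd.
by rewrite !rintE// !(@cint_split _ c d e) ?ce ?ed//; ring.
Qed.

(** The contour integral of an affine function vanishes, so only the distance from [F] to [k + l w]
    on the boundary counts. Of the factor 4, one 2 comes from pairing opposite sides and the other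
    from [le_cint]. *)
Lemma rint_affine_le F a b c d (k l : R[i]) (M : R) : a <= b -> c <= d ->
  bdry_cont F a b c d ->
  (forall x y : R, a <= x <= b -> c <= y <= d ->
    [|| x == a, x == b, y == c | y == d] ->
    normc (F (x +i* y) - (k + l * (x +i* y))) <= M) ->
  normc (rint F a b c d) <= 4 * M * ((b - a) + (d - c)).
Proof.
move=> ab cd Fc FM; have [pc pd pa pb] := bdry_path ab cd Fc.
have ph : pcont (fun x => F (x +i* c) - F (x +i* d)) a b by exact: pcontB.
have pv : pcont (fun y => F (b +i* y) - F (a +i* y)) c d by exact: pcontB.
(* The constants subtracted in [G1] and [G2] are the differences of [k + l w] between opposite
   sides; their two contributions to the contour integral cancel. *)
pose G1 x := F (x +i* c) - F (x +i* d) - l * 'i * (c - d)%:C.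
pose G2 y := F (b +i* y) - F (a +i* y) - l * (b - a)%:C.
have G1c : pcont G1 a b by apply: pcontB => //; exact: pcont_cst.
have G2c : pcont G2 c d by apply: pcontB => //; exact: pcont_cst.
have -> : rint F a b c d = cint a b G1 + 'i * cint c d G2.
  have -> : cint a b G1 = cint a b (fun x => F (x +i* c) - F (x +i* d)) -
      cint a b (fun=> l * 'i * (c - d)%:C).
    by rewrite -cintB//; exact: pcont_cst.
  have -> : cint c d G2 = cint c d (fun y => F (b +i* y) - F (a +i* y)) -
      cint c d (fun=> l * (b - a)%:C).
    by rewrite -cintB//; exact: pcont_cst.
  rewrite /rint !cint_cst//.
  have -> : (c - d)%:C = - (d - c)%:C :> R[i] by apply: complexP => /=; ring.
  by ring.
have le1 : normc (cint a b G1) <= 2 * (M + M) * (b - a).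
  apply: le_cint => // x xab.
  rewrite (_ : G1 x = (F (x +i* c) - (k + l * (x +i* c))) -
     (F (x +i* d) - (k + l * (x +i* d)))); last first.
    have e : 'i * (c - d)%:C = (x +i* c) - (x +i* d) by apply: complexP => /=; ring.
    by rewrite /G1 -mulrA e; ring.
  by apply: (le_trans (le_normcB _ _)); apply: lerD; apply: FM;
    rewrite ?lexx ?eqxx ?ab ?cd ?orbT.
have le2 : normc (cint c d G2) <= 2 * (M + M) * (d - c).
  apply: le_cint => // y ycd.
  rewrite (_ : G2 y = (F (b +i* y) - (k + l * (b +i* y))) -
     (F (a +i* y) - (k + l * (a +i* y)))); last first.
    have e : (b - a)%:C = (b +i* y) - (a +i* y) by apply: complexP => /=; ring.
    by rewrite /G2 e; ring.
  by apply: (le_trans (le_normcB _ _)); apply: lerD; apply: FM;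
    rewrite ?lexx ?eqxx ?ab ?cd ?orbT.
apply: (le_trans (le_normcD _ _)).
by rewrite Normc.normcM normci mul1r mulrDr; apply: lerD;
  [apply: (le_trans le1)|apply: (le_trans le2)]; rewrite le_eqVlt; apply/orP; left; apply/eqP; ring.
Qed.

Lemma nested_intervals (u l : nat -> R) : (forall k, 0 <= l k) ->
  (forall k, u k <= u k.+1) -> (forall k, u k.+1 + l k.+1 <= u k + l k) ->
  exists x, forall k, u k <= x <= u k + l k.
Proof.
move=> l0 uS lS.
have umono j k : (j <= k)%N -> u j <= u k.
  by move=> /subnK <-; elim: (k - j)%N => // m IHm; exact: (le_trans IHm).
have lmono j k : (j <= k)%N -> u k + l k <= u j + l j.
  by move=> /subnK <-; elim: (k - j)%N => // m IHm; apply: (le_trans _ IHm); exact: lS.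
have ul j k : u j <= u k + l k.
  have [jk|kj] := leqP j k; first by rewrite (le_trans (umono _ _ jk)) ?lerDl.
  by rewrite (le_trans _ (lmono _ _ (ltnW kj))) ?lerDl.
exists (sup (range u)) => k; apply/andP; split.
  apply: ub_le_sup; last by exists k.
  by exists (u 0%N + l 0%N) => _ [j _ <-].
by apply: ge_sup; [exists (u 0%N), 0%N|move=> _ [j _ <-]].
Qed.

(** The lower left corner of a quarter that carries at least a quarter of the contour integral. The
    last quarter is returned without a test: by the triangle inequality it qualifies when the other
    three fail. *)
Let quarter F (s t a c : R) : R * R :=
  let m := normc (rint F a (a + s) c (c + t)) in
  if m <= 4 * normc (rint F a (a + s / 2) c (c + t / 2)) then (a, c) else
  if m <= 4 * normc (rint F (a + s / 2) (a + s) c (c + t / 2))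
    then (a + s / 2, c) else
  if m <= 4 * normc (rint F a (a + s / 2) (c + t / 2) (c + t))
    then (a, c + t / 2) else
  (a + s / 2, c + t / 2).

Let quarter_rect F (s t a c : R) : 0 <= s -> 0 <= t ->
  [/\ a <= (quarter F s t a c).1, (quarter F s t a c).1 + s / 2 <= a + s,
      c <= (quarter F s t a c).2 & (quarter F s t a c).2 + t / 2 <= c + t].
Proof.
move=> s0 t0; rewrite /quarter.
by do 3?case: ifP => _ /=; split; lra.
Qed.

Let quarter_le F (s t a c : R) : 0 <= s -> 0 <= t ->
  rect_cont F a (a + s) c (c + t) ->
  let q := quarter F s t a c in
  normc (rint F a (a + s) c (c + t)) <=
  4 * normc (rint F q.1 (q.1 + s / 2) q.2 (q.2 + t / 2)).
Proof.
move=> s0 t0 Fc; rewrite /quarter /=.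
have es : a + s / 2 + s / 2 = a + s by lra.
have et : c + t / 2 + t / 2 = c + t by lra.
case: ifP => [//|/negbT]; rewrite -ltNge => m1.
case: ifP => [|/negbT]; first by rewrite es.
rewrite -ltNge => m2; case: ifP => [|/negbT]; first by rewrite et.
rewrite -ltNge es et => m3; move: m1 m2 m3.
have -> : rint F a (a + s) c (c + t) =
   rint F a (a + s / 2) c (c + t / 2) +
   rint F a (a + s / 2) (c + t / 2) (c + t) +
   (rint F (a + s / 2) (a + s) c (c + t / 2) +
    rint F (a + s / 2) (a + s) (c + t / 2) (c + t)).
  have h1 : a <= a + s / 2 <= a + s by apply/andP; split; lra.
  have h2 : c <= c + t / 2 <= c + t by apply/andP; split; lra.
  have ct : c <= c + t by lra.
  rewrite (rint_hsplit h1 ct); last by move=> *; exact: Fc.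
  by congr (_ + _); (apply: rint_vsplit => //; first lra) => x y /andP[? ?] *;
    apply: Fc => //; apply/andP; split; lra.
set I1 := rint _ _ _ _ _; set I2 := rint _ _ _ _ _; set I3 := rint _ _ _ _ _.
set I4 := rint _ _ _ _ _ => m1 m2 m3.
have := le_normcD (I1 + I2) (I3 + I4); have := le_normcD I1 I2.
have := le_normcD I3 I4; lra.
Qed.

(** Bisection. The rectangles chosen by [quarter] shrink to a point where [F] is differentiable. On
    the k-th one [F] is within e D / 2^k of an affine function and the sum of the sides is D / 2^k,
    so the factor 4^k lost by bisecting is compensated exactly and e times a constant remains. *)
Theorem goursat F a b c d : a <= b -> c <= d ->
  (forall x y : R, a <= x <= b -> c <= y <= d -> cdiff F (x +i* y)) ->
  rint F a b c d = 0.
Proof.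
move=> ab cd Fd.
pose s k := (b - a) / 2 ^+ k; pose t k := (d - c) / 2 ^+ k.
pose P := fix P k := if k is k'.+1 then quarter F (s k') (t k') (P k').1 (P k').2 else (a, c).
have s0 k : 0 <= s k by rewrite divr_ge0 ?subr_ge0// exprn_ge0.
have t0 k : 0 <= t k by rewrite divr_ge0 ?subr_ge0// exprn_ge0.
have sS k : s k.+1 = s k / 2 by rewrite /s exprS invfM mulrA mulrAC.
have tS k : t k.+1 = t k / 2 by rewrite /t exprS invfM mulrA mulrAC.
have PS k := quarter_rect F (P k).1 (P k).2 (s0 k) (t0 k).
have [x xP] : exists x, forall k, (P k).1 <= x <= (P k).1 + s k.
  by apply: nested_intervals => // k; rewrite ?sS; have [] := PS k.
have [y yP] : exists y, forall k, (P k).2 <= y <= (P k).2 + t k.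
  by apply: nested_intervals => // k; rewrite ?tS; have [] := PS k.
have Pin k : [/\ a <= (P k).1, (P k).1 + s k <= b, c <= (P k).2 &
    (P k).2 + t k <= d].
  elim: k => [|k [h1 h2 h3 h4]].
    by rewrite /s /t !expr0 !divr1 /= !lexx; split => //; lra.
  have [g1 g2 g3 g4] := PS k; rewrite /= in g1 g2 g3 g4 *.
  rewrite sS tS; split;
    by [apply: le_trans g1|apply: le_trans h2|apply: le_trans g3|apply: le_trans h4].
pose I k := normc (rint F (P k).1 ((P k).1 + s k) (P k).2 ((P k).2 + t k)).
have Fc : rect_cont F a b c d by move=> ? ? ? ?; exact/cdiff_cont/Fd.
have Fck k : rect_cont F (P k).1 ((P k).1 + s k) (P k).2 ((P k).2 + t k).
  by have [? ? ? ?] := Pin k; apply: (rect_cont_sub Fc).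
have I0 k : I 0%N <= 4 ^+ k * I k.
  elim: k => [|k IHk]; first by rewrite expr0 mul1r.
  apply: (le_trans IHk); rewrite exprSr -mulrA ler_pM2l ?exprn_gt0//.
  by rewrite {2}/I sS tS; apply: quarter_le.
have [l Fl] : cdiff F (x +i* y).
  apply: Fd; have := Pin 0%N; have := xP 0%N; have := yP 0%N => /= /andP[? ?] /andP[? ?] [? ? ? ?];
  apply/andP; split; lra.
pose D := (b - a) + (d - c).
have D0 : 0 <= D by rewrite /D; lra.
have Ie e : 0 < e -> I 0%N <= e * (4 * D ^+ 2).
  move=> e0; have [r r0 Fr] := Fl _ e0.
  have [k kr] : exists k, D / 2 ^+ k < r.
    exists (Num.truncn (D / r)).+1; rewrite ltr_pdivrMr ?exprn_gt0//.
    rewrite mulrC -ltr_pdivrMr//.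
    apply: lt_le_trans (truncnS_gt _) _.
    by rewrite -natrX ler_nat ltnW// ltn_expl.
  apply: (le_trans (I0 k)).
  have stD : s k + t k = D / 2 ^+ k by rewrite /s /t -mulrDl.
  have Ik : I k <= 4 * (e * (D / 2 ^+ k)) * (D / 2 ^+ k).
    rewrite -{2}stD (_ : s k + t k =
      ((P k).1 + s k - (P k).1) + ((P k).2 + t k - (P k).2)); last by ring.
    apply: (@rint_affine_le F _ _ _ _ (F (x +i* y) - l * (x +i* y)) l _ _ _ (rect_cont_bdry (Fck k))).
    - by rewrite lerDl.
    - by rewrite lerDl.
    move=> x' y' x'P y'P _.
    have hD : normc ((x' +i* y') - (x +i* y)) <= D / 2 ^+ k.
      apply: (le_trans (ler_normc_ReIm _)); rewrite -stD /=.
      have := xP k; have := yP k => /andP[? ?] /andP[? ?].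
      move: x'P y'P => /andP[? ?] /andP[? ?].
      by apply: lerD; rewrite ler_norml; apply/andP; split; lra.
    have := Fr _ (le_lt_trans hD kr).
    rewrite (addrC (x +i* y)) subrK => Fx'.
    rewrite (_ : F (x' +i* y') - (F (x +i* y) - l * (x +i* y) + l * (x' +i* y')) =
      F (x' +i* y') - F (x +i* y) - l * (x' +i* y' - (x +i* y))); last by ring.
    by apply: (le_trans Fx'); rewrite ler_pM2l.
  rewrite -ler_pdivlMl ?exprn_gt0//; apply: (le_trans Ik).
  have -> : 4 = 2 * 2 :> R by rewrite -natrM.
  by rewrite exprMn invfM le_eqVlt; apply/orP; left; apply/eqP; ring.
have {}Ie : I 0%N <= 0.
  apply/ler_addgt0Pl => e e0; rewrite addr0.
  have D1 : 0 < 4 * D ^+ 2 + 1 by have := sqr_ge0 D; lra.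
  apply: (le_trans (Ie _ (divr_gt0 e0 D1))).
  by rewrite mulrAC ler_pdivrMr// ler_pM2l// lerDl.
have /eqP : I 0%N == 0 by rewrite eq_le Ie normc_ge0.
by rewrite /I /= /s /t expr0 !divr1 !(addrC _ (_ - _)) !subrK => /Normc.eq0_normc.
Qed.

End goursat.

(** * Cauchy's formula on rectangles *)

Section cauchy.
Context {R : realType}.
Implicit Types (F G : R[i] -> R[i]) (a b c d : R) (w l : R[i]).

Lemma cdiff_cst k w : cdiff (fun=> k) w.
Proof.
exists 0 => e e0; exists 1 => // h _.
by rewrite mul0r !subr0 subrr Normc.normc0 mulr_ge0 ?normc_ge0// ltW.
Qed.

Lemma cdiff_id w : cdiff id w.
Proof.
exists 1 => e e0; exists 1 => // h _.
by rewrite (_ : w + h - w - 1 * h = 0) ?Normc.normc0 ?mulr_ge0 ?normc_ge0 ?ltW//; ring.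
Qed.

Lemma cdiffB F G w : cdiff F w -> cdiff G w -> cdiff (fun z => F z - G z) w.
Proof.
move=> [k Fk] [l Gl]; exists (k - l) => e e0; have e20 : 0 < e / 2 by lra.
have [r r0 Fr] := Fk _ e20; have [s s0 Gs] := Gl _ e20.
exists (Num.min r s); first by rewrite lt_min r0.
move=> h; rewrite lt_min => /andP[/Fr hF /Gs hG].
rewrite (_ : _ - _ - _ = (F (w + h) - F w - k * h) - (G (w + h) - G w - l * h));
  last by ring.
apply: (le_trans (le_normcB _ _)).
by apply: (le_trans (lerD hF hG)); rewrite -mulrDl -splitr.
Qed.

Lemma cdiffM F G w : cdiff F w -> cdiff G w -> cdiff (fun z => F z * G z) w.
Proof.
move=> dF dG; have Gc := cdiff_cont dG; move: dF dG => [k Fk] [l Gl].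
exists (k * G w + F w * l) => e e0.
pose D := normc (G w) + 1 + normc k + normc (F w).
have [[n1 n2] n3] := (normc_ge0 (G w), normc_ge0 k, normc_ge0 (F w)).
have D0 : 0 < D by rewrite /D; lra.
have eD : 0 < e / D by exact: divr_gt0.
have [r r0 Fr] := Fk _ eD; have [s s0 Gs] := Gl _ eD.
have [t t0 Gt] := Gc _ eD; have [u u0 Gu] := Gc 1 ltr01.
exists (Num.min (Num.min r s) (Num.min t u)).
  by rewrite !lt_min r0 s0 t0 u0.
move=> h; rewrite !lt_min => /andP[/andP[/Fr hF /Gs hG] /andP[/Gt h1 /Gu h2]].
rewrite (_ : _ - _ - _ = (F (w + h) - F w - k * h) * G (w + h) +
  k * h * (G (w + h) - G w) + F w * (G (w + h) - G w - l * h)); last by ring.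
have h3 : normc (G (w + h)) <= normc (G w) + 1.
  rewrite -(subrK (G w) (G (w + h))) addrC.
  by apply: (le_trans (le_normcD _ _)); rewrite lerD2l.
apply: (le_trans (le_normcD _ _)); apply: (@le_trans _ _
  ((e / D * normc h) * (normc (G w) + 1) + normc k * normc h * (e / D) +
   normc (F w) * (e / D * normc h))).
  apply: lerD; last by rewrite Normc.normcM ler_wpM2l.
  apply: (le_trans (le_normcD _ _)); rewrite !Normc.normcM; apply: lerD.
    by apply: ler_pM; rewrite ?normc_ge0.
  by rewrite ler_wpM2l// mulr_ge0// normc_ge0.
rewrite (_ : _ + _ + _ = e / D * D * normc h); last by rewrite /D; ring.
by rewrite divfK// gt_eqF.
Qed.

Lemma cdiffV F w : cdiff F w -> F w != 0 -> cdiff (fun z => (F z)^-1) w.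
Proof.
move=> dF Fw0; have Fc := cdiff_cont dF; move: dF => [k Fk].
have n0 : 0 < normc (F w) by rewrite normc_gt0.
exists (- k / (F w) ^+ 2) => e e0.
pose N := normc (F w).
have [r r0 Fr] := Fc (N / 2) (divr_gt0 n0 (ltr0n _ 2)).
have e1 : 0 < e * N ^+ 2 / 4 by rewrite divr_gt0// mulr_gt0// exprn_gt0.
have [s s0 Fs] := Fk _ e1.
have e2 : 0 < e * N ^+ 3 / (4 * (normc k + 1)).
  have k1 : 0 < normc k + 1 by rewrite ltr_wpDl ?normc_ge0.
  by rewrite divr_gt0 ?mulr_gt0 ?exprn_gt0.
have [t t0 Ft] := Fc _ e2.
exists (Num.min r (Num.min s t)); first by rewrite !lt_min r0 s0.
move=> h; rewrite !lt_min => /and3P[/Fr h1 /Fs h2 /Ft h3].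
have NF : N / 2 <= normc (F (w + h)).
  have := normc_triangle (F (w + h)) (F w) 0; rewrite !subr0 (normcBC (F w)).
  by rewrite -/N; lra.
have Fh0 : F (w + h) != 0 by rewrite -normc_gt0 (lt_le_trans _ NF)// divr_gt0.
have {}n0 : 0 < N by [].
rewrite (_ : _ - _ - _ = (k * h * (F (w + h) - F w) -
    F w * (F (w + h) - F w - k * h)) * (F w ^- 2 * (F (w + h))^-1)); last first.
  by field; rewrite ?Fw0 ?Fh0.
rewrite Normc.normcM.
have P1 : normc (k * h * (F (w + h) - F w) -
    F w * (F (w + h) - F w - k * h)) <= e * N ^+ 3 / 2 * normc h.
  apply: (le_trans (le_normcB _ _)); rewrite !Normc.normcM -/N.
  apply: (@le_trans _ _ (normc k * normc h * (e * N ^+ 3 / (4 * (normc k + 1))) +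
     N * (e * N ^+ 2 / 4 * normc h))).
    by apply: lerD; apply: ler_wpM2l => //; rewrite ?mulr_ge0 ?normc_ge0.
  have k1 : 0 < normc k + 1 by rewrite ltr_wpDl ?normc_ge0.
  have -> : normc k * normc h * (e * N ^+ 3 / (4 * (normc k + 1))) =
      e * N ^+ 3 / 4 * normc h * (normc k / (normc k + 1)).
    by field; rewrite gt_eqF.
  have -> : N * (e * N ^+ 2 / 4 * normc h) = e * N ^+ 3 / 4 * normc h * 1 by ring.
  rewrite -mulrDr (_ : e * N ^+ 3 / 2 * normc h = e * N ^+ 3 / 4 * normc h * 2);
    last by field.
  apply: ler_wpM2l; first by rewrite mulr_ge0 ?normc_ge0// divr_ge0// mulr_ge0 ?exprn_ge0 ?ltW.
  rewrite (_ : 2 = 1 + 1 :> R)// lerD2r ler_pdivrMr// mul1r lerDl//.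
have P2 : normc (F w ^- 2 * (F (w + h))^-1) <= 2 / N ^+ 3.
  rewrite Normc.normcM !Normc.normcV normcX -/N.
  rewrite (_ : 2 / N ^+ 3 = N ^- 2 * (N / 2)^-1); last by field; rewrite gt_eqF.
  apply: ler_wpM2l; first by rewrite invr_ge0 exprn_ge0// ltW.
  by rewrite lef_pV2 ?posrE ?divr_gt0// normc_gt0.
apply: (le_trans (ler_pM _ _ P1 P2)); rewrite ?normc_ge0//.
rewrite le_eqVlt; apply/orP; left; apply/eqP; field; rewrite gt_eqF//.
Qed.

Lemma cdiffX F w k : cdiff F w -> cdiff (fun z => F z ^+ k) w.
Proof.
move=> dF; elim: k => [|k IHk]; first exact: cdiff_cst.
by rewrite (_ : (fun z => _) = (fun z => F z * F z ^+ k)); [exact: cdiffM|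
  apply/funext => z; rewrite exprS].
Qed.

Lemma cdiff_div_pole F (l w : R[i]) : cdiff F w -> w != l ->
  cdiff (fun z => F z / (z - l)) w.
Proof.
move=> dF wl; apply: cdiffM => //; apply: cdiffV; last by rewrite subr_eq0.
by apply: cdiffB; [exact: cdiff_id|exact: cdiff_cst].
Qed.

Lemma le_rint F a b c d (M : R) : a <= b -> c <= d -> bdry_cont F a b c d ->
  (forall x y : R, a <= x <= b -> c <= y <= d ->
    [|| x == a, x == b, y == c | y == d] -> normc (F (x +i* y)) <= M) ->
  normc (rint F a b c d) <= 4 * M * ((b - a) + (d - c)).
Proof.
move=> ab cd Fc FM; apply: (@rint_affine_le _ F a b c d 0 0) => // x y ? ? ?.
by rewrite mul0r addr0 subr0; exact: FM.
Qed.

Lemma rintB F G a b c d : a <= b -> c <= d -> bdry_cont F a b c d ->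
  bdry_cont G a b c d -> bdry_cont (fun w => F w - G w) a b c d ->
  rint (fun w => F w - G w) a b c d = rint F a b c d - rint G a b c d.
Proof.
move=> ab cd Fc Gc FGc; rewrite !rintE//.
have [? ? ? ?] := bdry_path ab cd Fc; have [? ? ? ?] := bdry_path ab cd Gc.
by rewrite ![in LHS]cintB//; ring.
Qed.

Lemma rintMl k F a b c d : a <= b -> c <= d -> bdry_cont F a b c d ->
  rint (fun w => k * F w) a b c d = k * rint F a b c d.
Proof.
move=> ab cd Fc; rewrite /rint; have [? ? ? ?] := bdry_path ab cd Fc.
rewrite (_ : (fun x => _ - _) = fun x => k * (F (x +i* c) - F (x +i* d))); last first.
  by apply/funext => x; rewrite mulrBr.
rewrite [in X in 'i * X](_ : (fun x => _ - _) =
    fun y => k * (F (b +i* y) - F (a +i* y))); last first.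
  by apply/funext => y; rewrite mulrBr.
by rewrite !cintMl; [ring|exact: pcontB..].
Qed.

(** The strips to the left and right of the small square, then those below and above it, avoid the
    singular point, and [goursat] applies to each. *)
Lemma rint_shrink F a b c d (p q e : R) : 0 < e ->
  a < p - e -> p + e < b -> c < q - e -> q + e < d ->
  (forall x y : R, a <= x <= b -> c <= y <= d -> x +i* y != p +i* q ->
    cdiff F (x +i* y)) ->
  rint F a b c d = rint F (p - e) (p + e) (q - e) (q + e).
Proof.
move=> e0 ap pb cq qd Fd.
have Fc (x y : R) : a <= x <= b -> c <= y <= d -> ~ (x = p /\ y = q) ->
    ccont F (x +i* y).
  move=> ? ? xy; apply: cdiff_cont; apply: Fd => //.
  by apply/eqP => -[xp yq]; apply: xy.
rewrite (@rint_hsplit _ F a b c d (p - e)); first last.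
- by move=> x y ? ? H; apply: Fc => // -[? ?]; case/or4P: H => [|||/orP[]] /eqP ?; lra.
- lra.
- by apply/andP; split; lra.
rewrite (@rint_hsplit _ F (p - e) b c d (p + e)); first last.
- move=> x y /andP[? ?] ? H; apply: Fc => //; first by apply/andP; split; lra.
  by case => ? ?; case/or4P: H => [|||/orP[]] /eqP ?; lra.
- lra.
- by apply/andP; split; lra.
rewrite (@rint_vsplit _ F (p - e) (p + e) c d (q - e)); first last.
- move=> x y /andP[? ?] ? H; apply: Fc => //; first by apply/andP; split; lra.
  by case => ? ?; case/or4P: H => [|||/orP[]] /eqP ?; lra.
- by apply/andP; split; lra.
- lra.
rewrite (@rint_vsplit _ F (p - e) (p + e) (q - e) d (q + e)); first last.
- move=> x y /andP[? ?] /andP[? ?] H; apply: Fc; try (by apply/andP; split; lra).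
  by case => ? ?; case/or4P: H => [|||/orP[]] /eqP ?; lra.
- by apply/andP; split; lra.
- lra.
have Z a' b' c' d' : a <= a' -> a' <= b' -> b' <= b -> c <= c' -> c' <= d' -> d' <= d ->
    [|| b' < p, p < a', d' < q | q < c'] -> rint F a' b' c' d' = 0.
  move=> ? ? ? ? ? ? out; apply: goursat => // x y /andP[? ?] /andP[? ?]; apply: Fd.
  - by apply/andP; split; lra.
  - by apply/andP; split; lra.
  - by apply/eqP => -[? ?]; case/or4P: out => ?; lra.
rewrite (Z a (p - e)) ?(Z (p + e) b) ?(Z _ _ c (q - e)) ?(Z _ _ (q + e) d).
  by rewrite !addr0 !add0r.
all: lra.
Qed.

(** The primitive 2 atan ((x - p) / e) runs from -pi/2 to pi/2. Each pair of opposite sides of a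
    square contributes i times this value to the integral of 1 / (w - l), l being the centre. *)
Lemma int_atan (p e : R) : 0 < e ->
  (\int[lebesgue_measure]_(x in `[(p - e)%R, (p + e)%R]) (2 * e / ((x - p) ^+ 2 + e ^+ 2)))%R = pi.
Proof.
move=> e0; pose F (x : R) := 2 * atan ((x - p) / e).
have dF (x : R) : is_derive x (1 : R) F (2 * e / ((x - p) ^+ 2 + e ^+ 2)).
  rewrite /F; apply: is_derive_eq; rewrite /GRing.scale /=.
  have en0 : e != 0 by rewrite gt_eqF.
  have [h1 h2] := (sqr_ge0 (x - p), exprn_gt0 2 e0).
  have s0 : (x - p) ^+ 2 + e ^+ 2 != 0 by rewrite gt_eqF//; lra.
  have -> : 1 + ((x - p) / e) ^+ 2 = ((x - p) ^+ 2 + e ^+ 2) / e ^+ 2 by field.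
  by rewrite invf_div mulr0 add0r subr0; field; rewrite en0 s0.
have cF : continuous F.
  by move=> x; apply: differentiable_continuous; apply/derivable1_diffP; case: (dF x).
rewrite /Rintegral (@continuous_FTC2 _ _ F).
- have e1 : (p + e - p) / e = 1 by field; rewrite gt_eqF.
  have e2 : (p - e - p) / e = - 1 by field; rewrite gt_eqF.
  by rewrite /F e1 e2 atanN atan1 -EFinB /=; field.
- lra.
- apply: continuous_subspaceT => x.
  have H : {for x, continuous (fun y : R => (y - p) ^+ 2 + e ^+ 2)}.
    apply: differentiable_continuous; apply/derivable1_diffP.
    by apply: ex_derive.
  apply: cvgM; first exact: cvg_cst.
  apply: cvgV => //; rewrite gt_eqF//.
  by have := sqr_ge0 (x - p); have := exprn_gt0 2 e0; lra.
- split.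
  + by move=> x _; case: (dF x).
  + by apply: cvg_at_right_filter; exact: cF.
  + by apply: cvg_at_left_filter; exact: cF.
- by move=> x _; rewrite derive1E; case: (dF x).
Qed.

Lemma rint_pole (p q e : R) : 0 < e ->
  rint (fun w => (w - (p +i* q))^-1) (p - e) (p + e) (q - e) (q + e) =
  2 * pi%:C * 'i.
Proof.
move=> e0; rewrite /rint.
have s0 (x : R) : x ^+ 2 + e ^+ 2 != 0.
  by rewrite gt_eqF//; have := sqr_ge0 x; have := exprn_gt0 2 e0; lra.
have s0' (x : R) : e ^+ 2 + x ^+ 2 != 0 by rewrite addrC.
have Ip (t : R) : t + e - t = e by ring.
have Im (t : R) : t - e - t = - e by ring.
rewrite (@eq_cint _ _ _ _ (fun x => 0 +i* (2 * e / ((x - p) ^+ 2 + e ^+ 2)))); last first.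
  by move=> x _; apply: complexP; rewrite /= Ip Im sqrrN; field; exact: s0.
rewrite [X in _ + 'i * X](@eq_cint _ _ _ _
    (fun y => (2 * e / ((y - q) ^+ 2 + e ^+ 2)) +i* 0)); last first.
  by move=> y _; apply: complexP; rewrite /= Ip Im sqrrN; field; rewrite ?s0 ?s0'.
have int0 (t : R) : (\int[lebesgue_measure]_(x in `[t - e, t + e]) (0 : R))%R = 0.
  by rewrite Rintegral_itv_cst ?mul0r//; lra.
by rewrite /cint /= !int_atan// !int0; apply: complexP => /=; ring.
Qed.

(** After shrinking to a square of half-side e around the pole, [F l] times the integral of the pole
    gives the value. The rest, (F w - F l) / (w - l), is bounded by differentiability at l, and its
    integral is O(e). *)
Theorem cauchy_rect F a b c d (p q : R) : a < p < b -> c < q < d ->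
  (forall x y : R, a <= x <= b -> c <= y <= d -> cdiff F (x +i* y)) ->
  rint (fun w => F w / (w - (p +i* q))) a b c d = 2 * pi%:C * 'i * F (p +i* q).
Proof.
move=> /andP[ap pb] /andP[cq qd] Fd; set l := p +i* q.
have [k Fk] : cdiff F l by apply: Fd; apply/andP; split; exact: ltW.
have [r r0 Fr] := Fk 1 ltr01.
have K0 : 0 < normc k + 1 by rewrite ltr_wpDl ?normc_ge0.
apply/eqP; rewrite -subr_eq0 -normc_eq0 eq_le normc_ge0 andbT.
apply/ler_addgt0Pl => eta eta0; rewrite addr0.
(* The first four bounds keep the square inside the rectangle, the fifth keeps it where the estimate
   of differentiability holds. By the last one, [4 * (normc k + 1)] times the sum [e * 4] of the two
   side lengths is at most [eta]. *)
have [e e0 [[e1 e2 e3 e4] e5 e6]] : exists2 e : R, 0 < e &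
    [/\ [/\ e * 4 <= p - a, e * 4 <= b - p, e * 4 <= q - c & e * 4 <= d - q],
      e * 4 <= r & e * 4 <= eta / (4 * (normc k + 1))].
  pose m := Num.min (Num.min (Num.min (p - a) (b - p)) (Num.min (q - c) (d - q)))
    (Num.min r (eta / (4 * (normc k + 1)))).
  exists (m / 4); first by rewrite divr_gt0// !lt_min !subr_gt0 ap pb cq qd r0
    divr_gt0// mulr_gt0.
  rewrite divfK//; have : m <= m by [].
  by rewrite {2}/m !le_min => /andP[/andP[/andP[-> ->] /andP[-> ->]] /andP[-> ->]].
have Fd' (x y : R) : a <= x <= b -> c <= y <= d -> x +i* y != l ->
    cdiff (fun w => F w / (w - l)) (x +i* y).
  by move=> ? ? ?; apply: cdiff_div_pole => //; exact: Fd.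
rewrite (@rint_shrink _ a b c d p q e)//; try lra.
rewrite -(rint_pole p q e0) mulrC.
have sq (x y : R) : p - e <= x <= p + e -> q - e <= y <= q + e ->
    [|| x == p - e, x == p + e, y == q - e | y == q + e] ->
    [/\ a <= x <= b, c <= y <= d, x +i* y != l & normc (x +i* y - l) < r].
  move=> /andP[? ?] /andP[? ?] H; split.
  - by apply/andP; split; lra.
  - by apply/andP; split; lra.
  - by apply/eqP => -[? ?]; case/or4P: H => /eqP ?; lra.
  - apply: le_lt_trans (ler_normc_ReIm _) _ => /=.
    apply: (@le_lt_trans _ _ (e + e)); last lra.
    by apply: lerD; rewrite ler_norml; apply/andP; split; lra.
have c1 : bdry_cont (fun w => F w / (w - l)) (p - e) (p + e) (q - e) (q + e).
  by move=> x y xp yq H; have [? ? ? _] := sq _ _ xp yq H; exact/cdiff_cont/Fd'.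
have c2 : bdry_cont (fun w => (w - l)^-1) (p - e) (p + e) (q - e) (q + e).
  move=> x y xp yq H; have [? ? ? _] := sq _ _ xp yq H; apply: cdiff_cont.
  rewrite (_ : (fun w => _) = fun w => (fun=> 1) w / (w - l)).
    by apply: cdiff_div_pole => //; exact: cdiff_cst.
  by apply/funext => w; rewrite mul1r.
have c3 : bdry_cont (fun w => F l * (w - l)^-1) (p - e) (p + e) (q - e) (q + e).
  move=> x y xp yq H; have [? ? ? _] := sq _ _ xp yq H; apply: cdiff_cont.
  by apply: cdiff_div_pole => //; exact: cdiff_cst.
have c4 : bdry_cont (fun w => F w / (w - l) - F l * (w - l)^-1)
    (p - e) (p + e) (q - e) (q + e).
  move=> x y xp yq H; have [? ? ? _] := sq _ _ xp yq H; apply: cdiff_cont.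
  by apply: cdiffB; [exact: Fd'|apply: cdiff_div_pole => //; exact: cdiff_cst].
rewrite -rintMl//; [|lra..]; rewrite -rintB//; [|lra..].
apply: (@le_trans _ _ (4 * (normc k + 1) * ((p + e - (p - e)) + (q + e - (q - e))))).
  apply: le_rint => //; [lra|lra|move=> x y xp yq H].
  have [_ _ xyl] := sq _ _ xp yq H; set w := x +i* y in xyl *.
  move=> /Fr; rewrite (addrC l) subrK mul1r => Fw.
  rewrite -mulrBl Normc.normcM Normc.normcV ler_pdivrMr; last first.
    by rewrite normc_gt0 subr_eq0.
  rewrite -(subrK (k * (w - l)) (F w - F l)).
  apply: le_trans (le_normcD _ _) _.
  by rewrite Normc.normcM mulrDl mul1r addrC lerD2l.
rewrite (_ : p + e - (p - e) + (q + e - (q - e)) = e * 4); last by ring.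
rewrite mulrC -ler_pdivlMr//; last by rewrite mulr_gt0.
Qed.

End cauchy.

(** * Taylor expansion and the maximum principle on a square *)

Section taylor.
Context {R : realType}.
Implicit Types (F G : R[i] -> R[i]) (a b c d : R) (w l : R[i]).

Lemma eq_rint F G a b c d : a <= b -> c <= d ->
  (forall x y : R, a <= x <= b -> c <= y <= d ->
    [|| x == a, x == b, y == c | y == d] -> F (x +i* y) = G (x +i* y)) ->
  rint F a b c d = rint G a b c d.
Proof.
move=> ab cd FG; rewrite /rint; congr (_ + 'i * _); apply: eq_cint => t tP.
  by rewrite !FG ?eqxx ?lexx ?cd ?orbT.
by rewrite !FG ?eqxx ?lexx ?ab ?orbT.
Qed.

Let kappa : R[i] := 2 * pi%:C * 'i.

Let normc_kappa : 4 <= normc kappa.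
Proof.
rewrite !Normc.normcM normci mulr1 normc_real (_ : normc 2 = 2); last first.
  by rewrite -[2]/(2%:R) -(rmorph_nat (real_complex R)) normc_real normr_nat.
by rewrite ger0_norm ?pi_ge0//; have := pi_ge2 R; lra.
Qed.

Let kappa0 : kappa != 0.
Proof. by rewrite -normc_gt0 (lt_le_trans _ normc_kappa). Qed.

Definition taylor_coef F k : R[i] :=
  rint (fun w => F w / w ^+ k.+1) (-1) 1 (-1) 1 / (2 * pi%:C * 'i).

Lemma bdry_unit (x y : R) : -1 <= x <= 1 -> -1 <= y <= 1 ->
  [|| x == -1, x == 1, y == -1 | y == 1] -> 1 <= normc (x +i* y).
Proof.
move=> _ _ H; have := ler_Re_normc (x +i* y); have := ler_Im_normc (x +i* y) => /=.
by case/or4P: H => /eqP ->; rewrite ?normrN normr1.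
Qed.

Section expansion.
Variable F : R[i] -> R[i].
Hypothesis Fd : forall x y : R, -1 <= x <= 1 -> -1 <= y <= 1 -> cdiff F (x +i* y).

Let pole_diff l (k : nat) (x y : R) : normc l <= 2^-1 ->
  -1 <= x <= 1 -> -1 <= y <= 1 -> [|| x == -1, x == 1, y == -1 | y == 1] ->
  cdiff (fun w => F w / w ^+ k.+1) (x +i* y) /\
  cdiff (fun w => F w / w ^+ k / (w - l)) (x +i* y).
Proof.
move=> l2 xP yP H; have w1 := bdry_unit xP yP H.
have w0 : x +i* y != 0 by rewrite -normc_gt0 (lt_le_trans ltr01).
have wl : x +i* y != l by apply/eqP => wl; move: l2; rewrite -wl; lra.
have D j : cdiff (fun w => F w / w ^+ j) (x +i* y).
  apply: cdiffM; first exact: Fd.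
  by apply: (@cdiffV _ (fun w => w ^+ j)); [apply: cdiffX; exact: cdiff_id|exact: expf_neq0].
by split; [exact: D|apply: cdiff_div_pole => //; exact: D].
Qed.

(** Starting from Cauchy's formula, 1 / (w - l) = 1 / w + l / (w (w - l)) is used once for each term
    of the expansion. *)
Let expansion_rem l N : normc l <= 2^-1 ->
  kappa * F l = kappa * \sum_(k < N) taylor_coef F k * l ^+ k +
  l ^+ N * rint (fun w => F w / w ^+ N / (w - l)) (-1) 1 (-1) 1.
Proof.
move=> l2; elim: N => [|N IHN].
  rewrite big_ord0 mulr0 add0r expr0 mul1r.
  have [p q] : -1 < complex.Re l < 1 /\ -1 < complex.Im l < 1.
    have := ler_Re_normc l; have := ler_Im_normc l.
    by rewrite !ler_norml => /andP[? ?] /andP[? ?]; split; apply/andP; split; lra.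
  have := @cauchy_rect _ F (-1) 1 (-1) 1 _ _ p q Fd.
  rewrite (_ : _ +i* _ = l); last by case: (l).
  move=> <-; apply: eq_rint => // x y _ _ _; by rewrite expr0 divr1.
rewrite IHN big_ord_recr /= [kappa * (_ + _)]mulrDr -[RHS]addrA; congr (_ + _).
have -> : kappa * (taylor_coef F N * l ^+ N) =
    l ^+ N * rint (fun w => F w / w ^+ N.+1) (-1) 1 (-1) 1.
  by rewrite /taylor_coef -/kappa; field; exact: kappa0.
rewrite exprS (mulrC l) -mulrA -mulrDr; congr (_ * _).
have bc1 : bdry_cont (fun w => F w / w ^+ N / (w - l)) (-1) 1 (-1) 1.
  by move=> x y xP yP H; apply: cdiff_cont; have [] := pole_diff N l2 xP yP H.
have bc2 : bdry_cont (fun w => F w / w ^+ N.+1 / (w - l)) (-1) 1 (-1) 1.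
  by move=> x y xP yP H; apply: cdiff_cont; have [] := pole_diff N.+1 l2 xP yP H.
have bc3 : bdry_cont (fun w => l * (F w / w ^+ N.+1 / (w - l))) (-1) 1 (-1) 1.
  move=> x y xP yP H; apply: cdiff_cont; apply: cdiffM; first exact: cdiff_cst.
  by have [] := pole_diff N.+1 l2 xP yP H.
have bc4 : bdry_cont (fun w => F w / w ^+ N / (w - l) - l * (F w / w ^+ N.+1 / (w - l)))
    (-1) 1 (-1) 1.
  move=> x y xP yP H; apply: cdiff_cont; apply: cdiffB.
    by have [] := pole_diff N l2 xP yP H.
  apply: cdiffM; first exact: cdiff_cst.
  by have [] := pole_diff N.+1 l2 xP yP H.
rewrite -rintMl//; apply/eqP; rewrite -subr_eq -rintB//; apply/eqP.
apply: eq_rint => // x y xP yP H; have w1 := bdry_unit xP yP H.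
have w0 : x +i* y != 0 by rewrite -normc_gt0 (lt_le_trans ltr01).
have wl : x +i* y - l != 0.
  by rewrite subr_eq0; apply/eqP => wl; move: l2; rewrite -wl; lra.
by rewrite exprS; field; rewrite w0 wl expf_neq0.
Qed.

(** On the boundary |w| >= 1 and |w - l| >= 1/2, so the integrand of the remainder is at most 2 M
    and its integral at most 32 M; dividing by |2 pi i| >= 4 gives 8 M. *)
Theorem taylor_expansion (M : R) N l : normc l <= 2^-1 ->
  (forall x y : R, -1 <= x <= 1 -> -1 <= y <= 1 ->
    [|| x == -1, x == 1, y == -1 | y == 1] -> normc (F (x +i* y)) <= M) ->
  normc (F l - \sum_(k < N) taylor_coef F k * l ^+ k) <= 8 * M * normc l ^+ N.
Proof.
move=> l2 FM.
have M0 : 0 <= M.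
  by apply: le_trans (normc_ge0 _) (FM 1 1 _ _ _); rewrite ?eqxx ?lexx ?orbT ?andbT.
have I : normc (rint (fun w => F w / w ^+ N / (w - l)) (-1) 1 (-1) 1) <=
    4 * (2 * M) * ((1 - -1) + (1 - -1)).
  apply: le_rint => //.
    by move=> x y xP yP H; apply: cdiff_cont; have [] := pole_diff N l2 xP yP H.
  move=> x y xP yP H; have w1 := bdry_unit xP yP H.
  have wl : 2^-1 <= normc (x +i* y - l).
    have h := normc_triangle l (x +i* y) 0; move: h; rewrite !subr0 => h; lra.
  rewrite !Normc.normcM !Normc.normcV normcX mulrC; apply: ler_pM.
  - by rewrite invr_ge0 normc_ge0.
  - by rewrite mulr_ge0 ?invr_ge0 ?exprn_ge0 ?normc_ge0.
  - by rewrite -[leRHS]invrK lef_pV2// posrE// (lt_le_trans _ wl)// invr_gt0.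
  - rewrite -[leRHS]mulr1; apply: ler_pM; rewrite ?normc_ge0 ?FM//.
      by rewrite invr_ge0 exprn_ge0 ?normc_ge0.
    by rewrite invf_le1 ?exprn_gt0 ?exprn_ege1 ?(lt_le_trans ltr01).
have /(congr1 (@Normc.normc R)) : kappa * (F l - \sum_(k < N) taylor_coef F k * l ^+ k) =
    l ^+ N * rint (fun w => F w / w ^+ N / (w - l)) (-1) 1 (-1) 1.
  by rewrite mulrBr (expansion_rem N l2) addrAC subrr add0r.
rewrite Normc.normcM [RHS]Normc.normcM normcX => E; rewrite -(@ler_pM2l _ 4)//.
apply: (@le_trans _ _ (normc kappa * normc (F l - \sum_(k < N) taylor_coef F k * l ^+ k))).
  by rewrite ler_wpM2r ?normc_ge0.
rewrite E mulrA (mulrC _ (normc l ^+ N)); apply: ler_wpM2l; first by rewrite exprn_ge0 ?normc_ge0.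
apply: (le_trans I); lra.
Qed.

End expansion.

(** The maximum principle up to the factor 8: the case N = 0 of [taylor_expansion]. *)
Lemma cauchy_max F (M : R) l : normc l <= 2^-1 ->
  (forall x y : R, -1 <= x <= 1 -> -1 <= y <= 1 -> cdiff F (x +i* y)) ->
  (forall x y : R, -1 <= x <= 1 -> -1 <= y <= 1 ->
    [|| x == -1, x == 1, y == -1 | y == 1] -> normc (F (x +i* y)) <= M) ->
  normc (F l) <= 8 * M.
Proof.
move=> l2 Fd FM; have := taylor_expansion Fd 0 l2 FM.
by rewrite big_ord0 subr0 expr0 mulr1.
Qed.

End taylor.

(** * The area mean value inequality *)

Section mean_value.
Context {R : realType}.
Notation leb := (@lebesgue_measure R).
Implicit Types (F G : R[i] -> R[i]) (a b c d : R).

Lemma pcont_normc (g : R -> R[i]) a b : pcont g a b ->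
  {within `[a, b], continuous (@Normc.normc R \o g)}.
Proof.
apply: pcont_within => x y; rewrite ler_norml; apply/andP; split.
  have := normc_triangle x y 0; rewrite !subr0 (normcBC x) => H.
  by have := normc_triangle x y 0; have := normc_triangle y x 0;
    rewrite !subr0 (normcBC x y); lra.
by have := normc_triangle y x 0; rewrite !subr0; lra.
Qed.

Lemma pcont_normc_int (g : R -> R[i]) a b : pcont g a b ->
  leb.-integrable `[a, b] (EFin \o (@Normc.normc R \o g)).
Proof.
move=> gc; apply: continuous_compact_integrable; first exact: segment_compact.
exact: pcont_normc.
Qed.

Lemma le_cint_int (g : R -> R[i]) a b : pcont g a b ->
  ((normc (cint a b g))%:E <=
    2%:E * \int[leb]_(x in `[a, b]) (normc (g x))%:E)%E.
Proof.
move=> gc; have /integrableP[mn _] := pcont_normc_int gc.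
have bnd (L : R[i] -> R) : (forall x, `|L x| <= normc x) ->
    leb.-integrable `[a, b] (EFin \o (L \o g)) ->
    (`|(\int[leb]_(x in `[a, b]) L (g x))%R|%:E <=
     \int[leb]_(x in `[a, b]) (normc (g x))%:E)%E.
  move=> Lle Li; have /integrableP[mL _] := Li.
  rewrite EFin_normr_Rintegral//.
  apply: (le_trans (le_abse_integral leb _ mL)) => //.
  apply: ge0_le_integral => //.
  - exact: measurableT_comp.
  - by move=> x _; rewrite /= lee_fin.
have h1 := bnd _ ler_Re_normc (pcont_intRe gc).
have h2 := bnd _ ler_Im_normc (pcont_intIm gc).
rewrite (_ : 2%:E = (1 + 1)%:E)%E// EFinD ge0_muleDl// mul1e.
apply: le_trans (leeD h1 h2).
by rewrite -EFinD lee_fin; exact: ler_normc_ReIm.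
Qed.

Lemma exists_le_average (h : measurableTypeR R -> \bar R) a b (A e : R) : a < b -> 0 < e ->
  measurable_fun [set: measurableTypeR R] h -> (forall x, 0 <= h x)%E ->
  (\int[leb]_x h x <= A%:E)%E ->
  exists2 t, a <= t <= b & (h t <= ((A + e) / (b - a))%:E)%E.
Proof.
move=> ab e0 mh h0 hA; apply: contrapT => H.
have hK t : a <= t <= b -> (((A + e) / (b - a))%:E <= h t)%E.
  by move=> tab; rewrite leNgt; apply/negP => /ltW ht; apply: H; exists t.
have A0 : 0 <= A.
  by rewrite -lee_fin; apply: le_trans hA; apply: integral_ge0.
have ba : 0 < b - a by rewrite subr_gt0.
suff : ((A + e)%:E <= A%:E)%E by rewrite lee_fin; lra.
apply: le_trans hA; apply: le_trans (ge0_subset_integral leb _ _ mh _ (@subsetT _ `[a, b])) => //.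
apply: (@le_trans _ _ (\int[leb]_(x in `[a, b]) cst ((A + e) / (b - a))%:E x)%E).
  rewrite integral_cst//= lebesgue_measure_itv/= lte_fin ab -EFinB -EFinM.
  by rewrite divfK// gt_eqF.
apply: ge0_le_integral => //.
- by move=> x _; rewrite /= lee_fin; apply: divr_ge0; lra.
- exact: (measurable_funS measurableT).
Qed.

(* Cauchy's formula over the boundary of a rectangle, averaged over the four
   sides independently. *)
Lemma cauchy_area F (p q r : R) (Phi : measurableTypeR R * measurableTypeR R -> \bar R) : 0 < r ->
  (forall x y : R, p - r <= x <= p + r -> q - r <= y <= q + r ->
    cdiff F (x +i* y) /\ Phi (x, y) = (normc (F (x +i* y)))%:E) ->
  measurable_fun [set: measurableTypeR R * measurableTypeR R] Phi ->
  (forall w, 0 <= Phi w)%E ->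
  ((r ^+ 2 * normc (F (p +i* q)))%:E <=
    8%:E * \int[prod_measure leb leb]_w Phi w)%E.
Proof.
move=> r0 FP mPhi Phi0.
have Fd (x y : R) : p - r <= x <= p + r -> q - r <= y <= q + r -> cdiff F (x +i* y).
  by move=> xP yP; have [] := FP x y xP yP.
have PhiE (x y : R) : p - r <= x <= p + r -> q - r <= y <= q + r ->
    Phi (x, y) = (normc (F (x +i* y)))%:E.
  by move=> xP yP; have [] := FP x y xP yP.
have I0 : (0 <= \int[prod_measure leb leb]_w Phi w)%E by exact: integral_ge0.
case EA : (\int[prod_measure leb leb]_w Phi w)%E => [A| |]; last 2 first.
- by rewrite gt0_muley ?leey// lte_fin.
- by move: I0; rewrite EA.
have EF : (\int[leb]_x fubini_F leb Phi x = A%:E)%E by rewrite -EA -fubini_tonelli1.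
have EG : (\int[leb]_y fubini_G leb Phi y = A%:E)%E.
  by rewrite -EF; symmetry; exact: fubini_tonelli.
have F0 x : (0 <= fubini_F leb Phi x)%E by apply: integral_ge0.
have G0 x : (0 <= fubini_G leb Phi x)%E by apply: integral_ge0.
have mF := measurable_fun_fubini_tonelli_F _ mPhi Phi0 : measurable_fun _ (fubini_F leb Phi).
have mG := measurable_fun_fubini_tonelli_G _ mPhi Phi0 : measurable_fun _ (fubini_G leb Phi).
rewrite -EFinM lee_fin; apply/ler_addgt0Pl => e e0.
have e80 : 0 < e / 8 by rewrite divr_gt0.
(* The average of a marginal of [Phi] over a band of width r / 2, with slack. Each side of the
   contour is placed in a band between the distances r / 2 and r from the centre, on a line along
   which the integral of [Phi] is at most [K]. *)
pose K := (A + e / 8) / (r / 2).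
have pick (h : measurableTypeR R -> \bar R) (u v : R) : v - u = r / 2 ->
    measurable_fun [set: measurableTypeR R] h -> (forall x, 0 <= h x)%E ->
    (\int[leb]_x h x = A%:E)%E -> exists2 t : R, u <= t <= v & (h t <= K%:E)%E.
  move=> uv mh h0 hA; rewrite /K -uv; apply: exists_le_average => //; first lra.
  by rewrite hA.
have [a aP Fa] := pick _ (p - r) (p - r / 2) ltac:(lra) mF F0 EF.
have [b bP Fb] := pick _ (p + r / 2) (p + r) ltac:(lra) mF F0 EF.
have [c cP Gc] := pick _ (q - r) (q - r / 2) ltac:(lra) mG G0 EG.
have [d dP Gd] := pick _ (q + r / 2) (q + r) ltac:(lra) mG G0 EG.
move: aP bP cP dP => /andP[a1 a2] /andP[b1 b2] /andP[c1 c2] /andP[d1 d2].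
have ab : a <= b by lra.
have cd : c <= d by lra.
have xin x : a <= x <= b -> p - r <= x <= p + r.
  by move=> /andP[h1 h2]; rewrite (le_trans a1 h1) (le_trans h2 b2).
have yin y : c <= y <= d -> q - r <= y <= q + r.
  by move=> /andP[h1 h2]; rewrite (le_trans c1 h1) (le_trans h2 d2).
set l := p +i* q.
pose G := fun w => F w / (w - l).
have GF (x y : R) : a <= x <= b -> c <= y <= d -> [|| x == a, x == b, y == c | y == d] ->
    [/\ cdiff G (x +i* y) & normc (G (x +i* y)) <= 2 / r * normc (F (x +i* y))].
  move=> xP yP H.
  have wl : r / 2 <= normc (x +i* y - l).
    have hr := ler_Re_normc (x +i* y - l); have hi := ler_Im_normc (x +i* y - l).
    case/or4P: H => /eqP H.
    - apply: le_trans hr => /=; rewrite ler_normr; apply/orP; right; lra.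
    - apply: le_trans hr => /=; rewrite ler_normr; apply/orP; left; lra.
    - apply: le_trans hi => /=; rewrite ler_normr; apply/orP; right; lra.
    - apply: le_trans hi => /=; rewrite ler_normr; apply/orP; left; lra.
  have wl0 : 0 < normc (x +i* y - l) by lra.
  split.
    apply: cdiff_div_pole; last by rewrite -subr_eq0 -normc_gt0.
    by apply: Fd; [exact: xin|exact: yin].
  rewrite Normc.normcM Normc.normcV mulrC ler_wpM2r ?normc_ge0//.
  by rewrite -[2 / r]invf_div lef_pV2 ?posrE//; lra.
have bG : bdry_cont G a b c d.
  by move=> x y xP yP H; apply: cdiff_cont; have [] := GF x y xP yP H.
have [pc pd pa pb] := bdry_path ab cd bG.
have := @cauchy_rect _ F a b c d p q.
have -> : a < p < b.
  by rewrite (le_lt_trans a2) ?(lt_le_trans _ b1)// ?ltrDl ?ltrBlDr ?ltrDl divr_gt0.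
have -> : c < q < d.
  by rewrite (le_lt_trans c2) ?(lt_le_trans _ d1)// ?ltrDl ?ltrBlDr ?ltrDl divr_gt0.
move=> /(_ isT isT) E; have {}E := congr1 (@Normc.normc R) (E _).
have {}E : normc (rint G a b c d) = normc (2 * pi%:C * 'i * F l).
  by apply: E => x y xP yP; apply: Fd; [exact: xin|exact: yin].
have h4 : 4 * normc (F l) <= normc (rint G a b c d).
  rewrite E !Normc.normcM normci mulr1 normc_real (_ : normc 2 = 2); last first.
    by rewrite -[2]/(2%:R) -(rmorph_nat (real_complex R)) normc_real normr_nat.
  rewrite ler_wpM2r ?normc_ge0// ger0_norm ?pi_ge0//; have := pi_ge2 R; lra.
have K0 : 0 <= K.
  by rewrite -lee_fin (le_trans _ Fa).
have side (g1 g2 : R -> R[i]) (P1 P2 : measurableTypeR R -> \bar R) (u v : R) :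
    pcont g1 u v -> pcont g2 u v ->
    measurable_fun [set: measurableTypeR R] P1 -> measurable_fun [set: measurableTypeR R] P2 ->
    (forall x, 0 <= P1 x)%E -> (forall x, 0 <= P2 x)%E ->
    (forall x, u <= x <= v -> ((normc (g1 x))%:E <= (2 / r)%:E * P1 x)%E) ->
    (forall x, u <= x <= v -> ((normc (g2 x))%:E <= (2 / r)%:E * P2 x)%E) ->
    (\int[leb]_x P1 x <= K%:E)%E -> (\int[leb]_x P2 x <= K%:E)%E ->
    normc (cint u v (fun x => g1 x - g2 x)) <= 8 * K / r.
  move=> gc1 gc2 m1 m2 p1 p2 b1' b2' i1 i2.
  have gc : pcont (fun x => g1 x - g2 x) u v by exact: pcontB.
  rewrite -lee_fin; apply: (le_trans (le_cint_int gc)).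
  rewrite (_ : 8 * K / r = 2 * (2 / r * K + 2 / r * K)); last by field; rewrite gt_eqF.
  rewrite EFinM lee_wpmul2l// EFinD !EFinM.
  apply: (@le_trans _ _ (\int[leb]_(x in `[u, v]) ((2 / r)%:E * P1 x + (2 / r)%:E * P2 x))%E).
    apply: ge0_le_integral => //.
    - by move=> x _; rewrite lee_fin normc_ge0.
    - by have /integrableP[] := pcont_normc_int gc.
    - by apply: emeasurable_funD; apply: measurable_funeM;
        exact: (measurable_funS measurableT).
    - move=> x /=; rewrite in_itv/= => xuv.
      apply: le_trans (leeD (b1' _ xuv) (b2' _ xuv)).
      by rewrite -EFinD lee_fin le_normcB.
  have r20 : 0 <= 2 / r by rewrite divr_ge0// ltW.
  rewrite ge0_integralD//.
  - rewrite !ge0_integralZl_EFin//; try exact: (measurable_funS measurableT).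
    apply: leeD; apply: lee_wpmul2l => //.
      by apply: le_trans i1; apply: ge0_subset_integral.
    by apply: le_trans i2; apply: ge0_subset_integral.
  - by move=> x _; rewrite mule_ge0.
  - by apply: measurable_funeM; exact: (measurable_funS measurableT).
  - by move=> x _; rewrite mule_ge0.
  - by apply: measurable_funeM; exact: (measurable_funS measurableT).
have hs : normc (cint a b (fun x => G (x +i* c) - G (x +i* d))) <= 8 * K / r.
  apply: (@side _ _ (fun x => Phi (x, c)) (fun x => Phi (x, d))) => //.
  - exact: measurableT_comp mPhi (pair2_measurable _).
  - exact: measurableT_comp mPhi (pair2_measurable _).
  - move=> x xP; rewrite PhiE ?xin ?yin ?lexx//.
    rewrite -EFinM lee_fin; have [|||//] := GF x c; rewrite ?xP ?eqxx ?orbT ?lexx//.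
  - move=> x xP; rewrite PhiE ?xin ?yin ?lexx ?cd//.
    rewrite -EFinM lee_fin; have [|||//] := GF x d; rewrite ?xP ?eqxx ?orbT ?lexx ?cd//.
have vs : normc (cint c d (fun y => G (b +i* y) - G (a +i* y))) <= 8 * K / r.
  apply: (@side _ _ (fun y => Phi (b, y)) (fun y => Phi (a, y))) => //.
  - exact: measurableT_comp mPhi (pair1_measurable _).
  - exact: measurableT_comp mPhi (pair1_measurable _).
  - move=> y yP; rewrite PhiE ?xin ?yin ?lexx ?ab//.
    rewrite -EFinM lee_fin; have [|||//] := GF b y; rewrite ?yP ?eqxx ?orbT ?lexx ?ab//.
  - move=> y yP; rewrite PhiE ?xin ?yin ?lexx//.
    rewrite -EFinM lee_fin; have [|||//] := GF a y; rewrite ?yP ?eqxx ?orbT ?lexx ?ab//.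
have : 4 * normc (F l) <= 8 * K / r + 8 * K / r.
  apply: (le_trans h4); rewrite /rint; apply: (le_trans (le_normcD _ _)).
  by rewrite Normc.normcM normci mul1r; exact: lerD.
move=> H; have rr : 0 < r ^+ 2 by rewrite exprn_gt0.
have : r ^+ 2 * (4 * normc (F l)) <= r ^+ 2 * (8 * K / r + 8 * K / r) by rewrite ler_pM2l.
rewrite (_ : r ^+ 2 * (8 * K / r + 8 * K / r) = 32 * A + 4 * e); last first.
  by rewrite /K; field; rewrite gt_eqF.
by rewrite mulrCA; lra.
Qed.

End mean_value.

(** * Several variables *)

Section complex_space.
Context {R : realType} {n : nat}.
Local Notation V := 'rV[R[i]]_n.
Implicit Types (z w h : V) (f : V -> R[i]).

(* [`|h|] lives in R[i], with zero imaginary part. *)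
Definition vnorm h : R := complex.Re `|h|.

Lemma vnormE h : `|h| = (vnorm h)%:C.
Proof. by rewrite /vnorm RRe_real// ger0_real. Qed.

Lemma normc_normE (x : R[i]) : `|x| = (normc x)%:C.
Proof. by []. Qed.

Lemma vnorm_ge0 h : 0 <= vnorm h.
Proof. by rewrite -ler0c -vnormE. Qed.

Lemma vnorm0 : vnorm 0 = 0.
Proof. by apply: complexI; rewrite -vnormE normr0. Qed.

Lemma vnormD h w : vnorm (h + w) <= vnorm h + vnorm w.
Proof. by rewrite -lecR rmorphD /= -!vnormE ler_normD. Qed.

Lemma vnormN h : vnorm (- h) = vnorm h.
Proof. by apply: complexI; rewrite -!vnormE normrN. Qed.

Lemma vnormBC h w : vnorm (h - w) = vnorm (w - h).
Proof. by rewrite -vnormN opprB. Qed.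

Lemma vnorm_triangle w z h : vnorm (z - h) <= vnorm (z - w) + vnorm (w - h).
Proof. by rewrite -[z - h](subrKA w); exact: vnormD. Qed.

Lemma vnormZ k h : vnorm (k *: h) = normc k * vnorm h.
Proof. by apply: complexI; rewrite -vnormE normrZ rmorphM /= -vnormE. Qed.

Lemma vnorm_eq0 h : vnorm h = 0 -> h = 0.
Proof. by move=> h0; apply: normr0_eq0; rewrite vnormE h0. Qed.

Lemma vnorm_coord h j : normc (h ord0 j) <= vnorm h.
Proof.
rewrite -lecR -vnormE -normc_normE.
rewrite [leRHS]/(@Num.norm _ _ _)/= mx_normE.
apply: (@le_trans _ _ (`|h (ord0, j).1 (ord0, j).2|%:nng)%:num); first by [].
by rewrite num_le; exact: le_bigmax.
Qed.

Lemma vnorm_le h (M : R) : 0 <= M -> (forall j, normc (h ord0 j) <= M) -> vnorm h <= M.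
Proof.
move=> M0 hM; rewrite -lecR -vnormE.
have M0' : 0 <= M%:C :> R[i] by rewrite ler0c.
rewrite [leLHS]/(@Num.norm _ _ _)/= mx_normE -[leRHS]/((NngNum M0')%:num) num_le.
apply/bigmax_leP; split => [|[i j] _]; rewrite -num_le//=.
by rewrite ord1 normc_normE lecR.
Qed.

(** All estimates are proved in the maximum norm and pass to the Euclidean norm through this
    inequality. *)
Lemma vnorm_le_enorm h : vnorm h <= enorm h.
Proof.
apply: vnorm_le; first exact: sqrtr_ge0.
move=> j; rewrite -(@ger0_norm _ (normc _)) ?normc_ge0// -sqrtr_sqr ler_sqrt.
  by rewrite (bigD1 j)//= lerDl sumr_ge0// => i _; rewrite sqr_ge0.
by apply: sumr_ge0 => i _; rewrite sqr_ge0.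
Qed.

Lemma nbhs_vnormP z (U : set V) :
  nbhs z U <-> exists2 r : R, 0 < r & forall w, vnorm (w - z) < r -> U w.
Proof.
split=> [/(@nbhs_normP R[i] V z U)[e /= e0 eU]|[r r0 rU]].
  have eE : e = (complex.Re e)%:C by rewrite RRe_real// gtr0_real.
  exists (complex.Re e); first by rewrite -ltcR -eE.
  move=> w wz; apply: eU => /=; rewrite distrC vnormE eE ltcR//.
apply/(@nbhs_normP R[i] V z U); exists r%:C => /=; first by rewrite ltcR.
by move=> w /=; rewrite distrC vnormE ltcR => /rU.
Qed.

Lemma open_vnormP (U : set V) z : open U -> U z ->
  exists2 r : R, 0 < r & forall w, vnorm (w - z) < r -> U w.
Proof. by move=> oU Uz; apply/nbhs_vnormP; exact: open_nbhs_nbhs. Qed.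

Definition vdiff f z (L : V -> R[i]) := forall e : R, 0 < e ->
  exists2 r : R, 0 < r & forall h, vnorm h < r ->
    normc (f (z + h) - f z - L h) <= e * vnorm h.

Lemma differentiable_vdiff f z : differentiable f z ->
  exists L : {linear V -> R[i]}, vdiff f z L.
Proof.
move=> df; exists ('d f z) => e e0.
have /eqaddoP := diff_locally df.
move=> /(_ e%:C); rewrite ltcR => /(_ e0) /nbhs_vnormP[r r0 rP].
exists r => // h hr; have := rP h; rewrite subr0 => /(_ hr) /=.
rewrite [X in `|X| <= _](_ : _ = f (z + h) - f z - 'd f z h).
  by rewrite vnormE normc_normE -rmorphM lecR.
by rewrite -[LHS]/(f (h + z) - (f z + 'd f z h)) opprD addrA (addrC h).
Qed.

(** The bound on [L] provides the continuity that a Frechet differential must have. *)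
Lemma vdiff_differentiable f z (L : {linear V -> R[i]}) (C : R) :
  (forall h, normc (L h) <= C * vnorm h) -> vdiff f z L -> differentiable f z.
Proof.
move=> LC fL.
have C0 : 0 < `|C| + 1 by rewrite ltr_wpDl.
have Lc : continuous L.
  move=> x A /(@nbhs_normP R[i] R[i] (L x) A)[e e0 eA]; apply/nbhs_vnormP.
  have eE : e = (complex.Re e)%:C by rewrite RRe_real// gtr0_real.
  have e0' : 0 < complex.Re e by rewrite -ltcR -eE.
  exists (complex.Re e / (`|C| + 1)); first by rewrite divr_gt0.
  move=> w wx; apply: eA => /=; rewrite -linearB normc_normE eE ltcR.
  apply: (le_lt_trans (LC _)); rewrite vnormBC.
  apply: (@le_lt_trans _ _ ((`|C| + 1) * vnorm (w - x))).
    by rewrite ler_wpM2r ?vnorm_ge0// (le_trans (ler_norm C)) ?lerDl.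
  by rewrite mulrC -ltr_pdivlMr.
have fo : f \o shift z = cst (f z) + L +o_ (0 : V) id.
  apply/eqaddoP => e e0; apply/nbhs_vnormP.
  have eE : e = (complex.Re e)%:C by rewrite RRe_real// gtr0_real.
  have e0' : 0 < complex.Re e by rewrite -ltcR -eE.
  have [r r0 rP] := fL _ e0'; exists r => // h; rewrite subr0 => /rP.
  rewrite /= vnormE normc_normE eE -rmorphM lecR => H.
  rewrite [X in normc X <= _](_ : _ = f (z + h) - f z - L h)//.
  by rewrite -[LHS]/(f (h + z) - (f z + L h)) opprD addrA (addrC h).
by apply/diff_locallyP; rewrite (diff_unique Lc fo).
Qed.

Lemma vdiff_line f z e (l : R[i]) (L : {linear V -> R[i]}) :
  vdiff f (z + l *: e) L -> cdiff (fun t => f (z + t *: e)) l.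
Proof.
move=> fL; exists (L e) => eps eps0.
have e1 : 0 < vnorm e + 1 by rewrite ltr_wpDl ?vnorm_ge0.
have [r r0 rP] := fL _ (divr_gt0 eps0 e1).
exists (r / (vnorm e + 1)); first by rewrite divr_gt0.
move=> h hr; have /rP : vnorm (h *: e) < r.
  rewrite vnormZ; apply: (@le_lt_trans _ _ (normc h * (vnorm e + 1))).
    by rewrite ler_wpM2l ?normc_ge0// lerDl.
  by rewrite -ltr_pdivlMr.
rewrite linearZ /= scalerDl addrA => H; rewrite [L e * h]mulrC; apply: (le_trans H).
rewrite vnormZ [leLHS]mulrCA [leRHS]mulrC; apply: ler_wpM2l; first exact: normc_ge0.
by rewrite mulrAC ler_pdivrMr// ler_pM2l// lerDl.
Qed.

Lemma differentiable_line f z e (l : R[i]) :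
  differentiable f (z + l *: e) -> cdiff (fun t => f (z + t *: e)) l.
Proof. by move=> /differentiable_vdiff[L]; exact: vdiff_line. Qed.


Lemma differentiable_cont f z : differentiable f z -> forall e : R, 0 < e ->
  exists2 r : R, 0 < r & forall w, vnorm (w - z) < r -> normc (f w - f z) < e.
Proof.
move=> /differentiable_continuous fc e e0; apply/nbhs_vnormP.
have : nbhs (f z) [set x | normc (x - f z) < e].
  apply/(@nbhs_normP R[i] R[i]); exists e%:C => /=; first by rewrite ltcR.
  by move=> x /=; rewrite normc_normE ltcR normcBC.
exact: fc.
Qed.

End complex_space.

(** * Convergence of complex sequences *)

Section complex_sequences.
Context {R : realType}.
Implicit Types (u v : nat -> R[i]) (l : R[i]).

Definition ccvg u l := forall e : R, 0 < e ->
  exists N, forall k, (N <= k)%N -> normc (u k - l) <= e.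

Lemma ccvg_unique u l l' : ccvg u l -> ccvg u l' -> l = l'.
Proof.
move=> ul ul'; apply/eqP; rewrite -subr_eq0 -normc_eq0 eq_le normc_ge0 andbT.
apply/ler_addgt0Pl => e e0; rewrite addr0.
have e20 : 0 < e / 2 by rewrite divr_gt0.
have [N uN] := ul _ e20; have [N' uN'] := ul' _ e20.
apply: (le_trans (normc_triangle (u (maxn N N')) _ _)).
have := uN _ (leq_maxl N N'); have := uN' _ (leq_maxr N N').
by rewrite (normcBC l); lra.
Qed.

Lemma ccvg_le u l (M : R) : ccvg u l -> (exists N, forall k, (N <= k)%N -> normc (u k) <= M) ->
  normc l <= M.
Proof.
move=> ul [N uM]; apply/ler_addgt0Pl => e e0; have [N' uN'] := ul _ e0.
have := uM _ (leq_maxl N N'); have := uN' _ (leq_maxr N N').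
have := normc_triangle (u (maxn N N')) l 0; rewrite !subr0 (normcBC l); lra.
Qed.

Lemma ccvgD u v l l' : ccvg u l -> ccvg v l' -> ccvg (fun k => u k + v k) (l + l').
Proof.
move=> ul vl e e0; have e20 : 0 < e / 2 by rewrite divr_gt0.
have [N uN] := ul _ e20; have [N' vN'] := vl _ e20.
exists (maxn N N') => k; rewrite geq_max => /andP[/uN uk /vN' vk].
rewrite (_ : _ - _ = (u k - l) + (v k - l')); last by ring.
by apply: (le_trans (le_normcD _ _)); lra.
Qed.

Lemma ccvgMl u l (a : R[i]) : ccvg u l -> ccvg (fun k => a * u k) (a * l).
Proof.
move=> ul e e0; have a1 : 0 < normc a + 1 by rewrite ltr_wpDl ?normc_ge0.
have [N uN] := ul _ (divr_gt0 e0 a1); exists N => k /uN uk.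
rewrite -mulrBr Normc.normcM; apply: (@le_trans _ _ ((normc a + 1) * normc (u k - l))).
  by rewrite ler_wpM2r ?normc_ge0// lerDl.
by rewrite mulrC -ler_pdivlMr.
Qed.

Lemma ccvg_cst l : ccvg (fun=> l) l.
Proof. by move=> e e0; exists 0%N => k _; rewrite subrr Normc.normc0 ltW. Qed.

Lemma real_cauchy (u : nat -> R) : (forall e : R, 0 < e ->
    exists N, forall k m, (N <= k)%N -> (N <= m)%N -> `|u k - u m| <= e) ->
  exists l : R, forall e : R, 0 < e -> exists N, forall k, (N <= k)%N -> `|u k - l| <= e.
Proof.
move=> uC; have : cvgn u.
  apply: cauchy_cvg; apply: cauchy_exP => e e0.
  have e20 : 0 < e / 2 by rewrite divr_gt0.
  have [N uN] := uC _ e20; exists (u N); exists N => // k /= Nk.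
  rewrite /ball /= (le_lt_trans (uN _ _ (leqnn N) Nk))//; lra.
move=> /cvg_ex[l /cvgrPdist_le ul]; exists l => e e0.
have [N _ uN] := ul _ e0; exists N => k Nk; rewrite distrC; exact: uN.
Qed.

Lemma ccauchy u : (forall e : R, 0 < e ->
    exists N, forall k m, (N <= k)%N -> (N <= m)%N -> normc (u k - u m) <= e) ->
  exists l, ccvg u l.
Proof.
move=> uC.
have [a ua] : exists l : R, forall e : R, 0 < e -> exists N, forall k, (N <= k)%N ->
    `|complex.Re (u k) - l| <= e.
  apply: real_cauchy => e e0; have [N uN] := uC e e0; exists N => k m Nk Nm.
  by rewrite -ReB (le_trans (ler_Re_normc _)) ?uN.
have [b ub] : exists l : R, forall e : R, 0 < e -> exists N, forall k, (N <= k)%N ->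
    `|complex.Im (u k) - l| <= e.
  apply: real_cauchy => e e0; have [N uN] := uC e e0; exists N => k m Nk Nm.
  by rewrite -ImB (le_trans (ler_Im_normc _)) ?uN.
exists (a +i* b) => e e0; have e20 : 0 < e / 2 by rewrite divr_gt0.
have [N uN] := ua _ e20; have [N' uN'] := ub _ e20.
exists (maxn N N') => k; rewrite geq_max => /andP[/uN h1 /uN' h2].
by apply: (le_trans (ler_normc_ReIm _)); rewrite ReB ImB /=; lra.
Qed.

End complex_sequences.

(** * Cauchy estimates and uniform limits in several variables *)

Section local_estimates.
Context {R : realType} {n : nat}.
Local Notation V := 'rV[R[i]]_n.
Implicit Types (z w h e : V) (f : V -> R[i]).

Lemma normc_unit_square (x y : R) : -1 <= x <= 1 -> -1 <= y <= 1 ->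
  normc (x +i* y) <= 2.
Proof.
move=> xP yP; apply: (le_trans (ler_normc_ReIm _)) => /=.
have : `|x| <= 1 by rewrite ler_norml.
have : `|y| <= 1 by rewrite ler_norml.
lra.
Qed.

(** Points of the square have modulus at most 2, which is why directions are taken of norm below r /
    2 in the sequel. *)
Lemma line_in_ball z e (r : R) (x y : R) : -1 <= x <= 1 -> -1 <= y <= 1 ->
  vnorm e < r / 2 -> vnorm (z + (x +i* y) *: e - z) < r.
Proof.
move=> xP yP er; rewrite addrAC subrr add0r vnormZ.
have := normc_unit_square xP yP => H.
apply: (@le_lt_trans _ _ (2 * vnorm e)); last lra.
by rewrite ler_wpM2r ?vnorm_ge0.
Qed.

Section bounded_holomorphic.
Variables (f : V -> R[i]) (z : V) (r M : R).
Hypotheses (r0 : 0 < r) (M0 : 0 <= M).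
Hypothesis fd : forall w, vnorm (w - z) < r -> differentiable f w.
Hypothesis fM : forall w, vnorm (w - z) < r -> normc (f w) <= M.

Let lineP e (N : nat) (l : R[i]) : vnorm e < r / 2 -> normc l <= 2^-1 ->
  normc (f (z + l *: e) - \sum_(k < N) taylor_coef (fun t => f (z + t *: e)) k * l ^+ k)
    <= 8 * M * normc l ^+ N.
Proof.
move=> er l2; apply: (@taylor_expansion _ (fun t => f (z + t *: e))) => // x y xP yP.
  by apply: differentiable_line; apply: fd; exact: line_in_ball.
by move=> _; apply: fM; exact: line_in_ball.
Qed.

Let coef0 e : vnorm e < r / 2 -> taylor_coef (fun t => f (z + t *: e)) 0 = f z.
Proof.
move=> er; have := @lineP e 1 0 er; rewrite Normc.normc0 invr_ge0 ler0n => /(_ isT).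
rewrite big_ord_recl big_ord0 addr0 expr0 mulr1 scale0r addr0 expr1 mulr0.
by rewrite le_eqVlt ltNge normc_ge0 orbF normc_eq0 subr_eq0 => /eqP.
Qed.

(** At z + t e with t > 0 small, the Taylor remainder is O(t^2) and that of the differential is
    o(t); the two first-order terms are compared after division by t. *)
Let coef1 e (L : {linear V -> R[i]}) : vdiff f z L -> vnorm e < r / 2 ->
  taylor_coef (fun t => f (z + t *: e)) 1 = L e.
Proof.
move=> fL er; set a := taylor_coef _ _.
apply/eqP; rewrite -subr_eq0 -normc_eq0 eq_le normc_ge0 andbT.
apply/ler_addgt0Pl => eps eps0; rewrite addr0.
have eps20 : 0 < eps / 2 by rewrite divr_gt0.
have : vdiff f (z + 0 *: e) L by rewrite scale0r addr0.
move=> _.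
have e1 : 0 < vnorm e + 1 by rewrite ltr_wpDl ?vnorm_ge0.
have [d d0 fd'] := fL _ (divr_gt0 eps20 e1).
have M1 : 0 < 8 * M + 1 by have := M0; lra.
pose t := Num.min (2^-1) (Num.min (d / (2 * (vnorm e + 1))) (eps / 2 / (8 * M + 1))).
have t0 : 0 < t.
  rewrite !lt_min invr_gt0 ltr0n /=; apply/andP; split; apply: divr_gt0 => //; exact: mulr_gt0.
have : t <= t by [].
rewrite {2}/t !le_min => /and3P[t1 t2 t3].
have nt : normc t%:C = t by rewrite normc_real ger0_norm// ltW.
have := @lineP e 2 t%:C er; rewrite nt => /(_ t1).
rewrite !big_ord_recl big_ord0 /= addr0 coef0// expr0 mulr1 expr1 -/a => H1.
have /fd' : vnorm (t%:C *: e) < d.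
  rewrite vnormZ nt; apply: (@le_lt_trans _ _ (t * (vnorm e + 1))).
    by rewrite ler_wpM2l ?lerDl// ltW.
  rewrite -ltr_pdivlMr//; apply: (le_lt_trans t2).
  by rewrite ltr_pM2l// ltf_pV2 ?posrE ?mulr_gt0//; lra.
rewrite linearZ vnormZ nt => H2.
have H : normc (a - L e) * t <= (eps / 2 + 8 * M * t) * t.
  rewrite -{1}nt -Normc.normcM.
  rewrite (_ : _ * _ = (f (z + t%:C *: e) - f z - t%:C *: L e) -
    (f (z + t%:C *: e) - (f z + a * t%:C))); last first.
    by rewrite -[t%:C *: L e]/(t%:C * L e); ring.
  apply: (le_trans (le_normcB _ _)); rewrite mulrDl; apply: lerD.
    apply: (le_trans H2); rewrite (mulrC t) mulrA ler_wpM2r//; first exact: ltW.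
    by rewrite mulrAC ler_pdivrMr// ler_wpM2l ?lerDl// ltW.
  by rewrite (_ : 8 * M * t * t = 8 * M * t ^+ 2)//; ring.
rewrite ler_pM2r// in H; apply: (le_trans H).
rewrite -lerBrDl (_ : eps - eps / 2 = eps / 2); last by field.
apply: (@le_trans _ _ ((8 * M + 1) * t)).
  by rewrite ler_wpM2r ?lerDl// ltW.
by rewrite mulrC -ler_pdivlMr.
Qed.

(** The direction [e] has norm r / 4. Since t = 4 |h| / r, the Taylor bounds 8 M t and 8 M t^2
    become the bounds with constants 32 and 128 below. *)
Let rescale h : h != 0 -> vnorm h <= r / 8 ->
  exists e, exists t : R, [/\ h = t%:C *: e, vnorm e < r / 2, 0 <= t <= 2^-1 & t = 4 * vnorm h / r].
Proof.
move=> h0 hr.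
have nh : 0 < vnorm h.
  rewrite lt_def vnorm_ge0 andbT; apply: contra h0 => /eqP nh.
  by rewrite (vnorm_eq0 nh).
exists ((r / (4 * vnorm h))%:C *: h), (4 * vnorm h / r); split => //.
- rewrite scalerA -rmorphM /= (_ : _ * _ = 1) ?scale1r//.
  by field; rewrite !gt_eqF.
- rewrite vnormZ normc_real ger0_norm; last by rewrite divr_ge0 ?mulr_ge0 ?ltW.
  have -> : r / (4 * vnorm h) * vnorm h = r / 4 by field; rewrite !gt_eqF.
  by have := r0; lra.
- apply/andP; split; first by rewrite divr_ge0 ?mulr_ge0// ltW.
  by rewrite ler_pdivrMr//; have := r0; lra.
Qed.

Lemma holo_lipschitz h : vnorm h <= r / 8 ->
  normc (f (z + h) - f z) <= 32 * M / r * vnorm h.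
Proof.
have [->|h0 hr] := eqVneq h 0; first by rewrite addr0 subrr Normc.normc0 vnorm0 mulr0.
have [e [t [he er /andP[t0 t2] tE]]] := rescale h0 hr.
have nt : normc t%:C = t by rewrite normc_real ger0_norm.
have := @lineP e 1 t%:C er; rewrite nt => /(_ t2).
rewrite !big_ord_recl big_ord0 /= addr0 coef0// expr0 mulr1 expr1 -he => H.
by apply: (le_trans H); rewrite tE le_eqVlt; apply/orP; left; apply/eqP; field; rewrite gt_eqF.
Qed.

Lemma holo_taylor2 (L : {linear V -> R[i]}) h : vdiff f z L -> vnorm h <= r / 8 ->
  normc (f (z + h) - f z - L h) <= 128 * M / r ^+ 2 * vnorm h ^+ 2.
Proof.
move=> fL; have [->|h0 hr] := eqVneq h 0.
  by rewrite addr0 subrr linear0 subr0 Normc.normc0 vnorm0 expr0n mulr0.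
have [e [t [he er /andP[t0 t2] tE]]] := rescale h0 hr.
have nt : normc t%:C = t by rewrite normc_real ger0_norm.
have := @lineP e 2 t%:C er; rewrite nt => /(_ t2).
rewrite !big_ord_recl big_ord0 /= addr0 coef0// (coef1 fL er) expr0 mulr1 expr1.
rewrite (_ : L e * t%:C = L h); last by rewrite he linearZ mulrC.
rewrite -he opprD addrA => H.
by apply: (le_trans H); rewrite tE le_eqVlt; apply/orP; left; apply/eqP; field; rewrite gt_eqF.
Qed.

(** On the multiple of [h] of norm r / 8 the second-order remainder is at most 2 M, and so is the
    increment of [f]; hence [L] is at most 4 M there, and homogeneity does the rest. *)
Lemma holo_diff_le (L : {linear V -> R[i]}) h : vdiff f z L ->
  normc (L h) <= 32 * M / r * vnorm h.
Proof.
move=> fL; have [->|h0] := eqVneq h 0.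
  by rewrite linear0 Normc.normc0 vnorm0 mulr0.
have nh : 0 < vnorm h.
  rewrite lt_def vnorm_ge0 andbT; apply: contra h0 => /eqP nh.
  by rewrite (vnorm_eq0 nh).
pose k := r / 8 / vnorm h.
have k0 : 0 < k by rewrite !divr_gt0.
have nk : normc k%:C = k by rewrite normc_real ger0_norm// ltW.
have nkh : vnorm (k%:C *: h) = r / 8 by rewrite vnormZ nk divfK// gt_eqF.
have := holo_taylor2 fL (_ : vnorm (k%:C *: h) <= r / 8); rewrite nkh => /(_ (lexx _)).
rewrite (_ : _ * _ ^+ 2 = 2 * M); last by field; rewrite gt_eqF.
have := fM (_ : vnorm (z + k%:C *: h - z) < r).
rewrite addrAC subrr add0r nkh => /(_ ltac:(have := r0; lra)).
have := fM (_ : vnorm (z - z) < r); rewrite subrr vnorm0 => /(_ r0).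
set a := f (z + _); set b := f z => h1 h2 h3.
have : normc (L (k%:C *: h)) <= 4 * M.
  rewrite (_ : L _ = (a - b) - (a - b - L (k%:C *: h))); last by ring.
  have := le_normcB (a - b) (a - b - L (k%:C *: h)); have := le_normcB a b; lra.
rewrite linearZ Normc.normcM nk -ler_pdivlMl// => H; apply: (le_trans H).
by rewrite /k le_eqVlt; apply/orP; left; apply/eqP; field; rewrite !gt_eqF.
Qed.

End bounded_holomorphic.

Lemma vdiffB f g z (L K : {linear V -> R[i]}) : vdiff f z L -> vdiff g z K ->
  vdiff (fun w => f w - g w) z (L \- K).
Proof.
move=> fL gK e e0; have e20 : 0 < e / 2 by rewrite divr_gt0.
have [r r0 rP] := fL _ e20; have [s s0 sP] := gK _ e20.
exists (Num.min r s); first by rewrite lt_min r0.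
move=> h; rewrite lt_min => /andP[/rP h1 /sP h2] /=.
rewrite (_ : _ - _ - _ = (f (z + h) - f z - L h) - (g (z + h) - g z - K h)); last by ring.
by apply: (le_trans (le_normcB _ _)); apply: (le_trans (lerD h1 h2)); rewrite -mulrDl -splitr.
Qed.

(** [holo_diff_le], applied to differences of the sequence, makes the differentials at z a Cauchy
    sequence in each direction. The quadratic remainder bound of [holo_taylor2] is uniform along the
    sequence and passes to the limit. *)
Theorem uniform_limit_differentiable (F : nat -> V -> R[i]) f z (r M : R) : 0 < r ->
  (forall k w, vnorm (w - z) < r -> differentiable (F k) w) ->
  (forall k w, vnorm (w - z) < r -> normc (F k w) <= M) ->
  (forall e : R, 0 < e -> exists N, forall k w, (N <= k)%N -> vnorm (w - z) < r ->
    normc (F k w - f w) <= e) ->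
  differentiable f z.
Proof.
move=> r0 Fd FM Ff.
have zz : vnorm (z - z) < r by rewrite subrr vnorm0.
have M0 : 0 <= M by apply: le_trans (normc_ge0 _) (FM 0%N z zz).
have LP k : exists L : {linear V -> R[i]}, vdiff (F k) z L.
  by apply: differentiable_vdiff; exact: Fd.
pose L k := projT1 (cid (LP k)).
have FL k : vdiff (F k) z (L k) by rewrite /L; case: cid.
have LC h : exists l, ccvg (fun k => L k h) l.
  apply: ccauchy => e e0.
  have h1 : 0 < vnorm h + 1 by rewrite ltr_wpDl ?vnorm_ge0.
  have e1 : 0 < e * r / (64 * (vnorm h + 1)) by rewrite divr_gt0// mulr_gt0.
  have [N FN] := Ff _ e1.
  exists N => k m Nk Nm.
  have D := vdiffB (FL k) (FL m).
  have FB w : vnorm (w - z) < r -> normc (F k w - F m w) <= 2 * (e * r / (64 * (vnorm h + 1))).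
    move=> wz; apply: (le_trans (normc_triangle (f w) _ _)).
    by have := FN k w Nk wz; have := FN m w Nm wz; rewrite (normcBC (F m w)); lra.
  have Fdd w : vnorm (w - z) < r -> differentiable (fun w => F k w - F m w) w.
    by move=> wz; apply: differentiableB; exact: Fd.
  have B0 : 0 <= 2 * (e * r / (64 * (vnorm h + 1))).
    by rewrite mulr_ge0// divr_ge0 ?mulr_ge0 ?ltW.
  have := @holo_diff_le _ z r _ r0 B0 Fdd FB (L k \- L m) h D.
  rewrite /= => H; apply: (le_trans H).
  rewrite (_ : _ * _ = e * (vnorm h / (vnorm h + 1))); last by field; rewrite !gt_eqF.
  by rewrite ler_piMr ?ltW// ltr_pdivrMr// mul1r ltrDl.
pose l h := projT1 (cid (LC h)).
have lP h : ccvg (fun k => L k h) (l h) by rewrite /l; case: cid.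
have lin : linear l.
  move=> a u v; apply: ccvg_unique (lP _) _.
  rewrite (_ : (fun k => _) = fun k => a * L k u + L k v); last first.
    by apply/funext => k; rewrite linearP.
  by apply: ccvgD => //; exact: ccvgMl.
pose ll : {linear V -> R[i]} := HB.pack l (GRing.isLinear.Build _ _ _ _ l lin).
have fz w : vnorm (w - z) < r -> ccvg (fun k => F k w) (f w).
  by move=> wz e e0; have [N FN] := Ff e e0; exists N => k Nk; exact: FN.
apply: (@vdiff_differentiable _ _ f z ll (32 * M / r)).
  move=> h; apply: ccvg_le (lP h) _; exists 0%N => k _.
  exact: (holo_diff_le r0 M0 (Fd k) (FM k)).
move=> e e0.
have M1 : 0 < 128 * M + 1 by lra.
exists (Num.min (r / 8) (e * r ^+ 2 / (128 * M + 1))).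
  by rewrite lt_min !divr_gt0// mulr_gt0// exprn_gt0.
move=> h; rewrite lt_min => /andP[h1 h2].
apply: (@le_trans _ _ (128 * M / r ^+ 2 * vnorm h ^+ 2)).
  apply: (@ccvg_le _ (fun k => F k (z + h) - F k z - L k h)).
    have zh : vnorm (z + h - z) < r by rewrite addrAC subrr add0r; lra.
    apply: ccvgD; last by rewrite -mulN1r; under eq_fun do rewrite -mulN1r; exact: ccvgMl.
    apply: ccvgD; first exact: fz.
    by rewrite -mulN1r; under eq_fun do rewrite -mulN1r; apply: ccvgMl; exact: fz.
  by exists 0%N => k _; apply: (holo_taylor2 r0 M0 (Fd k) (FM k) (FL k)); exact: ltW.
rewrite [vnorm h ^+ 2]expr2 mulrA ler_wpM2r ?vnorm_ge0//.
apply: (@le_trans _ _ ((128 * M + 1) / r ^+ 2 * vnorm h)).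
  by rewrite ler_wpM2r ?vnorm_ge0// ler_wpM2r ?invr_ge0 ?exprn_ge0 ?ltW// ltrDl.
rewrite mulrAC ler_pdivrMr ?exprn_gt0// mulrC -ler_pdivlMr//; exact: ltW.
Qed.

End local_estimates.

(** * Measurability and iterated means *)

Section coordinates.
Context {R : realType} {n : nat}.
Local Notation P2 := (measurableTypeR R * measurableTypeR R)%type.
Local Notation V := 'rV[R[i]]_n.
Local Notation cot := (@complex_of_tuple R n).
Implicit Types (t s : n.-tuple P2) (z w : V).

Definition tuple_of_complex z : n.-tuple P2 :=
  [tuple (complex.Re (z ord0 j), complex.Im (z ord0 j)) | j < n].

Lemma tuple_of_complexK z : cot (tuple_of_complex z) = z.
Proof.
apply/rowP => j; rewrite mxE tnth_mktuple /=.
by case: (z ord0 j).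
Qed.

Definition square (x : P2) (r : R) : set P2 :=
  `[x.1 - r, x.1 + r]%classic `*` `[x.2 - r, x.2 + r]%classic.

Definition tuple_box t (r : R) : set (n.-tuple P2) :=
  [set s | forall j, square (tnth t j) r (tnth s j)].

Lemma measurable_square x (r : R) : measurable (square x r).
Proof. by apply: measurableX; exact: measurable_itv. Qed.

Lemma measurable_tuple_box t (r : R) : measurable (tuple_box t r).
Proof.
apply: (@measurable_box _ _ n (fun j => square (tnth t j) r)) => j.
exact: measurable_square.
Qed.

Lemma tuple_boxP t s (r : R) : tuple_box t r s <->
  forall j, `|(tnth s j).1 - (tnth t j).1| <= r /\ `|(tnth s j).2 - (tnth t j).2| <= r.
Proof.
split=> H j.
  have [/=] := H j; rewrite !in_itv/= => /andP[? ?] /andP[? ?].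
  by split; rewrite ler_norml; apply/andP; split; lra.
have [] := H j; rewrite !ler_norml => /andP[? ?] /andP[? ?].
by split; rewrite /= in_itv/=; apply/andP; split; lra.
Qed.

Lemma tuple_box_vnorm t s (r : R) : 0 <= r -> tuple_box t r s ->
  vnorm (cot s - cot t) <= 2 * r.
Proof.
move=> r0 /tuple_boxP H; apply: vnorm_le; first by rewrite mulr_ge0.
move=> j; rewrite !mxE; apply: (le_trans (ler_normc_ReIm _)) => /=.
by have [] := H j; lra.
Qed.

Lemma lebesgue2n_tuple_box t (r : R) : 0 <= r ->
  lebesgue2n (tuple_box t r) = (((2 * r) ^+ 2) ^+ n)%:E.
Proof.
move=> r0; rewrite /lebesgue2n /tuple_box.
rewrite (@tuple_measure_box _ _ _ _ n (fun j => square (tnth t j) r)); last first.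
  by move=> j; exact: measurable_square.
have L (c : R) : (lebesgue_measure `[(c - r)%R, (c + r)%R]%classic = (2 * r)%:E)%E.
  rewrite lebesgue_measure_itv/= lte_fin; case: ifPn => [_|].
    by rewrite -EFinB; congr EFin; ring.
  rewrite -leNgt => h; congr EFin; lra.
rewrite (eq_bigr (fun=> ((2 * r) ^+ 2)%:E)); last first.
  move=> j _ /=; rewrite /prod_measure /square product_measure1E;
    try exact: measurable_itv.
  have -> : ((2 * r) ^+ 2)%:E = ((2 * r)%:E * (2 * r)%:E)%E by rewrite -EFinM expr2.
  by congr (_ * _)%E; exact: L.
by rewrite prodEFin prodr_const card_ord.
Qed.

Let ratsquare (x : rat * rat) (k : nat) : set P2 :=
  `](ratr x.1 - k.+1%:R^-1), (ratr x.1 + k.+1%:R^-1)[%classic `*`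
  `](ratr x.2 - k.+1%:R^-1), (ratr x.2 + k.+1%:R^-1)[%classic.

Let ratbox (k : n.-tuple (rat * rat) * nat) : set (n.-tuple P2) :=
  [set s | forall j, ratsquare (tnth k.1 j) k.2 (tnth s j)].

(** The sigma-algebra on tuples is generated by coordinates, so the open set is written as the
    countable union of the rational boxes that it contains. *)
Lemma measurable_open (U : set V) : open U -> measurable (cot @^-1` U).
Proof.
move=> oU.
pose F k := if `[< ratbox k `<=` cot @^-1` U >] then ratbox k else set0.
rewrite (_ : cot @^-1` U = \bigcup_k F k).
  apply: countable_bigcupT_measurable; first exact: countableP.
  move=> k; rewrite /F; case: ifP => // _.
  apply: (@measurable_box _ _ n (fun j => ratsquare (tnth k.1 j) k.2)) => j.
  by apply: measurableX; exact: measurable_itv.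
apply/seteqP; split=> [t Ut|t [k _]]; last first.
  by rewrite /F; case: ifPn => [/asboolP kU /kU|].
have [r r0 rU] := open_vnormP oU Ut.
(* Two points of a rational box of half-side d differ by at most 2 d in each real coordinate, hence
   by at most 4 d < r in each complex one. *)
pose m := Num.truncn (4 / r); pose d : R := m.+1%:R^-1.
have d0 : 0 < d by rewrite invr_gt0.
have dr : 4 * d < r.
  rewrite /d -ltr_pdivlMl// invf_plt ?posrE ?mulr_gt0 ?invr_gt0//.
  by rewrite invfM invrK (lt_le_trans (truncnS_gt _)).
have Q (x : R) : exists q : rat, `|x - ratr q| < d.
  have [|q] := @rat_in_itvoo R (x - d) (x + d); first lra.
  rewrite in_itv/= => /andP[? ?]; exists q.
  by rewrite ltr_norml; apply/andP; split; lra.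
pose c : n.-tuple (rat * rat) :=
  [tuple (projT1 (cid (Q (tnth t j).1)), projT1 (cid (Q (tnth t j).2))) | j < n].
have cP j : `|(tnth t j).1 - ratr (tnth c j).1| < d /\
    `|(tnth t j).2 - ratr (tnth c j).2| < d.
  by rewrite tnth_mktuple /=; split; case: cid.
exists (c, m) => //; rewrite /F; case: ifPn => [_|/asboolP []].
  move=> j; have [] := cP j; rewrite !ltr_norml -/d => /andP[? ?] /andP[? ?].
  by split; rewrite /= in_itv/= -/d; apply/andP; split; lra.
move=> s sB; apply: rU; apply: (@le_lt_trans _ _ (4 * d)) => //.
apply: vnorm_le; first by rewrite mulr_ge0// ltW.
move=> j; rewrite !mxE; apply: (le_trans (ler_normc_ReIm _)) => /=.
have [] := cP j; have [/=] := sB j; rewrite !in_itv/= -/d !ltr_norml.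
move=> /andP[? ?] /andP[? ?] /andP[? ?] /andP[? ?].
have : `|(tnth s j).1 - (tnth t j).1| <= 2 * d by rewrite ler_norml; apply/andP; split; lra.
have : `|(tnth s j).2 - (tnth t j).2| <= 2 * d by rewrite ler_norml; apply/andP; split; lra.
lra.
Qed.

Lemma measurable_normc (U : set V) (g : V -> R) : open U ->
  (forall z, U z -> forall e : R, 0 < e ->
    exists2 r : R, 0 < r & forall w, vnorm (w - z) < r -> `|g w - g z| < e) ->
  measurable_fun (cot @^-1` U) (g \o cot).
Proof.
move=> oU gc mU; apply: (measurability _ (RGenOInfty.measurableE R)) => //.
move=> _ [_ [a ->] <-]; rewrite preimage_itvoy.
rewrite (_ : _ `&` _ = cot @^-1` (U `&` [set z | a < g z])); last by [].
apply: measurable_open; rewrite openE => z [Uz az]; apply/nbhs_vnormP.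
have [r r0 rU] := open_vnormP oU Uz.
have e0 : 0 < g z - a by rewrite subr_gt0.
have [s s0 sP] := gc z Uz _ e0.
exists (Num.min r s); first by rewrite lt_min r0.
move=> w; rewrite lt_min => /andP[/rU Uw /sP]; rewrite ltr_norml => /andP[h _].
by split => //=; lra.
Qed.

Lemma holomorphic_normc_cont (U : set V) (f : V -> R[i]) : holomorphic U f ->
  forall z, U z -> forall e : R, 0 < e ->
    exists2 r : R, 0 < r & forall w, vnorm (w - z) < r -> `|normc (f w) - normc (f z)| < e.
Proof.
move=> hf z Uz e e0; have [r r0 rP] := differentiable_cont (hf z Uz) e0.
exists r => // w /rP h; rewrite ltr_norml.
have := normc_triangle (f z) (f w) 0; have := normc_triangle (f w) (f z) 0.
by rewrite !subr0 (normcBC (f z)) => h1 h2; apply/andP; split; lra.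
Qed.

Lemma measurable_holomorphic (U : set V) (f : V -> R[i]) : open U -> holomorphic U f ->
  measurable_fun (cot @^-1` U) (fun t => normc (f (cot t))).
Proof.
move=> oU hf; apply: (@measurable_normc U (fun w => normc (f w))) => //.
exact: holomorphic_normc_cont.
Qed.

End coordinates.

Section iterated.
Context {R : realType}.
Local Notation P2 := (measurableTypeR R * measurableTypeR R)%type.
Local Notation leb := (@lebesgue_measure R).

Definition tuple_set n (s : n.-tuple P2) (i : 'I_n) (a : P2) : n.-tuple P2 :=
  [tuple if j == i then a else tnth s j | j < n].

Lemma measurable_tuple_set n (s : n.-tuple P2) i :
  measurable_fun [set: P2] (tuple_set s i).
Proof.
apply/measurable_fun_tnthP => j; rewrite (_ : _ \o _ = fun a => if j == i then a else tnth s j).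
  by case: eqP => _; [exact: measurable_id|exact: measurable_cst].
by apply/funext => a /=; rewrite tnth_mktuple.
Qed.

Lemma tuple_set_cons0 n (a : P2) (s : n.-tuple P2) b :
  tuple_set (tuple_cons (a, s)) ord0 b = tuple_cons (b, s).
Proof.
apply: eq_from_tnth => j; rewrite tnth_mktuple.
by case: (unliftP ord0 j) => [k|] ->; rewrite ?tnthS ?tnth0.
Qed.

Lemma tuple_set_consS n (a : P2) (s : n.-tuple P2) i b :
  tuple_set (tuple_cons (a, s)) (lift ord0 i) b = tuple_cons (a, tuple_set s i b).
Proof.
apply: eq_from_tnth => j; rewrite tnth_mktuple.
case: (unliftP ord0 j) => [k|] ->; rewrite ?tnthS ?tnth0//.
by rewrite tnth_mktuple (inj_eq lift_inj).
Qed.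

(** Induction on n with Tonelli's theorem. The one-coordinate inequality is assumed at every [s], so
    that it is inherited by the slices obtained by fixing the first coordinate. *)
Lemma iterated_mean n (t : n.-tuple P2) (c : R) (Phi : n.-tuple P2 -> \bar R) :
  0 <= c -> measurable_fun [set: n.-tuple P2] Phi -> (forall s, 0 <= Phi s)%E ->
  (forall s i, (Phi (tuple_set s i (tnth t i)) <=
    c%:E * \int[prod_measure leb leb]_a Phi (tuple_set s i a))%E) ->
  (Phi t <= (c ^+ n)%:E * \int[tuple_measure (prod_measure leb leb) n]_s Phi s)%E.
Proof.
move=> c0; elim: n t Phi => [|n IHn] t Phi mPhi Phi0 H.
  rewrite expr0 mul1e /= integral_dirac// diracE in_setT mul1e.
  by rewrite (tuple0 t).
case/tupleP: t H => a0 t H.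
have consE (a : P2) (s : n.-tuple P2) : [tuple of a :: s] = tuple_cons (a, s) by [].
have mcons (a : P2) : measurable_fun [set: n.-tuple P2] (fun s => Phi (tuple_cons (a, s))).
  apply: (@measurableT_comp _ _ _ _ _ _ Phi _ (fun s => tuple_cons (a, s))) => //.
  apply: (@measurableT_comp _ _ _ _ _ _ (@tuple_cons _ _ n)); first exact: measurable_tuple_cons.
  exact: pair1_measurable.
have mc : measurable_fun [set: P2 * n.-tuple P2] (Phi \o @tuple_cons _ _ n).
  by apply: measurableT_comp => //; exact: measurable_tuple_cons.
have step (a : P2) : (Phi (tuple_cons (a, t)) <=
    (c ^+ n)%:E * \int[tuple_measure (prod_measure leb leb) n]_s Phi (tuple_cons (a, s)))%E.
  apply: (IHn t (fun s => Phi (tuple_cons (a, s)))) => // s i.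
  have := H (tuple_cons (a, s)) (lift ord0 i); rewrite tuple_set_consS tnthS => h.
  apply: (le_trans h); rewrite le_eqVlt; apply/orP; left; apply/eqP; congr (_ * _)%E.
  by apply: eq_integral => b _; rewrite tuple_set_consS.
have := H (tuple_cons (a0, t)) ord0; rewrite tuple_set_cons0 tnth0 => h.
apply: (le_trans h); rewrite exprS EFinM -muleA lee_wpmul2l ?lee_fin//.
rewrite [X in (_ * X)%E](_ : _ =
    \int[prod_measure leb leb]_a \int[tuple_measure (prod_measure leb leb) n]_s
      Phi (tuple_cons (a, s)))%E; last first.
  rewrite /= /cons_measure ge0_integral_pushforward//; last exact: measurable_tuple_cons.
  rewrite preimage_setT; apply: fubini_tonelli1 => //.
  by move=> x; exact: Phi0.
have cn : 0 <= c ^+ n by rewrite exprn_ge0.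
have mI : measurable_fun [set: P2] (fun a =>
    \int[tuple_measure (prod_measure leb leb) n]_s Phi (tuple_cons (a, s)))%E.
  apply: (@measurable_fun_fubini_tonelli_F _ _ _ _ _
    (tuple_measure (prod_measure leb leb) n) _ mc) => x; exact: Phi0.
rewrite -ge0_integralZl_EFin//; last by move=> a _; apply: integral_ge0.
apply: ge0_le_integral => //.
- rewrite (_ : (fun _ => _) = fun a => Phi (tuple_cons (a, t))); last first.
    by apply/funext => a; rewrite tuple_set_cons0.
  apply: (@measurableT_comp _ _ _ _ _ _ (Phi \o @tuple_cons _ _ n) _ (fun a => (a, t))) => //.
- exact: measurable_funeM.
- by move=> a _; rewrite tuple_set_cons0; exact: step.
Qed.

End iterated.

(** * Local bounds by integrals *)

Section local_bounds.
Context {R : realType} {n : nat}.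
Local Notation P2 := (measurableTypeR R * measurableTypeR R)%type.
Local Notation V := 'rV[R[i]]_n.
Local Notation cot := (@complex_of_tuple R n).
Notation leb := (@lebesgue_measure R).
Implicit Types (t s : n.-tuple P2) (z w : V) (U : set V) (f : V -> R[i]).

Lemma complex_of_tuple_set s i (x y : R) :
  cot (tuple_set s i (x, y)) = cot (tuple_set s i (0, 0)) + (x +i* y) *: delta_mx ord0 i.
Proof.
apply/rowP => j; rewrite !mxE !tnth_mktuple /=.
by case: eqP => _; rewrite ?mulr1 ?mulr0 ?addr0//; apply: complexP => /=; rewrite add0r.
Qed.

Lemma holomorphic_box_measurable U f t (r : R) : open U -> holomorphic U f ->
  (forall s, tuple_box t r s -> U (cot s)) ->
  measurable_fun (tuple_box t r) (fun s => normc (f (cot s))).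
Proof.
move=> oU hf tU; apply: (measurable_funS _ _ (measurable_holomorphic oU hf)) => //.
exact: measurable_open.
Qed.

(** [cauchy_area] in each coordinate, combined by [iterated_mean]. *)
Theorem holomorphic_L1_bound U f t (r : R) : 0 < r -> open U -> holomorphic U f ->
  (forall s, tuple_box t r s -> U (cot s)) ->
  ((normc (f (cot t)))%:E <=
   ((8 / r ^+ 2) ^+ n)%:E * \int[lebesgue2n]_(s in tuple_box t r) (normc (f (cot s)))%:E)%E.
Proof.
move=> r0 oU hf tU.
pose g s := (normc (f (cot s)))%:E.
pose Phi := g \_ (tuple_box t r).
have tt : tuple_box t r t by apply/tuple_boxP => j; rewrite !subrr normr0 ltW.
have PhiE s : tuple_box t r s -> Phi s = (normc (f (cot s)))%:E.
  by move=> st; rewrite /Phi patchE mem_set.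
have Phi0 s : (0 <= Phi s)%E.
  by rewrite /Phi patchE; case: ifP => // _; rewrite lee_fin normc_ge0.
have mPhi : measurable_fun [set: n.-tuple P2] Phi.
  have mg : measurable_fun (tuple_box t r) g.
    by apply/measurable_EFinP; exact: holomorphic_box_measurable hf tU.
  exact: (measurable_restrictT g (measurable_tuple_box t r)).1 mg.
rewrite integral_mkcond -/Phi -(PhiE t tt).
apply: iterated_mean => //; first by rewrite divr_ge0// sqr_ge0.
move=> s i.
have mPs : measurable_fun [set: P2] (fun a => Phi (tuple_set s i a)).
  by apply: (measurableT_comp mPhi); exact: measurable_tuple_set.
(* If another coordinate leaves its square, the left side is 0, since [Phi] is extended by 0 outside
   the box. *)
have [sP|sN] := pselect (forall j, j != i -> square (tnth t j) r (tnth s j)); last first.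
  rewrite {1}/Phi patchE memNset ?mule_ge0 ?lee_fin ?divr_ge0 ?sqr_ge0 ?integral_ge0//.
  move=> H; apply: sN => j ji; have := H j.
  by rewrite tnth_mktuple (negbTE ji).
have inb (x y : R) : (tnth t i).1 - r <= x <= (tnth t i).1 + r ->
    (tnth t i).2 - r <= y <= (tnth t i).2 + r -> tuple_box t r (tuple_set s i (x, y)).
  move=> xP yP j; rewrite tnth_mktuple; case: eqP => [->|/eqP ji]; last exact: sP.
  by split; rewrite /= in_itv.
pose F (l : R[i]) := f (cot (tuple_set s i (0, 0)) + l *: delta_mx ord0 i).
have FE (x y : R) : F (x +i* y) = f (cot (tuple_set s i (x, y))).
  by rewrite /F -complex_of_tuple_set.
have := @cauchy_area _ F (tnth t i).1 (tnth t i).2 r (fun a => Phi (tuple_set s i a)) r0.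
have h (x : R) : x - r <= x <= x + r by apply/andP; split; lra.
have -> : F ((tnth t i).1 +i* (tnth t i).2) = f (cot (tuple_set s i (tnth t i))).
  by rewrite FE -surjective_pairing.
move=> H; have {}H := H _ mPs (fun=> Phi0 _).
rewrite PhiE; last by rewrite [tnth t i]surjective_pairing; apply: inb.
have r2 : 0 < r ^+ 2 by rewrite exprn_gt0.
set X := normc _ in H *.
have -> : X%:E = ((r ^+ 2)^-1%:E * (r ^+ 2 * X)%:E)%E by rewrite -EFinM mulKf// gt_eqF.
have -> : (8 / r ^+ 2)%:E = ((r ^+ 2)^-1%:E * 8%:E)%E by rewrite -EFinM mulrC.
rewrite -muleA; apply: lee_wpmul2l; first by rewrite lee_fin invr_ge0 ltW.
apply: H.
move=> x y xP yP; split; last by rewrite PhiE ?FE//; exact: inb.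
apply: differentiable_line; rewrite -complex_of_tuple_set; apply: hf.
by apply: tU; exact: inb.
Qed.

Lemma le_1_powR (x P : R) : 0 <= x -> 1 <= P -> x <= 1 + x `^ P.
Proof.
move=> x0 P1; have [x1|/ltW x1] := leP x 1.
  by rewrite (le_trans x1)// lerDl powR_ge0.
by rewrite -{1}(powRr1 x0) (le_trans (ler_powR x1 P1))// lerDr.
Qed.

(** Here x <= 1 + x^P, applied to |f| / k with k = I^(1/P), does the work of Hoelder's inequality:
    the integral of |f| over the box of volume v is at most k v + (k / I) I = k (v + 1). *)
Theorem holomorphic_Lp_bound (r P : R) : 0 < r -> 1 <= P ->
  exists2 C : R, 0 < C & forall U f t (I : R), open U -> holomorphic U f ->
    (forall s, tuple_box t r s -> U (cot s)) -> 0 < I ->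
    (\int[lebesgue2n]_(s in tuple_box t r) (normc (f (cot s)) `^ P)%:E <= I%:E)%E ->
    normc (f (cot t)) <= C * I `^ P^-1.
Proof.
move=> r0 P1; pose v := ((2 * r) ^+ 2) ^+ n; have P0 : 0 < P by lra.
have v0 : 0 <= v by rewrite exprn_ge0// sqr_ge0.
have K0 : 0 < (8 / r ^+ 2) ^+ n by rewrite exprn_gt0// divr_gt0// exprn_gt0.
exists ((8 / r ^+ 2) ^+ n * (v + 1)); first by rewrite mulr_gt0// ltr_wpDl.
move=> U f t I oU hf tU I0 fI.
have mf := holomorphic_box_measurable oU hf tU.
rewrite -lee_fin; apply: (le_trans (holomorphic_L1_bound r0 oU hf tU)).
rewrite -mulrA [leRHS]EFinM; apply: lee_wpmul2l; first by rewrite lee_fin ltW.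
pose k := I `^ P^-1; have k0 : 0 < k by rewrite powR_gt0.
have kP : k `^ P = I by rewrite -powRrM mulVf ?gt_eqF// powRr1// ltW.
have kVP : k^-1 `^ P = I^-1.
  by rewrite -powR_inv1 ?ltW// -powRrM mulrC powRrM kP powR_inv1 ?ltW.
have mfP : measurable_fun (tuple_box t r) (fun s => normc (f (cot s)) `^ P).
  by apply: (measurableT_comp (measurable_powR P)).
apply: (@le_trans _ _ (\int[lebesgue2n]_(s in tuple_box t r)
    (k%:E + (k / I)%:E * (normc (f (cot s)) `^ P)%:E))%E).
  apply: ge0_le_integral => //.
  - exact: measurable_tuple_box.
  - by move=> s _; rewrite lee_fin normc_ge0.
  - exact/measurable_EFinP.
  - apply: emeasurable_funD => //; apply: measurable_funeM; exact/measurable_EFinP.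
  - move=> s _; rewrite -EFinM -EFinD lee_fin.
    have := @le_1_powR (normc (f (cot s)) / k) P (divr_ge0 (normc_ge0 _) (ltW k0)) P1.
    rewrite powRM ?normc_ge0 ?invr_ge0 ?(ltW k0)// kVP ler_pdivrMr// => h.
    by apply: (le_trans h); rewrite le_eqVlt; apply/orP; left; apply/eqP; ring.
rewrite ge0_integralD//; last 4 first.
- exact: measurable_tuple_box.
- by move=> s _; rewrite lee_fin ltW.
- by move=> s _; rewrite -EFinM lee_fin mulr_ge0 ?powR_ge0// divr_ge0 ?ltW.
- by apply: measurable_funeM; exact/measurable_EFinP.
rewrite integral_cst; last exact: measurable_tuple_box.
rewrite ge0_integralZl_EFin//; last 4 first.
- exact: measurable_tuple_box.
- by move=> s _; rewrite lee_fin powR_ge0.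
- exact/measurable_EFinP.
- by rewrite divr_ge0 ?ltW.
apply: (@le_trans _ _ (k%:E * v%:E + (k / I)%:E * I%:E)%E).
  apply: leeD; last by apply: lee_wpmul2l => //; rewrite lee_fin ltW// divr_gt0.
  rewrite le_eqVlt; apply/orP; left; apply/eqP; congr (_ * _)%E.
  exact: lebesgue2n_tuple_box (ltW r0).
by rewrite -!EFinM -EFinD lee_fin divfK ?gt_eqF// -/k; lra.
Qed.

End local_bounds.

(** * Uniform convexity of the p-th power of the modulus *)

Section power_inequalities.
Context {R : realType}.
Implicit Types (x y p r : R) (u v : R[i]).

(** Young's inequality for the product of x and 1, with the exponents p and p / (p - 1). *)
Lemma bernoulli_ge x p : 0 <= x -> 1 <= p -> 1 + p * (x - 1) <= x `^ p.
Proof.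
move=> x0; rewrite le_eqVlt => /predU1P[<-|p1]; first by rewrite powRr1//; lra.
have p0 : 0 < p by lra.
have q0 : 0 < p / (p - 1) by rewrite divr_gt0//; lra.
have pq : p^-1 + (p / (p - 1))^-1 = 1.
  by rewrite invf_div; field; rewrite !gt_eqF//; lra.
have := conjugate_powR x0 ler01 p0 q0 pq.
rewrite powR1 mulr1 invf_div mul1r => h.
have : p * x <= p * (x `^ p / p + (p - 1) / p) by rewrite ler_pM2l.
by rewrite mulrDr !(mulrC p (_ / p)) !divfK ?gt_eqF//; lra.
Qed.

Lemma bernoulli_le x r : 0 <= x -> 0 < r -> r <= 1 -> x `^ r <= 1 + r * (x - 1).
Proof.
move=> x0 r0 r1; have := @bernoulli_ge (x `^ r) r^-1 (powR_ge0 _ _).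
rewrite -powRrM divff ?gt_eqF// powRr1// invf_ge1// => /(_ r1) h.
have : r * (1 + r^-1 * (x `^ r - 1)) <= r * x by rewrite ler_pM2l.
by rewrite mulrDr mulVKf ?gt_eqF//; lra.
Qed.

Lemma powR_rescale x a p : 0 <= x -> 0 < a -> a `^ p * (x / a) `^ p = x `^ p.
Proof.
by move=> x0 a0; rewrite -powRM ?divr_ge0 ?(ltW a0)// mulrC divfK// gt_eqF.
Qed.

Lemma powR_tangent_ge x a p : 0 <= x -> 0 < a -> 1 <= p ->
  a `^ p * (1 + p * (x / a - 1)) <= x `^ p.
Proof.
move=> x0 a0 p1; have := bernoulli_ge (divr_ge0 x0 (ltW a0)) p1.
move=> /(ler_wpM2l (powR_ge0 a p)) h; apply: (le_trans h).
by rewrite powR_rescale.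
Qed.

Lemma powR_tangent_le x a r : 0 <= x -> 0 < a -> 0 < r -> r <= 1 ->
  x `^ r <= a `^ r * (1 + r * (x / a - 1)).
Proof.
move=> x0 a0 r0 r1; have := bernoulli_le (divr_ge0 x0 (ltW a0)) r0 r1.
move=> /(ler_wpM2l (powR_ge0 a r)) h; apply: le_trans h.
by rewrite powR_rescale.
Qed.

(** The linear terms of the two tangent bounds at [A] cancel. *)
Lemma powR_midpoint (A t r : R) : `|t| <= A -> 1 <= r ->
  2 * A `^ r <= (A + t) `^ r + (A - t) `^ r.
Proof.
rewrite ler_norml => /andP[t1 t2] r1.
have [A0|A0] := leP A 0.
  have -> : A = 0 by lra.
  by rewrite powR0 ?mulr0 ?addr_ge0 ?powR_ge0// gt_eqF//; lra.
have h1 := @powR_tangent_ge (A + t) A r ltac:(lra) A0 r1.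
have h2 := @powR_tangent_ge (A - t) A r ltac:(lra) A0 r1.
apply: le_trans (lerD h1 h2); rewrite -mulrDr mulrC ler_wpM2l ?powR_ge0//.
by rewrite le_eqVlt; apply/orP; left; apply/eqP; field; rewrite gt_eqF.
Qed.

(** A + t and A - t are convex combinations of A + T and A - T with exchanged weights; concavity of
    the power, itself read off from the tangent at the intermediate point, is used at both. *)
Lemma powR_concave_spread (A t T r : R) : `|t| <= T -> T <= A -> 0 < r -> r <= 1 ->
  (A + T) `^ r + (A - T) `^ r <= (A + t) `^ r + (A - t) `^ r.
Proof.
move=> tT TA r0 r1.
have concave (a b m al : R) : 0 <= a -> 0 <= b -> 0 <= al <= 1 -> m = al * a + (1 - al) * b ->
    al * a `^ r + (1 - al) * b `^ r <= m `^ r.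
  move=> a0 b0 /andP[al0 al1] mE.
  have m0 : 0 <= m by rewrite mE addr_ge0// mulr_ge0//; lra.
  have [mz|mz] := eqVneq m 0.
    have z1 : 0 <= al * a by rewrite mulr_ge0.
    have z2 : 0 <= (1 - al) * b by rewrite mulr_ge0//; lra.
    have /eqP : al * a = 0 by lra.
    have /eqP : (1 - al) * b = 0 by lra.
    have r00 : r != 0 by rewrite gt_eqF.
    rewrite !mulf_eq0 mz powR0// => /orP[]/eqP-> /orP[]/eqP->;
      by rewrite ?powR0// ?mul0r ?mulr0 ?addr0.
  have {mz}m0 : 0 < m by rewrite lt_def mz.
  have al1' : 0 <= 1 - al by lra.
  have h1 := ler_wpM2l al0 (powR_tangent_le a0 m0 r0 r1).
  have h2 := ler_wpM2l al1' (powR_tangent_le b0 m0 r0 r1).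
  apply: (le_trans (lerD h1 h2)).
  have -> : al * (m `^ r * (1 + r * (a / m - 1))) + (1 - al) * (m `^ r * (1 + r * (b / m - 1)))
      = m `^ r * (1 + r * ((al * a + (1 - al) * b) / m - 1)) by ring.
  by rewrite -mE divff ?gt_eqF// subrr mulr0 addr0 mulr1.
have [T0|T0] := leP T 0.
  have -> : t = 0 by apply/eqP; rewrite -normr_le0 (le_trans tT).
  have -> : T = 0 by have := normr_ge0 t; lra.
  by [].
move: tT; rewrite ler_norml => /andP[t1 t2].
pose al := (1 + t / T) / 2.
have alP : 0 <= al <= 1.
  rewrite /al; have : -1 <= t / T by rewrite ler_pdivlMr//; lra.
  have : t / T <= 1 by rewrite ler_pdivrMr//; lra.
  by move=> ? ?; apply/andP; split; lra.
have h1 := @concave (A + T) (A - T) (A + t) al ltac:(lra) ltac:(lra) alP.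
have h2 := @concave (A - T) (A + T) (A - t) al ltac:(lra) ltac:(lra) alP.
have e1 : A + t = al * (A + T) + (1 - al) * (A - T) by rewrite /al; field; rewrite gt_eqF.
have e2 : A - t = al * (A - T) + (1 - al) * (A + T) by rewrite /al; field; rewrite gt_eqF.
by have := lerD (h1 e1) (h2 e2); lra.
Qed.

Lemma powR_superadd (x y r : R) : 0 <= x -> 0 <= y -> 1 <= r ->
  x `^ r + y `^ r <= (x + y) `^ r.
Proof.
move=> x0 y0 r1; have [s0|s0] := leP (x + y) 0.
  have -> : x = 0 by lra.
  have -> : y = 0 by lra.
  by rewrite addr0 powR0 ?addr0// gt_eqF//; lra.
have part (a : R) : 0 <= a -> a <= x + y -> a `^ r <= (a / (x + y)) * (x + y) `^ r.
  move=> a0 as'; have [->|an] := eqVneq a 0; first by rewrite powR0 ?mul0r// gt_eqF//; lra.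
  have a1 : 0 < a by rewrite lt_def an.
  have /ge1r_powR H : 0 < a / (x + y) <= 1.
    by rewrite divr_gt0//= ler_pdivrMr// mul1r.
  by rewrite -(powR_rescale r a0 s0) mulrC ler_wpM2r ?powR_ge0// H.
apply: (le_trans (lerD (part x x0 _) (part y y0 _))); try lra.
by rewrite -mulrDl -mulrDl divff ?mul1r// gt_eqF.
Qed.

Lemma normc_sqr u : normc u ^+ 2 = complex.Re u ^+ 2 + complex.Im u ^+ 2.
Proof. by case: u => a b; rewrite /Normc.normc sqr_sqrtr// addr_ge0 ?sqr_ge0. Qed.

Lemma powR_sqr x p : 0 <= x -> x `^ p = (x ^+ 2) `^ (p / 2).
Proof.
by move=> x0; rewrite -[x ^+ 2](@powR_mulrn _ x 2)// -powRrM mulrC divfK.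
Qed.

(* [v] below is half the difference of the two values compared and [u] is half
   their sum. Where [u] stays away from 0 the defect controls [|v|^2] for every
   [p > 1]; without that, only [|v|^P] with [P = max p 2]. *)
Definition convexity_defect p u v : R :=
  normc (u + v) `^ p + normc (u - v) `^ p - 2 * normc u `^ p.

(** Twice the real part of u times the conjugate of v. Through |u + v|^2 and |u - v|^2 the defect
    becomes an expression in powers p / 2, convex for p >= 2 and concave for p < 2, in which the
    relative argument of u and v enters only here. *)
Let cross u v : R := 2 * (complex.Re u * complex.Re v + complex.Im u * complex.Im v).

Let defectE p u v : convexity_defect p u v =
  (normc u ^+ 2 + normc v ^+ 2 + cross u v) `^ (p / 2) +
  (normc u ^+ 2 + normc v ^+ 2 - cross u v) `^ (p / 2) - 2 * normc u `^ p.
Proof.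
rewrite /convexity_defect (powR_sqr _ (normc_ge0 (u + v))) (powR_sqr _ (normc_ge0 (u - v))).
congr (_ `^ _ + _ `^ _ - _); rewrite !normc_sqr ?ReD ?ImD ?ReB ?ImB /cross; ring.
Qed.

Let cross_le u v : `|cross u v| <= 2 * (normc u * normc v).
Proof.
have h1 : normc (u + v) ^+ 2 <= (normc u + normc v) ^+ 2.
  by rewrite lerXn2r ?nnegrE ?addr_ge0 ?normc_ge0// le_normcD.
have h2 : normc (u - v) ^+ 2 <= (normc u + normc v) ^+ 2.
  by rewrite lerXn2r ?nnegrE ?addr_ge0 ?normc_ge0// le_normcB.
move: h1 h2; rewrite sqrrD !normc_sqr ReD ImD ReB ImB /cross => h1 h2.
by rewrite ler_norml; apply/andP; split; nra.
Qed.

Let cross_le_sum u v : 2 * (normc u * normc v) <= normc u ^+ 2 + normc v ^+ 2.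
Proof. have := sqr_ge0 (normc u - normc v); rewrite sqrrB; lra. Qed.

(** Convexity of the power p / 2 removes the cross term and leaves 2 (|u|^2 + |v|^2)^(p/2) - 2
    |u|^p. Superadditivity gives the first bound, the tangent at |u|^2 the second. *)
Lemma defect_ge2 p u v : 2 <= p ->
  2 * normc v `^ p <= convexity_defect p u v /\
  (0 < normc u -> p * (normc u `^ p / normc u ^+ 2) * normc v ^+ 2 <= convexity_defect p u v).
Proof.
move=> p2; rewrite defectE; have r1 : 1 <= p / 2 by lra.
have hc : `|cross u v| <= normc u ^+ 2 + normc v ^+ 2.
  exact: le_trans (cross_le _ _) (cross_le_sum _ _).
have h := powR_midpoint hc r1; split.
  have := powR_superadd (sqr_ge0 (normc u)) (sqr_ge0 (normc v)) r1.
  by rewrite -!powR_sqr ?normc_ge0//; lra.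
move=> u0; have u2 : 0 < normc u ^+ 2 by rewrite exprn_gt0.
have := @powR_tangent_ge (normc u ^+ 2 + normc v ^+ 2) _ _ (addr_ge0 (sqr_ge0 _) (sqr_ge0 _)) u2 r1.
rewrite -powR_sqr ?normc_ge0//.
have -> : normc u `^ p * (1 + p / 2 * ((normc u ^+ 2 + normc v ^+ 2) / normc u ^+ 2 - 1)) =
   normc u `^ p + (p * (normc u `^ p / normc u ^+ 2) * normc v ^+ 2) / 2.
  by field; rewrite gt_eqF.
lra.
Qed.

(** Tangents at 1 for both terms would give only 2. For the first term the tangent at a = 1 + s/2 is
    taken, and a^p >= 1 + p s/2 together with a^(p-1) >= 1 + (p - 1) s/4 produce the quadratic term
    with its constant p (p - 1) / 8. *)
Lemma two_point_small (s p : R) : 0 <= s -> s <= 1 -> 1 < p -> p < 2 ->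
  2 + p * (p - 1) / 8 * s ^+ 2 <= (1 + s) `^ p + (1 - s) `^ p.
Proof.
move=> s0 s1 p1 p2; pose a := 1 + s / 2.
have a0 : 0 < a by rewrite /a; lra.
have h1 := @powR_tangent_ge (1 + s) a p ltac:(lra) a0 ltac:(lra).
have h2 := @bernoulli_ge (1 - s) p ltac:(lra) ltac:(lra).
have h3 := @bernoulli_ge a p ltac:(lra) ltac:(lra).
have h4 : 1 + (p - 1) * (s / 4) <= a `^ (p - 1).
  have ai : 0 <= a^-1 by rewrite invr_ge0 ltW.
  have := @bernoulli_le a^-1 (p - 1) ai ltac:(lra) ltac:(lra).
  have -> : a^-1 `^ (p - 1) = (a `^ (p - 1))^-1.
    by rewrite -powR_inv1 ?(ltW a0)// -powRrM mulN1r powRN.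
  move=> h.
  have b0 : 0 < a `^ (p - 1) by rewrite powR_gt0.
  have -> : a `^ (p - 1) = ((a `^ (p - 1))^-1)^-1 by rewrite invrK.
  have w1 : a^-1 - 1 = - (s / 2 / a) by rewrite /a; field; rewrite gt_eqF//; lra.
  have w2 : s / 4 <= s / 2 / a.
    by rewrite ler_pdivlMr// /a; nra.
  rewrite w1 in h.
  have w3 : s / 2 / a <= 1 / 2 by rewrite ler_pdivrMr// /a; lra.
  have w4 : 0 <= s / 2 / a by rewrite mulr_ge0//; lra.
  set X := s / 2 / a in h w2 w3 w4 *.
  have X0 : 0 < 1 + (p - 1) * - X by nra.
  apply: (@le_trans _ _ (1 + (p - 1) * - X)^-1).
    have z1 : (p - 1) * (s / 4) <= (p - 1) * X by rewrite ler_wpM2l//; lra.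
    have z2 : 0 <= (p - 1) * (s / 4) * ((p - 1) * X).
      by rewrite !mulr_ge0//; lra.
    by rewrite -[leRHS]mul1r ler_pdivlMr//; lra.
  by rewrite lef_pV2 ?posrE ?invr_gt0.
have h5 : a `^ p * (1 + p * ((1 + s) / a - 1)) = a `^ p + a `^ (p - 1) * (p * (s / 2)).
  have -> : a `^ p = a * a `^ (p - 1) by rewrite mulr_powRB1 ?ltW//; lra.
  by rewrite /a; field; rewrite gt_eqF//; lra.
have h6 : (1 + (p - 1) * (s / 4)) * (p * (s / 2)) <= a `^ (p - 1) * (p * (s / 2)).
  by rewrite ler_wpM2r// mulr_ge0//; lra.
have h7 : 1 + p * (s / 2) <= a `^ p by apply: le_trans h3; rewrite /a; lra.
have h8 : (1 + (p - 1) * (s / 4)) * (p * (s / 2)) = p * (s / 2) + p * (p - 1) / 8 * s ^+ 2 by field.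
lra.
Qed.

(** Homogeneity reduces to [two_point_small] with s the quotient of the smaller by the larger
    number. The weight is M^(p-2), which for p < 2 is at most the same power of the larger
    number. *)
Lemma two_point (x y p : R) : 0 <= x -> 0 <= y -> 1 < p -> p < 2 ->
  forall M, 0 < M -> x <= M -> y <= M ->
  2 * x `^ p + p * (p - 1) / 8 * (M `^ p / M ^+ 2) * y ^+ 2 <= (x + y) `^ p + `|x - y| `^ p.
Proof.
move=> x0 y0 p1 p2 M M0 xM yM.
have p0 : p != 0 by rewrite gt_eqF//; lra.
have weight (z : R) : 0 <= z -> z <= M -> M `^ p / M ^+ 2 * z ^+ 2 <= z `^ p.
  move=> z0 zM; have [->|zn] := eqVneq z 0; first by rewrite powR0// expr0n mulr0.
  have z1 : 0 < z by rewrite lt_def zn.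
  have /ger_powR H : 0 < z / M <= 1 by rewrite divr_gt0//= ler_pdivrMr// mul1r.
  rewrite -(powR_rescale p z0 M0) -mulrA ler_wpM2l ?powR_ge0//.
  rewrite mulrC -expr_div_n -(@powR_mulrn _ _ 2) ?divr_ge0 ?(ltW M0)//; apply: H; lra.
have k0 : 0 <= p * (p - 1) / 8 by rewrite divr_ge0// mulr_ge0//; lra.
have [yx|/ltW xy] := leP y x.
  have [xz|xn] := eqVneq x 0.
    have -> : y = 0 by lra.
    by rewrite xz expr0n mulr0 addr0 subr0 normr0 powR0// mulr0 addr0.
  have x1 : 0 < x by rewrite lt_def xn.
  have h := two_point_small (divr_ge0 y0 (ltW x1)) (_ : y / x <= 1) p1 p2.
  rewrite ler_pdivrMr// mul1r in h.
  have := ler_wpM2l (powR_ge0 x p) (h yx).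
  have -> : 1 + y / x = (x + y) / x by field.
  have -> : 1 - y / x = (x - y) / x by field.
  have a1 : 0 <= x + y by lra.
  have a2 : 0 <= x - y by lra.
  rewrite [_ * (_ + _ `^ _)]mulrDr !powR_rescale//.
  rewrite (@ger0_norm _ (x - y)); last lra.
  move=> H; apply: le_trans H; rewrite [leRHS]mulrDr (mulrC _ 2) lerD2l.
  have := ler_wpM2l k0 (weight _ x0 xM) => w.
  have := ler_wpM2r (_ : 0 <= (y / x) ^+ 2) w; rewrite sqr_ge0 => /(_ isT) h2.
  apply: le_trans (le_trans h2 _).
    by rewrite le_eqVlt; apply/orP; left; apply/eqP; field; rewrite !gt_eqF.
  by rewrite le_eqVlt; apply/orP; left; apply/eqP; ring.
have [yz|yn] := eqVneq y 0.
  have -> : x = 0 by lra.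
  by rewrite yz expr0n mulr0 addr0 subr0 normr0 powR0// mulr0 addr0.
have y1 : 0 < y by rewrite lt_def yn.
pose s := x / y; have s0 : 0 <= s by rewrite divr_ge0.
have s1 : s <= 1 by rewrite ler_pdivrMr// mul1r.
have h := two_point_small s0 s1 p1 p2.
have := ler_wpM2l (powR_ge0 y p) h.
have -> : 1 + s = (x + y) / y by rewrite /s; field.
have -> : 1 - s = (y - x) / y by rewrite /s; field.
have a1 : 0 <= x + y by lra.
have a2 : 0 <= y - x by lra.
rewrite [_ * (_ + _ `^ _)]mulrDr !powR_rescale//.
rewrite distrC (@ger0_norm _ (y - x)); last lra.
move=> H; apply: le_trans H.
(* With y the larger number, the gain in s^2 has to be traded for one without s: k being the
   constant p (p - 1) / 8 <= 1/4, 2 + k s^2 >= 2 s + k for s <= 1, and s dominates s^p. *)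
have sp : s `^ p <= s.
  have [->|sn] := eqVneq s 0; first by rewrite powR0.
  by apply: ge1r_powR; [rewrite s1 lt_def sn s0|lra].
have xp : x `^ p = y `^ p * s `^ p by rewrite -powRM// ?(ltW y1)// /s mulrC divfK// gt_eqF.
have := weight y y0 yM; rewrite xp => w.
have yp := powR_ge0 y p.
have kk : p * (p - 1) / 8 <= 1 / 4 by nra.
have w' := ler_wpM2l k0 w.
apply: (@le_trans _ _ (y `^ p * (2 * s `^ p + p * (p - 1) / 8))).
  rewrite [leRHS]mulrDr; apply: lerD; first by rewrite mulrCA.
  by rewrite -mulrA [leRHS]mulrC.
rewrite ler_wpM2l//; move: kk k0; set k := p * (p - 1) / 8 => kk k0.
have : 0 <= (1 - s) ^+ 2 by exact: sqr_ge0.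
nra.
Qed.

(** By concavity the defect is smallest when the cross term is extremal, that is, for parallel u and
    v; this is the real inequality [two_point] for the moduli. *)
Lemma defect_lt2 p u v (M : R) : 1 < p -> p < 2 -> 0 < M -> normc u <= M -> normc v <= M ->
  p * (p - 1) / 8 * (M `^ p / M ^+ 2) * normc v ^+ 2 <= convexity_defect p u v.
Proof.
move=> p1 p2 M0 uM vM; rewrite defectE.
have r0 : 0 < p / 2 by lra.
have r1 : p / 2 <= 1 by lra.
have := powR_concave_spread (cross_le u v) (cross_le_sum u v) r0 r1.
have -> : normc u ^+ 2 + normc v ^+ 2 + 2 * (normc u * normc v) = (normc u + normc v) ^+ 2 by ring.
have -> : normc u ^+ 2 + normc v ^+ 2 - 2 * (normc u * normc v) = `|normc u - normc v| ^+ 2.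
  by rewrite real_normK ?num_real//; ring.
rewrite -!powR_sqr ?addr_ge0 ?normc_ge0//.
have := two_point (normc_ge0 u) (normc_ge0 v) p1 p2 M0 uM vM; lra.
Qed.

Theorem defect_weak p : 1 < p -> exists2 P : R, 1 <= P & forall M : R, 0 < M ->
  exists2 c : R, 0 < c & forall u v, normc u <= M -> normc v <= M ->
    c * normc v `^ P <= convexity_defect p u v.
Proof.
move=> p1; have [p2|p2] := leP 2 p.
  exists p; first lra.
  move=> M M0; exists 2 => // u v _ _; by have [] := defect_ge2 u v p2.
exists 2; first lra.
move=> M M0; exists (p * (p - 1) / 8 * (M `^ p / M ^+ 2)).
  by rewrite mulr_gt0 ?divr_gt0 ?mulr_gt0 ?exprn_gt0 ?powR_gt0//; lra.
move=> u v uM vM; rewrite (@powR_mulrn _ _ 2) ?normc_ge0//; exact: defect_lt2.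
Qed.

Theorem defect_strong p (M d : R) : 1 < p -> 0 < M -> 0 < d ->
  exists2 c : R, 0 < c & forall u v, d <= normc u -> normc u <= M -> normc v <= M ->
    c * normc v ^+ 2 <= convexity_defect p u v.
Proof.
move=> p1 M0 d0; have [p2|p2] := leP 2 p.
  exists (p * (d `^ p / M ^+ 2)).
    by rewrite mulr_gt0 ?divr_gt0 ?exprn_gt0 ?powR_gt0//; lra.
  move=> u v ud uM _; have u0 := lt_le_trans d0 ud.
  have [_ /(_ u0)] := defect_ge2 u v p2; apply: le_trans.
  rewrite ler_wpM2r ?sqr_ge0// ler_wpM2l//; first lra.
  apply: ler_pM; rewrite ?powR_ge0 ?invr_ge0 ?sqr_ge0//.
    by apply: ge0_ler_powR; rewrite ?nnegrE ?normc_ge0 ?(ltW d0)//; lra.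
  by rewrite lef_pV2 ?posrE ?exprn_gt0// lerXn2r ?nnegrE ?normc_ge0// ltW.
exists (p * (p - 1) / 8 * (M `^ p / M ^+ 2)).
  by rewrite mulr_gt0 ?divr_gt0 ?mulr_gt0 ?exprn_gt0 ?powR_gt0//; lra.
by move=> u v _ uM vM; exact: defect_lt2.
Qed.

Lemma defect_ge0 p u v : 1 < p -> 0 <= convexity_defect p u v.
Proof.
move=> p1; have [P P1 H] := defect_weak p1.
have M0 : 0 < normc u + normc v + 1 by have := normc_ge0 u; have := normc_ge0 v; lra.
have [c c0] := H _ M0; have := normc_ge0 u; have := normc_ge0 v => ? ?.
move=> /(_ u v ltac:(lra) ltac:(lra)); apply: le_trans.
by rewrite mulr_ge0 ?powR_ge0// ltW.
Qed.

(** Being linear in u, this bound turns the inequalities for competitors into first-order ones. *)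
Lemma normc_powR_ge p u : 1 <= p -> 1 + p * (complex.Re u - 1) <= normc u `^ p.
Proof.
move=> p1; apply: le_trans (bernoulli_ge (normc_ge0 u) p1).
rewrite lerD2l ler_wpM2l//; first lra.
by rewrite lerD2r (le_trans (ler_norm _))// ler_Re_normc.
Qed.

End power_inequalities.

(** * Isolated zeros and the identity theorem *)

Section zeros.
Context {R : realType}.
Implicit Types (F : R[i] -> R[i]) (l : R[i]).

(** If all Taylor coefficients vanished, F l0 would be at most 8 M / 2^N for every N. So there is a
    first nonzero coefficient, and its term dominates the remainder near 0. *)
Lemma isolated_zeros F (M : R) l0 :
  (forall x y : R, -1 <= x <= 1 -> -1 <= y <= 1 -> cdiff F (x +i* y)) ->
  (forall x y : R, -1 <= x <= 1 -> -1 <= y <= 1 -> normc (F (x +i* y)) <= M) ->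
  normc l0 <= 4^-1 -> F l0 != 0 ->
  exists2 r : R, 0 < r & forall l, 0 < normc l -> normc l <= r -> F l != 0.
Proof.
move=> Fd FM l04 Fl0.
have FM' (x y : R) : -1 <= x <= 1 -> -1 <= y <= 1 ->
    [|| x == -1, x == 1, y == -1 | y == 1] -> normc (F (x +i* y)) <= M.
  by move=> *; exact: FM.
have M0 : 0 <= M.
  by apply: le_trans (normc_ge0 _) (FM 1 1 _ _); rewrite lexx andbT; lra.
have [|none] := pselect (exists k, taylor_coef F k != 0); last first.
  exfalso; move: Fl0; rewrite -normc_gt0 => Fl0.
  have H N : normc (F l0) <= 8 * M * (2 ^- N).
    have l02 : normc l0 <= 2^-1 by lra.
    have := taylor_expansion Fd N l02 FM'; rewrite big1 ?subr0; last first.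
      move=> k _; have /negP := fun e => none (ex_intro _ (k : nat) e).
      by rewrite negbK => /eqP ->; rewrite mul0r.
    move=> h; apply: (le_trans h); rewrite ler_wpM2l ?mulr_ge0//.
    by rewrite -exprVn lerXn2r ?nnegrE ?normc_ge0 ?invr_ge0.
  have [N] : exists N, 8 * M * 2 ^- N < normc (F l0).
    have [N hN] : exists N, 8 * M / normc (F l0) < 2 ^+ N.
      exists (Num.truncn (8 * M / normc (F l0))).+1.
      apply: lt_le_trans (truncnS_gt _) _.
      by rewrite -natrX ler_nat ltnW// ltn_expl.
    exists N; move: hN; rewrite ltr_pdivrMr// => hN.
    by rewrite ltr_pdivrMr ?exprn_gt0// [ltRHS]mulrC.
  by rewrite ltNge H.
move=> exk; have [N cN minN] := ex_minnP exk.
have c0 : 0 < normc (taylor_coef F N) by rewrite normc_gt0.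
have M1 : 0 < 8 * M + 1 by lra.
exists (Num.min 2^-1 (normc (taylor_coef F N) / 2 / (8 * M + 1))).
  by rewrite lt_min invr_gt0 ltr0n/= !divr_gt0.
move=> l l0' ; rewrite le_min => /andP[l2 lc].
have := taylor_expansion Fd N.+1 l2 FM'; rewrite big_ord_recr /= big1 ?add0r; last first.
  move=> k _; have [->|ck] := eqVneq (taylor_coef F k) 0; first by rewrite mul0r.
  by have := minN _ ck; rewrite leqNgt ltn_ord.
move=> h; apply/eqP => Fl; move: h; rewrite Fl sub0r normcN Normc.normcM normcX exprSr mulrA.
rewrite (mulrC (8 * M)) -mulrA (mulrC (normc (taylor_coef F N))).
rewrite ler_pM2l ?exprn_gt0// leNgt => /negP; apply.
apply: (@le_lt_trans _ _ ((8 * M + 1) * normc l)).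
  by rewrite ler_wpM2r ?normc_ge0// lerDl.
rewrite mulrC -ltr_pdivlMr//; apply: (le_lt_trans lc).
by rewrite ltr_pM2r ?invr_gt0// ltr_pdivrMr// ltr_pMr// ltr1n.
Qed.

Lemma bdry_lower_bound F a b c d : a <= b -> c <= d -> bdry_cont F a b c d ->
  (forall x y : R, a <= x <= b -> c <= y <= d ->
    [|| x == a, x == b, y == c | y == d] -> F (x +i* y) != 0) ->
  exists2 e : R, 0 < e & forall x y : R, a <= x <= b -> c <= y <= d ->
    [|| x == a, x == b, y == c | y == d] -> e <= normc (F (x +i* y)).
Proof.
move=> ab cd Fc F0; have [pc pd pa pb] := bdry_path ab cd Fc.
have side (g : R -> R[i]) (u v : R) : u <= v -> pcont g u v ->
    (forall x, u <= x <= v -> g x != 0) ->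
    exists2 e : R, 0 < e & forall x, u <= x <= v -> e <= normc (g x).
  move=> uv gc g0; have [x xuv xmin] := EVT_min uv (pcont_normc gc).
  exists (normc (g x)); first by rewrite normc_gt0 g0// -in_itv.
  by move=> y yuv; apply: xmin; rewrite in_itv.
have [|e1 e10 h1] := side _ _ _ ab pc; first by move=> x xab; apply: F0; rewrite ?lexx ?eqxx ?cd ?orbT.
have [|e2 e20 h2] := side _ _ _ ab pd; first by move=> x xab; apply: F0; rewrite ?lexx ?eqxx ?cd ?orbT.
have [|e3 e30 h3] := side _ _ _ cd pa; first by move=> x xab; apply: F0; rewrite ?lexx ?eqxx ?ab ?orbT.
have [|e4 e40 h4] := side _ _ _ cd pb; first by move=> x xab; apply: F0; rewrite ?lexx ?eqxx ?ab ?orbT.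
exists (Num.min (Num.min e1 e2) (Num.min e3 e4)); first by rewrite !lt_min e10 e20 e30.
move=> x y xP yP /or4P[] /eqP E; subst; rewrite !ge_min ?h1 ?h2 ?h3 ?h4 ?orbT//.
Qed.

End zeros.

Section identity.
Context {R : realType} {n : nat}.
Local Notation V := 'rV[R[i]]_n.
Implicit Types (z w h e : V) (f : V -> R[i]) (Omega : set V).

Lemma holomorphic_locally_bounded Omega f z : open Omega -> holomorphic Omega f -> Omega z ->
  exists2 r : R, 0 < r & forall w, vnorm (w - z) < r -> Omega w /\ normc (f w) <= normc (f z) + 1.
Proof.
move=> oO hf Oz; have [r r0 rO] := open_vnormP oO Oz.
have [s s0 sP] := differentiable_cont (hf z Oz) ltr01.
exists (Num.min r s); first by rewrite lt_min r0.
move=> w; rewrite lt_min => /andP[/rO Ow /sP fw]; split => //.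
have := normc_triangle (f z) (f w) 0; rewrite !subr0; lra.
Qed.

Lemma isolated_zeros_line f z e (r M : R) : vnorm e < r / 2 ->
  (forall w, vnorm (w - z) < r -> differentiable f w /\ normc (f w) <= M) ->
  f (z + 4^-1 *: e) != 0 ->
  exists2 s : R, 0 < s & forall l, 0 < normc l -> normc l <= s -> f (z + l *: e) != 0.
Proof.
move=> er fd fe; apply: (@isolated_zeros _ (fun l => f (z + l *: e)) M 4^-1) => //.
- move=> x y xP yP; apply: differentiable_line.
  by have [] := fd _ (line_in_ball z xP yP er).
- by move=> x y xP yP; have [] := fd _ (line_in_ball z xP yP er).
- by rewrite -(rmorph_nat (real_complex R)) -fmorphV normc_real normfV normr_nat.
Qed.

(** The set [Z] of points near which f vanishes is open. It is closed in Omega: near a limit point w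
    lies some a in [Z], and a point h near w with f h <> 0 would make the zeros of f isolated at a
    on the line through a and h. *)
Theorem identity_theorem Omega f b : open Omega -> connected Omega -> holomorphic Omega f ->
  Omega b -> f b != 0 ->
  forall z (e : R), Omega z -> 0 < e -> exists2 w, vnorm (w - z) < e & f w != 0.
Proof.
move=> oO cO hf Ob fb z e Oz e0; apply: contrapT => H.
pose Z := [set w | Omega w /\ exists2 r : R, 0 < r & forall h, vnorm (h - w) < r -> f h = 0].
suff ZO : Z = Omega.
  have : Z b by rewrite ZO.
  move=> [_ [r r0 fr]]; move/eqP: fb; apply; apply: fr.
  by rewrite subrr vnorm0.
have Zz : Z z.
  split => //; exists e => // h hz; apply/eqP/negPn/negP => fh.
  by apply: H; exists h.
apply: cO; first by exists z.
  exists Z; last by rewrite setIidr// => w [].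
  rewrite openE => w [Ow [r r0 fr]]; apply/nbhs_vnormP.
  have [s s0 sO] := open_vnormP oO Ow.
  exists (Num.min s (r / 2)); first by rewrite lt_min s0 divr_gt0.
  move=> h; rewrite lt_min => /andP[/sO Oh hr]; split => //.
  exists (r / 2); first by rewrite divr_gt0.
  move=> x xh; apply: fr; have := vnorm_triangle h x w; lra.
exists (closure Z); first exact: closed_closure.
apply/seteqP; split => [w Zw|w [Ow clw]].
  by split; [case: Zw|exact: subset_closure].
split => //; have [r r0 rP] := holomorphic_locally_bounded oO hf Ow.
have [|a [[Oa [s s0 fs]] aw]] := clw [set h | vnorm (h - w) < r / 16].
  by apply/nbhs_vnormP; exists (r / 16); rewrite ?divr_gt0.
exists (r / 32); first by rewrite divr_gt0.
move=> h hw; apply/eqP/negPn/negP => fh.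
have ah : vnorm (h - a) <= r / 16 + r / 32.
  by have := vnorm_triangle w h a; rewrite (vnormBC w a); move: aw => /=; lra.
have aB x : vnorm (x - a) < 15 / 16 * r -> differentiable f x /\ normc (f x) <= normc (f w) + 1.
  move=> xa; have xw : vnorm (x - w) < r.
    by have := vnorm_triangle a x w; move: aw => /=; lra.
  by have [Ox fx] := rP x xw; split => //; exact: hf.
have n4 : normc (4 : R[i]) = 4.
  by rewrite -(rmorph_nat (real_complex R)) normc_real normr_nat.
(* The factor 4 puts h at the parameter 1/4 of the line, where [isolated_zeros_line] asks for a
   nonzero value. *)
have e4 : vnorm (4 *: (h - a)) < 15 / 16 * r / 2 by rewrite vnormZ n4; lra.
have := isolated_zeros_line e4 aB.
rewrite scalerA mulVf ?pnatr_eq0// scale1r addrC subrK => /(_ fh)[t t0 tP].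
have e0' : 0 < 4 * vnorm (h - a) + 1 by have := vnorm_ge0 (h - a); lra.
pose l := Num.min t (s / (4 * vnorm (h - a) + 1)) / 2.
have l0 : 0 < l by rewrite divr_gt0// lt_min t0 divr_gt0.
have lm : l < Num.min t (s / (4 * vnorm (h - a) + 1)).
  by rewrite ltr_pdivrMr// ltr_pMr ?ltr1n// lt_min t0 divr_gt0.
move: lm; rewrite lt_min => /andP[lt ls].
have nl : normc l%:C = l by rewrite normc_real ger0_norm// ltW.
have := tP l%:C; rewrite nl => /(_ l0 (ltW lt)) /eqP; apply; apply: fs.
rewrite addrAC subrr add0r !vnormZ nl n4.
apply: (@le_lt_trans _ _ (l * (4 * vnorm (h - a) + 1))).
  by rewrite ler_wpM2l ?(ltW l0)// lerDl.
by rewrite -ltr_pdivlMr.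
Qed.

(* A boundary free of zeros is what lets the strong form of the convexity
   estimate reach points [z] where [f] vanishes, through the maximum principle. *)
Theorem zero_free_square Omega f b z (e : R) : open Omega -> connected Omega ->
  holomorphic Omega f -> Omega b -> f b != 0 -> Omega z -> 0 < e ->
  exists h, exists2 d : R, 0 < d & vnorm h < e /\
    forall x y : R, -1 <= x <= 1 -> -1 <= y <= 1 ->
      [|| x == -1, x == 1, y == -1 | y == 1] -> d <= normc (f (z + (x +i* y) *: h)).
Proof.
move=> oO cO hf Ob fb Oz e0.
have [r r0 rP] := holomorphic_locally_bounded oO hf Oz.
have m0 : 0 < Num.min r e / 16 by rewrite divr_gt0// lt_min r0.
have [w wz fw] := identity_theorem oO cO hf Ob fb Oz m0.
have := ltr_pdivlMr; move: wz; rewrite ltr_pdivlMr// lt_min => /andP[wr we] _.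
have zB x : vnorm (x - z) < r -> differentiable f x /\ normc (f x) <= normc (f z) + 1.
  by move=> /rP[Ox fx]; split => //; exact: hf.
have n4 : normc (4 : R[i]) = 4.
  by rewrite -(rmorph_nat (real_complex R)) normc_real normr_nat.
have e4 : vnorm (4 *: (w - z)) < r / 2.
  by rewrite vnormZ n4; have := vnorm_ge0 (w - z); lra.
have := isolated_zeros_line e4 zB.
rewrite scalerA mulVf ?pnatr_eq0// scale1r addrC subrK => /(_ fw)[t t0 tP].
(* The boundary of the unit square satisfies 1 <= |x + iy| <= 2; scaled by k it lies in the
   punctured disc of radius t, where f has no zero. The bound by 1 keeps [h] short. *)
have [k k0 [kt k1]] : exists2 k : R, 0 < k & k * 2 <= t /\ k * 2 <= 1.
  exists (Num.min t 1 / 2); first by rewrite divr_gt0// lt_min t0 ltr01.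
  by rewrite !divfK// !ge_min !lexx orbT.
have nk : normc k%:C = k by rewrite normc_real ger0_norm// ltW.
have [h hE] : {h | h = k%:C *: (4 *: (w - z))} by exists (k%:C *: (4 *: (w - z))).
have hv : vnorm h <= 2 * vnorm (w - z).
  rewrite hE !vnormZ nk n4 mulrA ler_wpM2r ?vnorm_ge0//; clear -k1; lra.
have hr : vnorm h < r / 2 by have := vnorm_ge0 (w - z); clear -hv wr; lra.
have bc : bdry_cont (fun l => f (z + l *: h)) (-1) 1 (-1) 1.
  move=> x y xP yP _; apply: cdiff_cont; apply: differentiable_line.
  by have [] := zB _ (line_in_ball z xP yP hr).
have [||x y xP yP H|d d0 dP] := bdry_lower_bound _ _ bc; try lra.
  have n1 := bdry_unit xP yP H; have n2 := normc_unit_square xP yP.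
  rewrite hE scalerA; apply: tP; rewrite Normc.normcM nk.
    by rewrite mulr_gt0// (lt_le_trans ltr01).
  have : normc (x +i* y) * k <= 2 * k by rewrite ler_wpM2r// ltW.
  lra.
exists h, d => //; split => //.
by have := vnorm_ge0 (w - z); clear -hv we; lra.
Qed.

End identity.

(** * The p-Bergman space *)

Section bergman_space.
Context {R : realType} {n : nat}.
Local Notation P2 := (measurableTypeR R * measurableTypeR R)%type.
Local Notation V := 'rV[R[i]]_n.
Local Notation cot := (@complex_of_tuple R n).
Variables (Omega : set V) (p : R).
Hypotheses (domOmega : bounded_domain Omega) (p1 : 1 < p).
Implicit Types (z w h : V) (f g : V -> R[i]).
Local Notation A2 := (pbergman_space p Omega).
Local Notation D := (cot @^-1` Omega).

(** The p-th power of the norm, the quantity for which pointwise defects can be integrated. [fine]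
    sends an infinite integral to 0, so the value is meaningful on the space only. *)
Definition energy (p : R) (Omega : set V) f : R := fine (pintegral p Omega f).
Local Notation E := (energy p Omega).

Let p0 : 0 < p. Proof. by rewrite (lt_trans ltr01). Qed.
Let pn0 : p != 0. Proof. by rewrite gt_eqF. Qed.
Let oO : open Omega. Proof. by case: domOmega. Qed.
Let mD : measurable D. Proof. exact: measurable_open. Qed.

Lemma measurable_normc_powR f : holomorphic Omega f ->
  measurable_fun D (fun t => normc (f (cot t)) `^ p).
Proof.
by move=> hf; apply: (measurableT_comp (measurable_powR p)); exact: measurable_holomorphic.
Qed.

Lemma pintegral_ge0 f : (0 <= pintegral p Omega f)%E.
Proof. by apply: integral_ge0 => t _; rewrite lee_fin powR_ge0. Qed.

Lemma pintegralE f : A2 f -> pintegral p Omega f = (E f)%:E.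
Proof. by move=> [_ fI]; rewrite fineK// ge0_fin_numE// pintegral_ge0. Qed.

Lemma energy_ge0 f : 0 <= E f.
Proof. by rewrite fine_ge0// pintegral_ge0. Qed.

Lemma pnorm_powR f : pnorm p Omega f `^ p = E f.
Proof. by rewrite -powRrM mulVf// powRr1// energy_ge0. Qed.

Lemma pnorm_ge0 f : 0 <= pnorm p Omega f.
Proof. exact: powR_ge0. Qed.

Lemma energy_powR_inv f : E f `^ p^-1 = pnorm p Omega f.
Proof. by []. Qed.

Lemma pintegralZ (a : R[i]) f : holomorphic Omega f ->
  pintegral p Omega (fun w => a * f w) = ((normc a `^ p)%:E * pintegral p Omega f)%E.
Proof.
move=> hf; rewrite -ge0_integralZl_EFin ?powR_ge0//.
- by apply: eq_integral => t _; rewrite Normc.normcM powRM ?normc_ge0// EFinM.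
- by move=> t _; rewrite lee_fin powR_ge0.
- by apply/measurable_EFinP; exact: measurable_normc_powR.
Qed.

Lemma holomorphicZ (a : R[i]) f : holomorphic Omega f -> holomorphic Omega (fun w => a * f w).
Proof.
move=> hf z Oz; apply: differentiableM; [exact: differentiable_cst|exact: hf].
Qed.

Lemma holomorphicD f g : holomorphic Omega f -> holomorphic Omega g ->
  holomorphic Omega (fun w => f w + g w).
Proof. by move=> hf hg z Oz; apply: differentiableD; [exact: hf|exact: hg]. Qed.

Lemma bergmanZ (a : R[i]) f : A2 f -> A2 (fun w => a * f w).
Proof.
move=> [hf fI]; split; first exact: holomorphicZ.
by rewrite pintegralZ// lte_mul_pinfty// lee_fin powR_ge0.
Qed.

Lemma energyZ (a : R[i]) f : A2 f -> E (fun w => a * f w) = normc a `^ p * E f.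
Proof.
move=> Af; rewrite /energy pintegralZ ?(pintegralE Af)//; by case: Af.
Qed.

Lemma powR_add_le (x y : R) : 0 <= x -> 0 <= y ->
  (x + y) `^ p <= 2 `^ p * (x `^ p + y `^ p).
Proof.
move=> x0 y0; have [xy|/ltW yx] := leP x y.
  rewrite (@le_trans _ _ ((2 * y) `^ p))//.
    by rewrite ge0_ler_powR ?(ltW p0)// ?nnegrE ?addr_ge0 ?mulr_ge0//; lra.
  by rewrite powRM// ler_wpM2l ?powR_ge0// lerDr powR_ge0.
rewrite (@le_trans _ _ ((2 * x) `^ p))//.
  by rewrite ge0_ler_powR ?(ltW p0)// ?nnegrE ?addr_ge0 ?mulr_ge0//; lra.
by rewrite powRM// ler_wpM2l ?powR_ge0// lerDl powR_ge0.
Qed.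

Lemma bergmanD f g : A2 f -> A2 g -> A2 (fun w => f w + g w).
Proof.
move=> [hf fI] [hg gI]; split; first exact: holomorphicD.
apply: (@le_lt_trans _ _ (\int[lebesgue2n]_(t in D)
    ((2 `^ p)%:E * ((normc (f (cot t)) `^ p)%:E + (normc (g (cot t)) `^ p)%:E)))%E).
  apply: ge0_le_integral => //.
  - by move=> t _; rewrite lee_fin powR_ge0.
  - by apply/measurable_EFinP; exact: (measurable_normc_powR (holomorphicD hf hg)).
  - apply: measurable_funeM; apply: emeasurable_funD;
      by apply/measurable_EFinP; exact: measurable_normc_powR.
  - move=> t _; rewrite -EFinD -EFinM lee_fin.
    apply: le_trans (powR_add_le (normc_ge0 _) (normc_ge0 _)).
    by rewrite ge0_ler_powR ?(ltW p0)// ?nnegrE ?addr_ge0 ?normc_ge0// le_normcD.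
rewrite ge0_integralZl_EFin ?powR_ge0//; last 2 first.
- by move=> t _; rewrite adde_ge0// lee_fin powR_ge0.
- by apply: emeasurable_funD; apply/measurable_EFinP; exact: measurable_normc_powR.
rewrite ge0_integralD//; last 4 first.
- by move=> t _; rewrite lee_fin powR_ge0.
- by apply/measurable_EFinP; exact: measurable_normc_powR.
- by move=> t _; rewrite lee_fin powR_ge0.
- by apply/measurable_EFinP; exact: measurable_normc_powR.
rewrite lte_mul_pinfty ?lee_fin ?powR_ge0//.
exact: lte_add_pinfty.
Qed.

(** Omega is bounded, hence contained in a box of finite measure. Every infimum [pbergman_min] is
    thus over a nonempty set, and minimizers have a common energy bound. *)
Lemma bergman1 : A2 (fun=> 1).
Proof.
split; first by move=> z _; exact: differentiable_cst.
have [_ _ _ [M0 [M0r MO]]] := domOmega.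
have [M M00 MP] : exists2 M : R, 0 < M & forall z, Omega z -> vnorm z <= M.
  pose M : R := `|complex.Re M0| + 1; have M00 : 0 < M by rewrite ltr_pwDr// ltr01.
  exists M => // z Oz; rewrite -lecR -vnormE; apply: MO => //.
  rewrite (@le_lt_trans _ _ (complex.Re M0)%:C)//; last first.
    by rewrite ltcR /M; have := ler_norm (complex.Re M0); lra.
  by rewrite RRe_real.
pose t0 : n.-tuple P2 := [tuple (0, 0) | j < n].
apply: (@le_lt_trans _ _ (\int[@lebesgue2n R n]_(t in tuple_box t0 M) cst 1%:E t)%E).
  rewrite /pintegral; under eq_integral do rewrite Normc.normc1 powR1.
  apply: ge0_subset_integral => //; first exact: measurable_tuple_box.
  move=> t /MP tM; apply/tuple_boxP => j; rewrite tnth_mktuple !subr0.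
  have := vnorm_coord (cot t) j; rewrite mxE => h.
  have h' := le_trans h tM; split.
    exact: le_trans (ler_Re_normc _) h'.
  exact: le_trans (ler_Im_normc _) h'.
rewrite integral_cst; last exact: measurable_tuple_box.
rewrite mul1e.
have h : (((2 * M) ^+ 2) ^+ n)%:E = lebesgue2n (tuple_box t0 M).
  by rewrite lebesgue2n_tuple_box// ltW.
by apply: le_lt_trans (ltry (((2 * M) ^+ 2) ^+ n)); rewrite h.
Qed.

Lemma box_subset z (r : R) : 0 < r -> (forall w, vnorm (w - z) < r -> Omega w) ->
  forall t, tuple_box (tuple_of_complex z) (r / 4) t ->
    vnorm (cot t - z) < r /\ Omega (cot t).
Proof.
move=> r0 zr t /tuple_box_vnorm; rewrite tuple_of_complexK => h.
suff rt : vnorm (cot t - z) < r by split => //; exact: zr.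
by apply: le_lt_trans (h _) _; lra.
Qed.

Lemma bergman_local_bound (r : R) : 0 < r ->
  exists2 C : R, 0 < C & forall z f, (forall w, vnorm (w - z) < r -> Omega w) ->
    A2 f -> normc (f z) <= C * pnorm p Omega f.
Proof.
move=> r0; have r4 : 0 < r / 4 by rewrite divr_gt0.
have [C C0 CP] := @holomorphic_Lp_bound R n _ _ r4 (ltW p1).
exists C => // z f zr Af; have [hf _] := Af.
have H (J : R) : 0 < J -> E f <= J -> normc (f z) <= C * J `^ p^-1.
  move=> J0 fJ; rewrite -{1}(tuple_of_complexK z).
  apply: (CP Omega) => //; first by move=> t /(box_subset r0 zr)[].
  apply: (@le_trans _ _ (pintegral p Omega f)); last by rewrite pintegralE// lee_fin.
  apply: ge0_subset_integral => //; first exact: measurable_tuple_box.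
  - by apply/measurable_EFinP; exact: (measurable_normc_powR hf).
  - by move=> t _; rewrite lee_fin powR_ge0.
  - by move=> t /(box_subset r0 zr)[].
have := energy_ge0 f; rewrite le_eqVlt => /predU1P[f0|f0]; last exact: H.
(* [H] asks for a positive bound J. If the energy is 0, the J with C J^(1/p) = |f z| / 2 contradicts
   f z <> 0. *)
rewrite /pnorm -[fine _]/(E f) -f0 powR0 ?invr_eq0// mulr0 leNgt; apply/negP => fz.
have x0 : 0 < normc (f z) / (2 * C) by rewrite divr_gt0 ?mulr_gt0.
have := H ((normc (f z) / (2 * C)) `^ p); rewrite powR_gt0// -f0 powR_ge0.
rewrite -powRrM mulfV// powRr1 ?(ltW x0)// => /(_ isT isT).
have -> : C * (normc (f z) / (2 * C)) = normc (f z) / 2 by field; rewrite gt_eqF.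
by lra.
Qed.

(** The function k of the overview; on Omega it is 1 / K_p, by [pbergman_kernelE]. *)
Definition bergman_weight (p : R) (Omega : set V) z : R := pbergman_min p Omega z `^ p.
Local Notation k := (bergman_weight p Omega).

Lemma min_set_has_inf z : has_inf [set pnorm p Omega f | f in [set f | A2 f /\ f z = 1]].
Proof.
split; first by exists (pnorm p Omega (fun=> 1)); exists (fun=> 1) => //; split => //; exact: bergman1.
by exists 0 => _ [f _ <-]; exact: pnorm_ge0.
Qed.

Lemma pbergman_min_le z f : A2 f -> f z = 1 -> pbergman_min p Omega z <= pnorm p Omega f.
Proof.
move=> Af fz; apply: ge_inf; first by case: (min_set_has_inf z).
by exists f.
Qed.

Lemma pbergman_min_ge z (x : R) : (forall f, A2 f -> f z = 1 -> x <= pnorm p Omega f) ->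
  x <= pbergman_min p Omega z.
Proof.
move=> H; apply: lb_le_inf; first by case: (min_set_has_inf z).
by move=> _ [f [Af fz] <-]; exact: H.
Qed.

Lemma pbergman_min_ge0 z : 0 <= pbergman_min p Omega z.
Proof. by apply: pbergman_min_ge => f _ _; exact: pnorm_ge0. Qed.

Lemma weight_ge0 z : 0 <= k z.
Proof. exact: powR_ge0. Qed.

(** If f z is not 0, f / f z is a competitor at z. *)
Lemma weight_le_energy z f : A2 f -> k z * normc (f z) `^ p <= E f.
Proof.
move=> Af; have [fz|fz] := eqVneq (f z) 0.
  by rewrite fz Normc.normc0 powR0// mulr0 energy_ge0.
have Ag : A2 (fun w => (f z)^-1 * f w) by exact: bergmanZ.
have := pbergman_min_le Ag (mulVf fz).
move=> /(ge0_ler_powR (ltW p0)); rewrite !nnegrE pbergman_min_ge0 pnorm_ge0 => /(_ isT isT).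
rewrite pnorm_powR energyZ// Normc.normcV -/(k z) => h.
have n0 : 0 < normc (f z) by rewrite normc_gt0.
apply: (le_trans (ler_wpM2r (powR_ge0 _ _) h)).
rewrite mulrAC -powRM ?invr_ge0 ?normc_ge0// mulVf ?gt_eqF// powR1 mul1r.
exact: lexx.
Qed.

Lemma weight_le1 z : k z <= E (fun=> 1).
Proof.
have := weight_le_energy z bergman1.
by rewrite Normc.normc1 powR1 mulr1.
Qed.

Lemma weight_lower_bound (r : R) : 0 < r ->
  exists2 c : R, 0 < c & forall z, (forall w, vnorm (w - z) < r -> Omega w) -> c <= k z.
Proof.
move=> r0; have [C C0 CP] := bergman_local_bound r0.
exists (C^-1 `^ p); first by rewrite powR_gt0// invr_gt0.
move=> z zr; rewrite ge0_ler_powR ?(ltW p0) ?nnegrE ?invr_ge0 ?(ltW C0) ?pbergman_min_ge0//.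
apply: pbergman_min_ge => f Af fz; have := CP z f zr Af.
by rewrite fz Normc.normc1 -ler_pdivrMl// mulr1.
Qed.

Lemma weight_near z (e : R) : 0 < e -> exists f, [/\ A2 f, f z = 1 & E f < k z + e].
Proof.
move=> e0; apply: contrapT => H.
have ke : 0 <= k z + e by rewrite addr_ge0 ?weight_ge0 ?ltW.
have : (k z + e) `^ p^-1 <= pbergman_min p Omega z.
  apply: pbergman_min_ge => f Af fz; rewrite ge0_ler_powR ?nnegrE ?invr_ge0 ?(ltW p0) ?energy_ge0//.
  by rewrite leNgt; apply/negP => h; apply: H; exists f.
move=> /(ge0_ler_powR (ltW p0)); rewrite !nnegrE powR_ge0 pbergman_min_ge0 => /(_ isT isT).
by rewrite -powRrM mulVf// powRr1// -/(k z); lra.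
Qed.

Definition half_sum f g : V -> R[i] := fun w => 2^-1 * (f w + g w).
(** Written with a multiple of g, so that [bergmanD] and [bergmanZ] apply directly. *)
Definition half_diff f g : V -> R[i] := fun w => 2^-1 * (f w + (- 1) * g w).

Lemma half_sumD f g w : half_sum f g w + half_diff f g w = f w.
Proof. by rewrite /half_sum /half_diff; field. Qed.

Lemma half_sumB f g w : half_sum f g w - half_diff f g w = g w.
Proof. by rewrite /half_sum /half_diff; field. Qed.

Lemma bergman_half_sum f g : A2 f -> A2 g -> A2 (half_sum f g).
Proof. by move=> Af Ag; exact: (bergmanZ 2^-1 (bergmanD Af Ag)). Qed.

Lemma bergman_half_diff f g : A2 f -> A2 g -> A2 (half_diff f g).
Proof. by move=> Af Ag; exact: (bergmanZ 2^-1 (bergmanD Af (bergmanZ (- 1) Ag))). Qed.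

Lemma measurable_defect f g : A2 f -> A2 g ->
  measurable_fun D (fun t => (convexity_defect p (half_sum f g (cot t)) (half_diff f g (cot t)))%:E).
Proof.
move=> Af Ag; apply/measurable_EFinP.
have mP (h : V -> R[i]) : A2 h -> measurable_fun D (fun t => normc (h (cot t)) `^ p).
  by move=> [hh _]; exact: measurable_normc_powR.
rewrite (_ : (fun _ => _) = fun t => normc (f (cot t)) `^ p + normc (g (cot t)) `^ p -
    2 * normc (half_sum f g (cot t)) `^ p); last first.
  by apply/funext => t; rewrite /convexity_defect half_sumD half_sumB.
apply: measurable_funB; first by apply: measurable_funD; exact: mP.
by apply: measurable_funM => //; apply: mP; exact: bergman_half_sum.
Qed.

Lemma integral_defect f g : A2 f -> A2 g ->
  (\int[lebesgue2n]_(t in D)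
    (convexity_defect p (half_sum f g (cot t)) (half_diff f g (cot t)))%:E)%E =
  (E f + E g - 2 * E (half_sum f g))%:E.
Proof.
move=> Af Ag; have Au := bergman_half_sum Af Ag.
have mP (h : V -> R[i]) : A2 h -> measurable_fun D (fun t => (normc (h (cot t)) `^ p)%:E).
  by move=> [hh _]; apply/measurable_EFinP; exact: measurable_normc_powR.
have P0 (h : V -> R[i]) t : D t -> (0 <= (normc (h (cot t)) `^ p)%:E)%E by rewrite lee_fin powR_ge0.
set I := (\int[_]_(_ in _) _)%E.
(* With the subtracted term moved to the left, all integrands are nonnegative and the integrals add
   up in the extended reals. *)
have : (I + 2%:E * pintegral p Omega (half_sum f g) = pintegral p Omega f + pintegral p Omega g)%E.
  rewrite /pintegral -ge0_integralZl_EFin//; [|exact: P0|exact: mP].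
  rewrite -!ge0_integralD//; last first.
  - by apply: measurable_funeM; exact: mP.
  - by move=> t Dt; rewrite mule_ge0// P0.
  - exact: measurable_defect.
  - by move=> t _; rewrite lee_fin defect_ge0.
  - exact: mP.
  - exact: P0.
  - exact: mP.
  - exact: P0.
  apply: eq_integral => t _; rewrite -EFinM -!EFinD; congr EFin.
  by rewrite /convexity_defect half_sumD half_sumB subrK.
rewrite !pintegralE// -EFinM -EFinD.
by case: I => [x| |]//; rewrite -EFinD => -[<-]; rewrite addrK.
Qed.

(** Integrating the pointwise convexity estimate over a box around z bounds the integral of |v|^P
    there, and [holomorphic_Lp_bound] passes to the centre. The defect is bounded by some d > 0,
    which leaves room for a defect equal to 0. *)
Lemma defect_transfer (r P c : R) : 0 < r -> 1 <= P -> 0 < c ->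
  exists2 C : R, 0 < C & forall z f g (d : R), (forall w, vnorm (w - z) < r -> Omega w) ->
    A2 f -> A2 g ->
    (forall w, vnorm (w - z) < r -> c * normc (half_diff f g w) `^ P <=
      convexity_defect p (half_sum f g w) (half_diff f g w)) ->
    0 < d -> E f + E g - 2 * E (half_sum f g) <= d ->
    normc (half_diff f g z) <= C * d `^ P^-1.
Proof.
move=> r0 P1 c0; have r4 : 0 < r / 4 by rewrite divr_gt0.
have [C C0 CP] := @holomorphic_Lp_bound R n _ _ r4 P1.
exists (C * c^-1 `^ P^-1); first by rewrite mulr_gt0// powR_gt0// invr_gt0.
move=> z f g d zr Af Ag H d0 Hd; have [hv _] := bergman_half_diff Af Ag.
rewrite -{1}(tuple_of_complexK z) -mulrA -powRM ?invr_ge0 ?(ltW c0) ?(ltW d0)// (mulrC c^-1).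
have zB t : tuple_box (tuple_of_complex z) (r / 4) t -> Omega (cot t).
  by move=> /(box_subset r0 zr)[].
apply: (CP Omega) => //; first by rewrite divr_gt0.
set J := (\int[_]_(_ in _) _)%E.
suff cJ : (c%:E * J <= d%:E)%E.
  by rewrite mulrC EFinM lee_pdivlMl.
have mv : measurable_fun (tuple_box (tuple_of_complex z) (r / 4))
    (fun s => normc (half_diff f g (cot s)) `^ P).
  apply: (measurableT_comp (measurable_powR P)).
  exact: (holomorphic_box_measurable oO hv zB).
rewrite /J -ge0_integralZl_EFin//; last 4 first.
- exact: measurable_tuple_box.
- by move=> t _; rewrite lee_fin powR_ge0.
- exact/measurable_EFinP.
- exact: ltW.
apply: (@le_trans _ _ (E f + E g - 2 * E (half_sum f g))%:E); last by rewrite lee_fin.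
rewrite -integral_defect//.
apply: (@le_trans _ _ (\int[lebesgue2n]_(t in tuple_box (tuple_of_complex z) (r / 4))
    (convexity_defect p (half_sum f g (cot t)) (half_diff f g (cot t)))%:E)%E).
  apply: ge0_le_integral => //.
  - exact: measurable_tuple_box.
  - by move=> t _; rewrite mule_ge0// lee_fin ?powR_ge0// ltW.
  - by apply: measurable_funeM; exact/measurable_EFinP.
  - apply: (measurable_funS mD _ (measurable_defect Af Ag)); exact: zB.
  - by move=> t tB; rewrite -EFinM lee_fin H//; have [] := box_subset r0 zr tB.
apply: ge0_subset_integral => //.
- exact: measurable_tuple_box.
- exact: measurable_defect.
- by move=> t _; rewrite lee_fin defect_ge0.
Qed.

End bergman_space.

(** * Existence of minimizers *)

Section einf.
Context {R : realType}.

Lemma limn_einf_ge (u : (\bar R)^nat) (l : R) :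
  (forall e : R, 0 < e -> exists N, forall k, (N <= k)%N -> ((l - e)%:E <= u k)%E) ->
  (l%:E <= limn_einf u)%E.
Proof.
move=> H; apply/lee_addgt0Pr => e e0; have [N NP] := H e e0.
rewrite -leeBlDr// -EFinB limn_einf_lim; apply: lime_ge; first exact: is_cvg_einfs.
near=> m; apply: le_ereal_inf_tmp => _ [k /= mk <-]; apply: NP.
by apply: leq_trans mk; near: m; exact: nbhs_infty_ge.
Unshelve. all: by end_near. Qed.

Lemma limn_einf_le (u : (\bar R)^nat) (l : R) :
  (forall e : R, 0 < e -> exists N, forall k, (N <= k)%N -> (u k <= (l + e)%:E)%E) ->
  (limn_einf u <= l%:E)%E.
Proof.
move=> H; apply/lee_addgt0Pr => e e0; have [N NP] := H e e0.
rewrite -EFinD limn_einf_lim; apply: lime_le; first exact: is_cvg_einfs.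
apply: nearW => m; apply: (@le_trans _ _ (u (maxn m N))); last by apply: NP; exact: leq_maxr.
by apply: ereal_inf_lbound; exists (maxn m N) => //=; exact: leq_maxl.
Qed.

(** The lower semicontinuity that goes with Fatou's lemma, from the tangent to the power at |l|. *)
Lemma ccvg_normc_powR_le (u : nat -> R[i]) (l : R[i]) (p : R) : 1 <= p -> ccvg u l ->
  ((normc l `^ p)%:E <= limn_einf (fun k => (normc (u k) `^ p)%:E))%E.
Proof.
move=> p1 ul; apply: limn_einf_ge => e e0.
have [->|l0] := eqVneq l 0.
  exists 0%N => k _; rewrite lee_fin Normc.normc0 powR0 ?gt_eqF//; last lra.
  by rewrite sub0r (@le_trans _ _ 0)// ?powR_ge0//; lra.
have nl : 0 < normc l by rewrite normc_gt0.
pose c := p * normc l `^ p / normc l.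
have c0 : 0 < c by rewrite divr_gt0// mulr_gt0 ?powR_gt0//; lra.
have [N NP] := ul (e / c) ltac:(by rewrite divr_gt0).
exists N => k /NP uk; rewrite lee_fin.
apply: le_trans (powR_tangent_ge (normc_ge0 (u k)) nl p1).
have h : normc l - normc (u k) <= e / c.
  by apply: le_trans uk; have := normc_triangle (u k) l 0; rewrite !subr0 (normcBC l); lra.
have -> : normc l `^ p * (1 + p * (normc (u k) / normc l - 1)) =
    normc l `^ p - c * (normc l - normc (u k)) by rewrite /c; field; rewrite gt_eqF.
have : c * (normc l - normc (u k)) <= e.
  by rewrite -(@ler_pdivlMl _ c) 1?mulrC.
lra.
Qed.

Lemma ccvg_sub_le (u : nat -> R[i]) l x (e : R) N : ccvg u l ->
  (forall k, (N <= k)%N -> normc (x - u k) <= e) -> normc (x - l) <= e.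
Proof.
move=> ul H.
have := ccvg_le (ccvgD (ccvg_cst x) (ccvgMl (- 1) ul)); rewrite mulN1r; apply.
by exists N => k Nk; rewrite mulN1r; exact: H.
Qed.

End einf.

(* Conversion checks that unfold [energy] to integrals make [lra] diverge. *)
Opaque energy.

Section existence.
Context {R : realType} {n : nat}.
Local Notation P2 := (measurableTypeR R * measurableTypeR R)%type.
Local Notation V := 'rV[R[i]]_n.
Local Notation cot := (@complex_of_tuple R n).
Variables (Omega : set V) (p : R).
Hypotheses (domOmega : bounded_domain Omega) (p1 : 1 < p).
Implicit Types (z w h : V) (f g : V -> R[i]).
Local Notation A2 := (pbergman_space p Omega).
Local Notation D := (cot @^-1` Omega).
Local Notation E := (energy p Omega).
Local Notation k := (bergman_weight p Omega).

Let p0 : 0 < p. Proof. by rewrite (lt_trans ltr01). Qed.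

Lemma half_sum_normc_le f g w (M : R) : normc (f w) <= M -> normc (g w) <= M ->
  normc (half_sum f g w) <= M /\ normc (half_diff f g w) <= M.
Proof.
move=> fM gM; rewrite /half_sum /half_diff !Normc.normcM.
have -> : normc (2^-1 : R[i]) = 2^-1.
  by rewrite -(rmorph_nat (real_complex R)) -fmorphV normc_real normfV normr_nat.
have := le_normcD (f w) (g w); have := le_normcD (f w) (- 1 * g w).
by rewrite mulN1r normcN; split; lra.
Qed.

Lemma bergman_bound_unif (r B : R) : 0 < r -> exists2 M : R, 0 < M & forall z f,
  (forall w, vnorm (w - z) < r -> Omega w) -> A2 f -> E f <= B -> normc (f z) <= M.
Proof.
move=> r0; have [C C0 CP] := bergman_local_bound domOmega p1 r0.
exists (C * B `^ p^-1 + 1); first by rewrite ltr_wpDl// mulr_ge0 ?powR_ge0// ltW.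
move=> z f zr Af fB; apply: (le_trans (CP z f zr Af)).
rewrite (@le_trans _ _ (C * B `^ p^-1))//; last by rewrite lerDl.
rewrite ler_wpM2l ?(ltW C0)// ge0_ler_powR ?nnegrE ?invr_ge0 ?(ltW p0) ?energy_ge0//.
by apply: le_trans fB; exact: energy_ge0.
Qed.

Lemma ball_in_ball z w (r s : R) : vnorm (w - z) < r ->
  (forall x, vnorm (x - z) < r + s -> Omega x) -> forall x, vnorm (x - w) < s -> Omega x.
Proof.
move=> wz H x xw; apply: H; have := vnorm_triangle w x z; lra.
Qed.

(** The constant of [defect_weak] depends on a bound for |u| and |v|. Omega contains the ball of
    radius 2 r, so each point of the ball of radius r has its own ball of radius r in Omega, and the
    energy bound [B] controls f and g there. *)
Lemma weak_stability (r B : R) : 0 < r -> exists P C : R, [/\ 1 <= P, 0 < C &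
  forall z f g (d : R), (forall w, vnorm (w - z) < r + r -> Omega w) ->
    A2 f -> A2 g -> E f <= B -> E g <= B ->
    0 < d -> E f + E g - 2 * E (half_sum f g) <= d ->
    normc (half_diff f g z) <= C * d `^ P^-1].
Proof.
move=> r0; have [M M0 MP] := @bergman_bound_unif r B r0.
have [P P1 PP] := defect_weak p1; have [c c0 cP] := PP M M0.
have [C C0 CP] := defect_transfer domOmega p1 r0 P1 c0.
exists P, C; split => // z f g d zr Af Ag fB gB d0 Hd; apply: CP => //.
  by move=> w wz; apply: zr; rewrite (lt_trans wz)// ltrDl.
move=> w wz; have wr := ball_in_ball wz zr.
by have [] := half_sum_normc_le (MP w f wr Af fB) (MP w g wr Ag gB); exact: cP.
Qed.

Lemma strong_stability (r B e : R) : 0 < r -> 0 < e -> exists2 C : R, 0 < C &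
  forall z f g (d : R), (forall w, vnorm (w - z) < r + r -> Omega w) ->
    A2 f -> A2 g -> E f <= B -> E g <= B ->
    (forall w, vnorm (w - z) < r -> e <= normc (half_sum f g w)) ->
    0 < d -> E f + E g - 2 * E (half_sum f g) <= d ->
    normc (half_diff f g z) <= C * d `^ 2^-1.
Proof.
move=> r0 e0; have [M M0 MP] := @bergman_bound_unif r B r0.
have [c c0 cP] := defect_strong p1 M0 e0.
have [C C0 CP] := @defect_transfer _ _ _ _ domOmega p1 r 2 c r0 ltac:(lra) c0.
exists C => // z f g d zr Af Ag fB gB ez d0 Hd; apply: CP => //.
  by move=> w wz; apply: zr; rewrite (lt_trans wz)// ltrDl.
move=> w wz; have wr := ball_in_ball wz zr; rewrite (@powR_mulrn _ _ 2) ?normc_ge0//.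
have [uM vM] := half_sum_normc_le (MP w f wr Af fB) (MP w g wr Ag gB).
by apply: cP => //; exact: ez.
Qed.

Lemma half_sum_energy_ge z f g : A2 f -> A2 g -> f z = 1 -> g z = 1 ->
  k z <= E (half_sum f g).
Proof.
move=> Af Ag fz gz; have := weight_le_energy domOmega p1 z (bergman_half_sum domOmega p1 Af Ag).
rewrite /half_sum fz gz (_ : 2^-1 * (1 + 1) = 1 :> R[i]); last by field.
by rewrite Normc.normc1 powR1 mulr1.
Qed.

Lemma locally_cauchy (F : nat -> V -> R[i]) (B : R) z : (forall j, A2 (F j)) ->
  (forall j, E (F j) <= B) ->
  (forall d : R, 0 < d -> exists N, forall i j, (N <= i)%N -> (N <= j)%N ->
    E (F i) + E (F j) - 2 * E (half_sum (F i) (F j)) <= d) ->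
  Omega z -> exists2 r : R, 0 < r & exists M : R,
    (forall w, vnorm (w - z) < r -> Omega w /\ forall j, normc (F j w) <= M) /\
    (forall e : R, 0 < e -> exists N, forall i j w, (N <= i)%N -> (N <= j)%N ->
      vnorm (w - z) < r -> normc (F i w - F j w) <= e).
Proof.
move=> AF EB HF Oz; have [oO _ _ _] := domOmega.
have [r' r'0 zO] := open_vnormP oO Oz; pose r := r' / 3.
have r0 : 0 < r by rewrite divr_gt0.
have zO' w : vnorm (w - z) < r + (r + r) -> Omega w.
  by move=> wz; apply: zO; have h : r * 3 = r' by [rewrite divfK]; lra.
exists r => //; have [M M0 MP] := @bergman_bound_unif r B r0; exists M; split.
  move=> w wz; split => [|j]; first by apply: zO'; lra.
  by apply: MP => // x xw; apply: zO'; have := vnorm_triangle w x z; lra.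
move=> e e0; have [P [C [P1 C0 CP]]] := @weak_stability r B r0.
have x0 : 0 < e / (2 * C) by rewrite divr_gt0// mulr_gt0.
(* At this level of the defect the half difference is at most e / 2, and F i - F j is twice the half
   difference. *)
have [N NP] := HF ((e / (2 * C)) `^ P) ltac:(by rewrite powR_gt0).
exists N => i j w Ni Nj wz.
have := CP w (F i) (F j) _ (ball_in_ball wz zO') (AF i) (AF j) (EB i) (EB j)
  (powR_gt0 P x0) (NP i j Ni Nj).
rewrite -powRrM mulfV ?powRr1 ?(ltW x0)//; last by rewrite gt_eqF//; lra.
have -> : F i w - F j w = half_diff (F i) (F j) w + half_diff (F i) (F j) w.
  by rewrite /half_diff; field.
have -> : C * (e / (2 * C)) = e / 2 by field; rewrite gt_eqF.
by move=> h; apply: (le_trans (le_normcD _ _)); lra.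
Qed.

(** The half sum of two competitors is a competitor, so its energy is at least k z and the defects
    along a minimizing sequence tend to 0. By [locally_cauchy] the sequence converges locally
    uniformly; the limit is holomorphic, and Fatou's lemma bounds its energy by k z. *)
Theorem minimizer_exists z : Omega z -> exists f, is_minimizer p Omega z f.
Proof.
move=> Oz; have [oO _ _ _] := domOmega.
have /choice[F FP] : forall j : nat, exists f, [/\ A2 f, f z = 1 & E f < k z + j.+1%:R^-1].
  by move=> j; apply: weight_near => //; rewrite invr_gt0.
have AF j : A2 (F j) by have [] := FP j.
have hF j : holomorphic Omega (F j) by have [] := AF j.
have Fz j : F j z = 1 by have [] := FP j.
have EF j : E (F j) <= k z + j.+1%:R^-1 by have [_ _ /ltW] := FP j.
have inv_le (e : R) : 0 < e -> exists N, forall j, (N <= j)%N -> j.+1%:R^-1 <= e.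
  move=> e0; exists (Num.truncn e^-1) => j Nj.
  rewrite -[e]invrK lef_pV2 ?posrE ?invr_gt0// ltW//.
  by apply: (lt_le_trans (truncnS_gt _)); rewrite ler_nat ltnS.
have cau (d : R) : 0 < d -> exists N, forall i j, (N <= i)%N -> (N <= j)%N ->
    E (F i) + E (F j) - 2 * E (half_sum (F i) (F j)) <= d.
  move=> d0; have [N NP] := inv_le (d / 2) ltac:(by rewrite divr_gt0).
  exists N => i j Ni Nj; have := half_sum_energy_ge (AF i) (AF j) (Fz i) (Fz j).
  move: (EF i) (EF j) (NP i Ni) (NP j Nj); move: (E (half_sum _ _)) (E (F i)) (E (F j)) => a b c.
  by move: (i.+1%:R^-1) (j.+1%:R^-1) => x y; lra.
have EB j : E (F j) <= k z + 1.
  by rewrite (le_trans (EF j))// lerD2l invf_le1// ler1n.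
(* The pointwise limit on Omega; elsewhere the value is whatever [get] returns, and neither
   holomorphy on Omega nor the integral sees it. *)
pose f w : R[i] := get (ccvg (F ^~ w)).
have fP w : Omega w -> ccvg (F ^~ w) (f w).
  move=> Ow; have [r r0 [M [_ cM]]] := locally_cauchy AF EB cau Ow.
  apply: getPex; apply: ccauchy => e e0; have [N NP] := cM e e0.
  by exists N => i j Ni Nj; apply: NP; rewrite ?subrr ?vnorm0.
have hf : holomorphic Omega f.
  move=> w Ow; have [r r0 [M [MP cM]]] := locally_cauchy AF EB cau Ow.
  apply: (@uniform_limit_differentiable R n F f w r M) => //.
  - by move=> j x /MP[Ox _]; exact: hF.
  - by move=> j x /MP[_].
  - move=> e e0; have [N NP] := cM e e0; exists N => i x Ni xw.
    have [Ox _] := MP x xw; by apply: (@ccvg_sub_le _ _ _ _ e N (fP x Ox)) => j Nj; exact: NP.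
have fz : f z = 1.
  apply: (ccvg_unique (fP z Oz)); rewrite (_ : F ^~ z = fun=> 1); first exact: ccvg_cst.
  by apply/funext => j; rewrite Fz.
have If : (pintegral p Omega f <= (k z)%:E)%E.
  apply: (@le_trans _ _ (limn_einf (fun j => pintegral p Omega (F j)))); last first.
    apply: limn_einf_le => e e0; have [N NP] := inv_le e e0; exists N => j Nj.
    rewrite pintegralE// lee_fin; move: (EF j) (NP j Nj); move: (E (F j)) (j.+1%:R^-1) => a x.
    by lra.
  have mF j : measurable_fun D (fun t => (normc (F j (cot t)) `^ p)%:E).
    by apply/measurable_EFinP; exact: measurable_normc_powR.
  have F0 j t : D t -> (0 <= (normc (F j (cot t)) `^ p)%:E)%E by rewrite lee_fin powR_ge0.
  have := @fatou _ _ R (@lebesgue2n R n) D (measurable_open oO)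
    (fun j t => (normc (F j (cot t)) `^ p)%:E) mF F0.
  apply: le_trans.
  apply: ge0_le_integral => //.
  - exact: measurable_open.
  - by move=> t _; rewrite lee_fin powR_ge0.
  - by apply/measurable_EFinP; exact: measurable_normc_powR.
  - rewrite /limn_einf; apply: measurableT_comp => //.
    apply: (@measurable_fun_limn_esup _ _ R D (fun j t => (- (normc (F j (cot t)) `^ p)%:E)%E)).
    by move=> j; exact: measurableT_comp.
  - by move=> t Dt; apply: ccvg_normc_powR_le; [exact: ltW|exact: fP].
have Af : A2 f by split => //; apply: le_lt_trans If (ltry _).
exists f; split => //; apply/eqP; rewrite eq_le pbergman_min_le// andbT.
move: If; rewrite pintegralE// lee_fin => h.
rewrite -energy_powR_inv.
have -> : pbergman_min p Omega z = k z `^ p^-1.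
  by rewrite -powRrM mulfV ?powRr1 ?pbergman_min_ge0// gt_eqF.
by rewrite ge0_ler_powR ?nnegrE ?invr_ge0 ?(ltW p0) ?energy_ge0 ?weight_ge0.
Qed.

Lemma minimizerP z : Omega z -> is_minimizer p Omega z (get (is_minimizer p Omega z)).
Proof. by move=> Oz; exact: getPex (minimizer_exists Oz). Qed.

End existence.

(** * Stability of minimizers *)

(** Compactness in near-covering form, along the filter of C tending to infinity; monotonicity in C
    stands in for the maximum of finitely many local constants. *)
Lemma compact_uniform (R : realType) (T : topologicalType) (K : set T) (Q : R -> T -> Prop) :
  compact K -> (forall (C C' : R) x, C <= C' -> Q C x -> Q C' x) ->
  (forall x, K x -> exists C : R, nbhs x [set y | K y -> Q C y]) ->
  exists2 C : R, 0 < C & forall x, K x -> Q C x.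
Proof.
move=> /compact_near_coveringP/near_covering_withinP cK mono loc.
suff : \forall C \near +oo%R, K `<=` Q C.
  move=> [a [_ aP]]; exists (`|a| + 1); first by rewrite ltr_wpDl.
  by apply: aP; rewrite ltr_pwDr// ler_norm.
apply: (cK R +oo%R Q) => x Kx; have [C CP] := loc x Kx.
exists ([set y | K y -> Q C y], [set C' | C < C']) => /=.
  by split => //; exists C; split; [exact: num_real|].
by move=> [y C'] /= [yP CC'] Ky; apply: mono (ltW CC') (yP Ky).
Qed.

Section stability.
Context {R : realType} {n : nat}.
Local Notation V := 'rV[R[i]]_n.
Variables (Omega : set V) (p : R).
Hypotheses (domOmega : bounded_domain Omega) (p1 : 1 < p).
Implicit Types (z w h zeta : V) (f g : V -> R[i]).
Local Notation A2 := (pbergman_space p Omega).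
Local Notation E := (energy p Omega).
Local Notation k := (bergman_weight p Omega).
Local Notation m z := (get (is_minimizer p Omega z)).

Let p0 : 0 < p. Proof. by rewrite (lt_trans ltr01). Qed.
Let oO : open Omega. Proof. by case: domOmega. Qed.

Lemma compact_uniform_radius (S : set V) : compact S -> S `<=` Omega ->
  exists2 r : R, 0 < r & forall z, S z -> forall w, vnorm (w - z) < r + r -> Omega w.
Proof.
move=> cS SO.
(* C is the inverse of a radius, which makes the property monotone in the direction that
   [compact_uniform] requires. *)
pose Q (C : R) z := 0 < C /\ forall w, vnorm (w - z) * C < 1 -> Omega w.
have [||C C0 CP] := @compact_uniform R V S Q cS.
- move=> C C' z CC' [C0 CP]; split; first exact: lt_le_trans CC'.
  move=> w wC; apply: CP; apply: le_lt_trans wC.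
  by rewrite ler_wpM2l ?vnorm_ge0.
- move=> z Sz; have [r r0 rO] := open_vnormP oO (SO z Sz).
  exists (2 / r); apply/nbhs_vnormP; exists (r / 2); first by rewrite divr_gt0.
  move=> y yz _; split; first by rewrite divr_gt0.
  move=> w; rewrite mulrA ltr_pdivrMr// mul1r => wy; apply: rO.
  by have := vnorm_triangle y w z; lra.
exists (C^-1 / 2); first by rewrite divr_gt0// invr_gt0.
move=> z Sz w; rewrite -splitr => wz; have [_] := CP z Sz; apply.
by rewrite -ltr_pdivlMr// mul1r.
Qed.

Lemma bergman_lipschitz (r B : R) : 0 < r -> exists2 L : R, 0 < L & forall z f,
  (forall w, vnorm (w - z) < r + r -> Omega w) -> A2 f -> E f <= B ->
  forall w, vnorm (w - z) <= r / 8 -> normc (f w - f z) <= L * vnorm (w - z).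
Proof.
move=> r0; have [M M0 MP] := @bergman_bound_unif _ _ _ _ domOmega p1 r B r0.
exists (32 * M / r); first by rewrite divr_gt0// mulr_gt0.
move=> z f zr Af fB w wz.
rewrite -[in f w](subrK z w) [w - z + z]addrC.
apply: (@holo_lipschitz R n f z r M r0 _ _ (w - z) wz).
- move=> x xz; have [hf _] := Af; apply: hf; apply: zr; lra.
- by move=> x xz; apply: MP => //; exact: (ball_in_ball xz zr).
Qed.

Lemma minimizer_facts z : Omega z ->
  [/\ A2 (m z), m z z = 1, E (m z) = k z & E (m z) <= E (fun=> 1)].
Proof.
move=> Oz; have [Am mz mE] := minimizerP domOmega p1 Oz.
have Ek : E (m z) = k z by rewrite -pnorm_powR// mE.
by split => //; rewrite Ek; exact: weight_le1.
Qed.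

Lemma minimizer_bound : exists2 B : R, 0 <= B &
  (forall z, Omega z -> E (m z) <= B) /\ (forall z, k z <= B).
Proof.
exists (E (fun=> 1)); first exact: energy_ge0.
by split => z => [/minimizer_facts[]//|]; exact: weight_le1.
Qed.

Lemma half_diffE f g w : half_diff f g w = 2^-1 * (f w - g w).
Proof. by rewrite /half_diff mulN1r. Qed.

Lemma normc_half (x : R[i]) : normc (2^-1 * x) = 2^-1 * normc x.
Proof.
rewrite Normc.normcM; congr (_ * _).
by rewrite -(rmorph_nat (real_complex R)) -fmorphV normc_real normfV normr_nat.
Qed.

(* The half sum [u] satisfies [u z = 1 + v z] and [u z' = 1 - v z'], so its
   energy is at least [k z |1 + v z|^p] and at least [k z' |1 - v z'|^p]; the
   bound subtracts one of each. *)
Lemma minimizer_defect_le z z' f g : A2 f -> A2 g -> f z' = 1 -> g z = 1 ->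
  E f = k z' -> E g = k z ->
  E f + E g - 2 * E (half_sum f g) <=
    p * (k z' * normc (half_diff f g z' - half_diff f g z) +
         `|k z' - k z| * normc (half_diff f g z)).
Proof.
move=> Af Ag fz gz Ef Eg; set u := half_sum f g; set v := half_diff f g.
have Au : A2 u := bergman_half_sum domOmega p1 Af Ag.
have uz : complex.Re (u z) = 1 + complex.Re (v z).
  have <- : complex.Re (g z + v z) = 1 + complex.Re (v z) by rewrite gz ReD.
  by congr complex.Re; rewrite -(half_sumB f g z) subrK.
have uz' : complex.Re (u z') = 1 - complex.Re (v z').
  have <- : complex.Re (f z' - v z') = 1 - complex.Re (v z') by rewrite fz ReB.
  by congr complex.Re; rewrite -(half_sumD f g z') addrK.
have h1 := weight_le_energy domOmega p1 z Au.
have h2 := weight_le_energy domOmega p1 z' Au.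
have := ler_wpM2l (weight_ge0 Omega p z) (normc_powR_ge (u z) (ltW p1)); rewrite uz => h3.
have := ler_wpM2l (weight_ge0 Omega p z') (normc_powR_ge (u z') (ltW p1)); rewrite uz' => h4.
have h5 : k z' * complex.Re (v z' - v z) <= k z' * normc (v z' - v z).
  by rewrite ler_wpM2l ?weight_ge0// (le_trans (ler_norm _))// ler_Re_normc.
have h6 : (k z' - k z) * complex.Re (v z) <= `|k z' - k z| * normc (v z).
  apply: (le_trans (ler_norm _)); rewrite normrM ler_wpM2l ?normr_ge0//.
  exact: ler_Re_normc.
rewrite Eg Ef.
apply: (@le_trans _ _ (p * (k z' * complex.Re (v z' - v z) + (k z' - k z) * complex.Re (v z)))).
  have := le_trans h3 h1; have := le_trans h4 h2; rewrite ReB.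
  move: (E u) (k z) (k z') (complex.Re (v z)) (complex.Re (v z')) => e a b x y H1 H2.
  have -> : p * (b * (y - x) + (b - a) * x) =
      b + a - (b * (1 + p * (1 - y - 1)) + a * (1 + p * (1 + x - 1))) by ring.
  by rewrite lerD2l lerN2 mulr_natl mulr2n; exact: lerD.
by rewrite ler_wpM2l ?(ltW p0)// lerD.
Qed.

Lemma weight_lipschitz (S : set V) : compact S -> S `<=` Omega ->
  exists2 L : R, 0 < L & forall z z', S z -> S z' -> `|k z' - k z| <= L * vnorm (z' - z).
Proof.
move=> cS SO; have [r r0 rS] := compact_uniform_radius cS SO.
have [B B0 [mB wB]] := minimizer_bound.
have [L L0 LP] := @bergman_lipschitz r B r0.
exists (B * p * L + 8 * B / r + 1).
  by rewrite ltr_wpDl// addr_ge0// ?divr_ge0 ?mulr_ge0// ?ltW.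
suff H z z' : S z -> S z' -> k z' - k z <= (B * p * L + 8 * B / r + 1) * vnorm (z' - z).
  move=> z z' Sz Sz'; rewrite ler_norml H// andbT.
  by have := H z' z Sz' Sz; rewrite (vnormBC z); lra.
move=> Sz Sz'; have kB := wB z'.
have k0 := weight_ge0 Omega p z; have k0' := weight_ge0 Omega p z'.
have d0 := vnorm_ge0 (z' - z).
have BL0 : 0 <= B * p * L by rewrite !mulr_ge0// ltW.
have B8 : 0 <= 8 * B / r by rewrite divr_ge0 ?mulr_ge0// ltW.
(* For distant points the bound [B] on k suffices. For close ones m_z is a competitor at z' up to
   the factor m_z(z'), whose real part is at least 1 - L |z' - z|. *)
have [far|near] := leP (r / 8) (vnorm (z' - z)).
  apply: (@le_trans _ _ (8 * B / r * vnorm (z' - z))); last by rewrite ler_wpM2r//; lra.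
  apply: (@le_trans _ _ B); first lra.
  apply: (@le_trans _ _ (8 * B / r * (r / 8))); last by rewrite ler_wpM2l.
  by rewrite le_eqVlt; apply/orP; left; apply/eqP; field; rewrite gt_eqF.
have [Ag gz Eg _] := minimizer_facts (SO z Sz); have gB := mB z (SO z Sz).
have := LP z (m z) (rS z Sz) Ag gB z' (ltW near); rewrite gz => h1.
have h2 := weight_le_energy domOmega p1 z' Ag; rewrite Eg in h2.
have h3 := normc_powR_ge (m z z') (ltW p1).
have h4 : - (L * vnorm (z' - z)) <= complex.Re (m z z') - 1.
  have := ler_Re_normc (m z z' - 1); rewrite ReB ler_norml => /andP[h _].
  by apply: le_trans h; rewrite lerN2.
have h5 : k z' * (1 - p * (L * vnorm (z' - z))) <= k z.
  apply: le_trans h2; rewrite ler_wpM2l// (le_trans _ h3)// lerD2l -mulrN ler_wpM2l//.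
  exact: ltW.
have h6 : k z' * (p * (L * vnorm (z' - z))) <= B * (p * (L * vnorm (z' - z))).
  by rewrite ler_wpM2r// !mulr_ge0// ltW.
apply: (@le_trans _ _ (B * p * L * vnorm (z' - z))); last by rewrite ler_wpM2r//; lra.
have -> : B * p * L * vnorm (z' - z) = B * (p * (L * vnorm (z' - z))) by ring.
by move: h5 h6; rewrite mulrBr mulr1; lra.
Qed.

(* Near the diagonal both minimizers are close to 1 around [z], so [v] is at most
   a multiple of the square root of the defect [Del] there, and
   [minimizer_defect_le] becomes [Del <= G |z' - z| sqrt Del]. *)
Lemma minimizer_defect_quadratic (S : set V) : compact S -> S `<=` Omega ->
  exists2 C : R, 0 < C & forall z z', S z -> S z' ->
    E (m z') + E (m z) - 2 * E (half_sum (m z') (m z)) <= C * vnorm (z' - z) ^+ 2.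
Proof.
move=> cS SO; have [r r0 rS] := compact_uniform_radius cS SO.
have [K K0 KP] := weight_lipschitz cS SO.
have [B B0 [mB wB]] := minimizer_bound.
have [L L0 LP] := @bergman_lipschitz r B r0.
(* Within s of its own base point, a minimizer differs from 1 by at most 1/4; r / 8 is the range of
   the Lipschitz bound [L]. *)
pose s : R := Num.min (r / 8) (4 * L)^-1.
have s0 : 0 < s by rewrite lt_min divr_gt0// invr_gt0 mulr_gt0.
have sr : s <= r / 8 by rewrite ge_min lexx.
have sL : L * s <= 4^-1.
  apply: (@le_trans _ _ (L * (4 * L)^-1)); first by rewrite ler_wpM2l ?ge_min ?lexx ?orbT ?ltW.
  by rewrite invfM mulrCA divff ?mulr1// gt_eqF.
(* If |z' - z| < q / 8, a point within 2 q of z is within s = 4 q of z' as well, so both minimizers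
   are close to 1 there. *)
pose q : R := s / 4; have q0 : 0 < q by rewrite divr_gt0.
have qE : q * 4 = s by rewrite divfK.
clearbody q; clearbody s.
have [C C0 CP] := @strong_stability _ _ _ _ domOmega p1 q B 2^-1 q0 ltac:(lra).
(* The two terms of [minimizer_defect_le]: 32 C / q is the Cauchy estimate for the increment of v on
   the ball of radius q, and [K] is the Lipschitz constant of k. *)
pose G := p * (B * (32 * C / q) + K * C).
have Cq0 : 0 <= 32 * C / q by rewrite divr_ge0 ?mulr_ge0// ltW.
have G0 : 0 <= G.
  by apply: mulr_ge0 (ltW p0) _; apply: addr_ge0; apply: mulr_ge0 => //; exact: ltW.
have B80 : 0 <= 2 * B / (q / 8) ^+ 2 by exact: (divr_ge0 (mulr_ge0 (ler0n R 2) B0) (sqr_ge0 _)).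
exists (G ^+ 2 + 2 * B / (q / 8) ^+ 2 + 1); first by rewrite ltr_wpDl// addr_ge0 ?sqr_ge0.
move=> z z' Sz Sz'.
have [Ag gz Eg _] := minimizer_facts (SO z Sz); have gB := mB z (SO z Sz).
have [Af fz Ef _] := minimizer_facts (SO z' Sz'); have fB := mB z' (SO z' Sz').
move: (m z') (m z) Ag gz Eg gB Af fz Ef fB => f g Ag gz Eg gB Af fz Ef fB.
set Del := _ - _.
have d2 := sqr_ge0 (vnorm (z' - z)); have d0 := vnorm_ge0 (z' - z).
have [Del0|Del0] := leP Del 0.
  by apply: (le_trans Del0); rewrite mulr_ge0// !addr_ge0 ?sqr_ge0.
(* At distance at least q / 8 the defect is at most 2 B, which the second term of the constant
   absorbs. *)
have [far|near] := leP (q / 8) (vnorm (z' - z)).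
  apply: (@le_trans _ _ (2 * B)).
    have -> : 2 * B = B + B - 2 * 0 by ring.
    by apply: lerB; [exact: lerD|rewrite ler_wpM2l ?energy_ge0].
  apply: (@le_trans _ _ (2 * B / (q / 8) ^+ 2 * vnorm (z' - z) ^+ 2)); last first.
    by rewrite ler_wpM2r//; have := sqr_ge0 G; lra.
  rewrite -[leLHS](@divfK _ ((q / 8) ^+ 2)); last by rewrite expf_neq0// gt_eqF// divr_gt0.
  rewrite (ler_wpM2l B80)// lerXn2r ?nnegrE// divr_ge0//; exact: ltW.
have close w : vnorm (w - z) < q + q -> normc (g w - 1) <= 4^-1 /\ normc (f w - 1) <= 4^-1.
  move=> wz; have wz' : vnorm (w - z') <= s.
    by have := vnorm_triangle z w z'; rewrite (vnormBC z); lra.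
  have wzs : vnorm (w - z) <= s by lra.
  have := LP z _ (rS z Sz) Ag gB w (le_trans wzs sr); rewrite gz => h1.
  have := LP z' _ (rS z' Sz') Af fB w (le_trans wz' sr); rewrite fz => h2.
  split.
    by apply: (le_trans h1); apply: le_trans sL; rewrite ler_wpM2l// ltW.
  by apply: (le_trans h2); apply: le_trans sL; rewrite ler_wpM2l// ltW.
set u := half_sum f g; pose v := half_diff f g.
have uge w : vnorm (w - z) < q + q -> 2^-1 <= normc (u w).
  move=> /close[h1 h2].
  have [h3 _] := @half_sum_normc_le _ _ (fun w => f w - 1) (fun w => g w - 1) w _ h2 h1.
  have uE : half_sum (fun w => f w - 1) (fun w => g w - 1) w = u w - 1.
    by rewrite /u /half_sum; field.
  rewrite uE in h3; have := normc_triangle (u w) 1 0; rewrite !subr0 Normc.normc1 normcBC; lra.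
have vle w : vnorm (w - z) < q -> normc (v w) <= C * Del `^ 2^-1.
  move=> wz; apply: CP => //.
  - by move=> x xw; apply: (rS z Sz); have := vnorm_triangle w x z; lra.
  - by move=> x xw; apply: uge; have := vnorm_triangle w x z; lra.
have vL : normc (v z' - v z) <= 32 * (C * Del `^ 2^-1) / q * vnorm (z' - z).
  rewrite -[in v z'](subrK z z') [z' - z + z]addrC.
  have vd w : vnorm (w - z) < q -> differentiable v w.
    move=> wz; have [hv _] := bergman_half_diff domOmega p1 Af Ag; apply: hv.
    by apply: (rS z Sz); lra.
  exact: (holo_lipschitz q0 vd vle (ltW near)).
have := minimizer_defect_le Af Ag fz gz Ef Eg; rewrite -/Del -/v => H.
have DelG : Del <= G * vnorm (z' - z) * Del `^ 2^-1.
  apply: (le_trans H); rewrite /G -!mulrA ler_wpM2l ?(ltW p0)//.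
  have k0' := weight_ge0 Omega p z'; have kB := wB z'.
  have -> : (B * (32 * (C / q)) + K * C) * (vnorm (z' - z) * Del `^ 2^-1) =
     B * (32 * (C * Del `^ 2^-1) / q * vnorm (z' - z)) + K * vnorm (z' - z) * (C * Del `^ 2^-1).
    by ring.
  apply: lerD; first by rewrite ler_pM ?normc_ge0.
  by rewrite ler_pM ?normc_ge0 ?normr_ge0 ?KP// vle// subrr vnorm0.
have sq : Del = Del `^ 2^-1 ^+ 2.
  by rewrite -(@powR_mulrn _ _ 2) ?powR_ge0// -powRrM mulVf// powRr1// ltW.
have x0 : 0 < Del `^ 2^-1 by rewrite powR_gt0.
have xG : Del `^ 2^-1 <= G * vnorm (z' - z).
  by move: DelG; rewrite {1}sq expr2 ler_pM2r.
rewrite sq; apply: (@le_trans _ _ ((G * vnorm (z' - z)) ^+ 2)).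
  by rewrite lerXn2r ?nnegrE ?(ltW x0)// mulr_ge0.
by rewrite exprMn ler_wpM2r//; lra.
Qed.


(* [r], [q] and [rho] bound, in this order, the square around [zeta0], the balls
   around its boundary on which [m z0] varies by at most [e / 8], and the
   distances at which [m z] and [m z0] differ by at most [e / 8] there. *)
Lemma minimizer_locally_lipschitz (S : set V) z0 zeta0 : connected Omega ->
  compact S -> S `<=` Omega -> S z0 -> Omega zeta0 ->
  exists2 rho : R, 0 < rho & exists C : R, forall z z' zeta, S z -> S z' ->
    vnorm (z - z0) < rho -> vnorm (z' - z0) < rho -> vnorm (zeta - zeta0) < rho ->
    normc (half_diff (m z') (m z) zeta) <= C * vnorm (z' - z).
Proof.
move=> cO cS SO Sz0 Oz0.
have [Q Q0 QP] := minimizer_defect_quadratic cS SO.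
have [B B0 [mB _]] := minimizer_bound.
have mB' z : S z -> A2 (m z) /\ E (m z) <= B.
  by move=> Sz; have [Am _ _ _] := minimizer_facts (SO z Sz); split => //; exact: mB (SO z Sz).
have [Am0 mz0 _ _] := minimizer_facts (SO z0 Sz0); have m0B := mB z0 (SO z0 Sz0).
have [r' r'0 r'O] := open_vnormP oO Oz0.
pose r : R := r' / 8; have r0 : 0 < r by rewrite divr_gt0.
have rE : r * 8 = r' by rewrite divfK.
have [hm0 _] := Am0.
have mz00 : m z0 z0 != 0 by rewrite mz0 oner_neq0.
have r2 : 0 < r / 2 by rewrite divr_gt0.
have [h [e e0 [hr he]]] := zero_free_square oO cO hm0 (SO z0 Sz0) mz00 Oz0 r2.
clear hm0 mz00 mz0.
have rO w : vnorm (w - zeta0) < r * 8 -> Omega w by rewrite rE; exact: r'O.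
clearbody r; clear r'O rE r'0 r2 r'.
have [P [W [P1 W0 WP]]] := @weak_stability _ _ _ _ domOmega p1 r B r0.
have [L L0 LP] := @bergman_lipschitz r B r0.
pose q : R := Num.min (r / 8) (e / (8 * L)); have q0 : 0 < q.
  by rewrite lt_min !divr_gt0 ?mulr_gt0.
have qr : q <= r / 8 by rewrite ge_min lexx.
have qL : L * q <= e / 8.
  apply: (@le_trans _ _ (L * (e / (8 * L)))); first by rewrite ler_wpM2l ?ge_min ?lexx ?orbT ?ltW.
  by rewrite le_eqVlt; apply/orP; left; apply/eqP; field; rewrite gt_eqF.
clearbody q.
pose q2 : R := q / 2; have q20 : 0 < q2 by rewrite divr_gt0.
have q2E : q2 + q2 = q by rewrite -splitr.
clearbody q2.
have e2 : 0 < e / 2 by rewrite divr_gt0.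
have [C C0 CP] := @strong_stability _ _ _ _ domOmega p1 q2 B (e / 2) q20 e2.
have x0 : 0 < e / (16 * W) by rewrite divr_gt0// mulr_gt0.
(* The level of the defect at which [weak_stability] bounds the half difference by e / 16, hence the
   difference by e / 8. *)
pose y : R := (e / (16 * W)) `^ P; have y0 : 0 < y by rewrite powR_gt0.
(* Because rho <= 1, the quadratic bound on the defect is at most Q rho <= y when |z - z0| < rho. *)
pose rho : R := Num.min q2 (Num.min 1 (y / (Q + 1))).
have Q1 : 0 < Q + 1 by rewrite addr_gt0.
have rho0 : 0 < rho by rewrite !lt_min q20 ltr01 divr_gt0.
have rhoq : rho <= q2 by rewrite ge_min lexx.
have rho1 : rho <= 1 by rewrite !ge_min lexx orbT.
have rhoy : (Q + 1) * rho <= y.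
  by rewrite mulrC -ler_pdivlMr// !ge_min lexx !orbT.
clearbody rho.
have near0 z w : S z -> vnorm (z - z0) < rho -> vnorm (w - zeta0) < r * 3 ->
    normc (m z w - m z0 w) <= e / 8.
  move=> Sz zz wz; have [Am mBz] := mB' z Sz.
  have d0 := vnorm_ge0 (z - z0).
  have zd : E (m z) + E (m z0) - 2 * E (half_sum (m z) (m z0)) <= y.
    apply: (le_trans (QP z0 z Sz0 Sz)); apply: le_trans rhoy.
    rewrite expr2 mulrA; apply: (@le_trans _ _ (Q * 1 * rho)).
      rewrite ler_pM// ?ler_pM ?mulr_ge0 ?(ltW Q0) ?(ltW zz)//.
      exact: le_trans (ltW zz) rho1.
    by rewrite mulr1 ler_wpM2r ?lerDl// ltW.
  have wO x : vnorm (x - w) < r + r -> Omega x.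
    by move=> xw; apply: rO; have := vnorm_triangle w x zeta0; clear -domOmega p1 xw wz r0; lra.
  have := WP w _ _ y wO Am Am0 mBz m0B y0 zd.
  rewrite /y -powRrM mulfV ?gt_eqF//; last by rewrite (lt_le_trans ltr01).
  rewrite powRr1 ?(ltW x0)// half_diffE normc_half.
  have -> : W * (e / (16 * W)) = e / 16 by field; rewrite gt_eqF.
  by move: (normc _) => t; clear -domOmega p1; lra.
exists rho => //; exists (8 * (C * Num.sqrt Q)) => z z' zeta Sz Sz' zz zz' zetaz.
have [Ag gB] := mB' z Sz; have [Af fB] := mB' z' Sz'.
have d0 := vnorm_ge0 (z' - z).
have [zE|zz1] := eqVneq z' z.
  by rewrite zE half_diffE !subrr mulr0 Normc.normc0 vnorm0 mulr0.
have d1 : 0 < vnorm (z' - z).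
  rewrite lt_def d0 andbT; apply: contra zz1 => /eqP /vnorm_eq0 /eqP.
  by rewrite subr_eq0.
have zd := QP z z' Sz Sz'.
have Qd0 : 0 < Q * vnorm (z' - z) ^+ 2 by rewrite mulr_gt0// exprn_gt0.
have line x y' : -1 <= x <= 1 -> -1 <= y' <= 1 ->
    vnorm (zeta + (x +i* y') *: h - zeta0) < r * 2.
  move=> xP yP; have := line_in_ball zeta xP yP hr.
  have := vnorm_triangle zeta (zeta + (x +i* y') *: h) zeta0.
  by move: zetaz qr q2E rhoq r0; clear -domOmega p1; lra.
have bd x y' : -1 <= x <= 1 -> -1 <= y' <= 1 -> [|| x == -1, x == 1, y' == -1 | y' == 1] ->
    normc (half_diff (m z') (m z) (zeta + (x +i* y') *: h)) <= C * Num.sqrt Q * vnorm (z' - z).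
  move=> xP yP xy; have lz := line x y' xP yP.
  rewrite -mulrA (_ : Num.sqrt Q * vnorm (z' - z) = (Q * vnorm (z' - z) ^+ 2) `^ 2^-1); last first.
    by rewrite -powR12_sqrt ?ltW// powRM ?ltW ?exprn_gt0// -[_ ^+ 2](@powR_mulrn _ _ 2)// -powRrM mulfV// powRr1.
  apply: CP => //.
    move=> w wz; apply: rO; have := vnorm_triangle (zeta + (x +i* y') *: h) w zeta0.
    by move: wz lz q2E qr r0; clear -domOmega p1; lra.
  (* b is the point of the fixed square that corresponds to the centre of the ball on the translated
     one. There |m_z0| >= e; passing from b to w costs e / 8, and passing from m_z0 to the half sum
     another e / 8, so more than e / 2 is left. *)
  move=> w wz; pose b := zeta0 + (x +i* y') *: h.
  have wb : vnorm (w - b) < q.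
    have := vnorm_triangle (zeta + (x +i* y') *: h) w b.
    rewrite /b opprD addrACA subrr addr0; move: wz zetaz q2E rhoq; clear -domOmega p1; lra.
  have bz : vnorm (b - zeta0) < r by rewrite /b; exact: line_in_ball.
  have wz3 : vnorm (w - zeta0) < r * 3.
    by have := vnorm_triangle b w zeta0; move: wb bz qr r0; clear -domOmega p1; lra.
  have bO x' : vnorm (x' - b) < r + r -> Omega x'.
    by move=> xb; apply: rO; have := vnorm_triangle b x' zeta0; move: xb bz r0; clear -domOmega p1; lra.
  have wq : vnorm (w - b) <= r / 8 by exact: le_trans (ltW wb) qr.
  have h1 := LP b _ bO Am0 m0B w wq.
  have h1' : normc (m z0 w - m z0 b) <= e / 8.
    apply: (le_trans h1); apply: le_trans qL; rewrite ler_wpM2l ?ltW//.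
  have h2 := near0 z w Sz zz wz3; have h3 := near0 z' w Sz' zz' wz3.
  have h4 := he x y' xP yP xy; rewrite -/b in h4.
  have [h5 _] := @half_sum_normc_le _ _ (fun w => m z' w - m z0 w) (fun w => m z w - m z0 w) w _ h3 h2.
  have uE : half_sum (fun w => m z' w - m z0 w) (fun w => m z w - m z0 w) w =
      half_sum (m z') (m z) w - m z0 w by rewrite /half_sum; field.
  rewrite uE in h5.
  have := normc_triangle (m z0 w) (m z0 b) 0; rewrite !subr0 (normcBC (m z0 b)).
  have := normc_triangle (half_sum (m z') (m z) w) (m z0 w) 0; rewrite !subr0 (normcBC (m z0 w)).
  by move: h4 h5 h1' e0; clear -domOmega p1; lra.
rewrite -mulrA.
have := @cauchy_max R (fun l => half_diff (m z') (m z) (zeta + l *: h)) (C * Num.sqrt Q * vnorm (z' - z)) 0.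
rewrite scale0r addr0; apply.
- by rewrite Normc.normc0 invr_ge0.
- move=> x y' xP yP; apply: differentiable_line.
  have [hv _] := bergman_half_diff domOmega p1 Af Ag; apply: hv; apply: rO.
  by have := line x y' xP yP; move: r0; clear -domOmega p1; lra.
- exact: bd.
Qed.

End stability.

(** * Uniform Lipschitz bounds on S and the kernel on the diagonal *)

Section global.
Context {R : realType} {n : nat}.
Local Notation V := 'rV[R[i]]_n.
Variables (Omega : set V) (p : R).
Hypotheses (domOmega : bounded_domain Omega) (p1 : 1 < p).
Implicit Types (z w h zeta : V) (f g : V -> R[i]).
Local Notation A2 := (pbergman_space p Omega).
Local Notation E := (energy p Omega).
Local Notation k := (bergman_weight p Omega).
Local Notation m z := (get (is_minimizer p Omega z)).

Let p0 : 0 < p. Proof. by rewrite (lt_trans ltr01). Qed.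
Let oO : open Omega. Proof. by case: domOmega. Qed.

Lemma minimizer_bounded (S : set V) : compact S -> S `<=` Omega ->
  exists2 M : R, 0 < M & forall z zeta, S z -> S zeta -> normc (m z zeta) <= M.
Proof.
move=> cS SO; have [r r0 rS] := compact_uniform_radius domOmega cS SO.
have [B B0 [mB _]] := minimizer_bound domOmega p1.
have [M M0 MP] := @bergman_bound_unif _ _ _ _ domOmega p1 r B r0.
exists M => // z zeta Sz Szeta; apply: MP.
- by move=> w wz; apply: (rS zeta Szeta); rewrite ltr_wpDl// ltW.
- by have [] := minimizer_facts domOmega p1 (SO z Sz).
- exact: mB (SO z Sz).
Qed.

(** [compact_uniform] is applied to triples (z, z', zeta). Around a triple with z = z' the local
    estimate holds, with a factor 2 for the half difference. Around any other, |z' - z| stays above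
    half of its central value and boundedness of the minimizers is enough. *)
Theorem minimizer_lipschitz (S : set V) : compact S -> S `<=` Omega ->
  exists2 C : R, 0 < C & forall zeta z z', S zeta -> S z -> S z' ->
    normc (m z' zeta - m z zeta) <= C * vnorm (z' - z).
Proof.
move=> cS SO; have [_ cO _ _] := domOmega.
have [M M0 MP] := minimizer_bounded cS SO.
pose Q (C : R) (x : V * V * V) :=
  normc (m x.1.2 x.2 - m x.1.1 x.2) <= C * vnorm (x.1.2 - x.1.1).
have [||C C0 CP] := @compact_uniform R _ (S `*` S `*` S) Q
  (compact_setX (compact_setX cS cS) cS).
- by move=> C C' x CC' /le_trans; apply; rewrite ler_wpM2r ?vnorm_ge0.
- move=> [[z0 z0'] zeta0] [[/= Sz0 Sz0'] Szeta0].
  have ball3 (rho : R) (P : V * V * V -> Prop) : 0 < rho ->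
      (forall z z' zeta, vnorm (z - z0) < rho -> vnorm (z' - z0') < rho ->
        vnorm (zeta - zeta0) < rho -> P (z, z', zeta)) -> nbhs (z0, z0', zeta0) P.
    move=> rho0 H; pose U w := [set x | vnorm (x - w) < rho].
    have nU w : nbhs w (U w) by apply/nbhs_vnormP; exists rho.
    exists (U z0 `*` U z0', U zeta0).
      by split; [exists (U z0, U z0'); [split|move=> x]|].
    by move=> [[z z'] zeta] [/= [h1 h2] h3]; exact: H.
  have [E0|zz0] := eqVneq z0' z0.
    have [rho rho0 [C CP]] := minimizer_locally_lipschitz domOmega p1 cO cS SO Sz0 (SO _ Szeta0).
    exists (2 * C); apply: (ball3 rho) => // z z' zeta; rewrite E0 => h1 h2 h3 [[/= Sz Sz'] _].
    have := CP z z' zeta Sz Sz' h1 h2 h3; rewrite half_diffE normc_half /Q /=.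
    by move: (normc _) (vnorm _) => a b; lra.
  pose d := vnorm (z0' - z0).
  have d0 : 0 < d.
    rewrite lt_def vnorm_ge0 andbT; apply: contra zz0 => /eqP /vnorm_eq0 /eqP.
    by rewrite subr_eq0.
  exists (2 * M / (d / 2)); apply: (ball3 (d / 4)); first by rewrite divr_gt0.
  move=> z z' zeta h1 h2 h3 [[/= Sz Sz'] Sz3]; rewrite /Q /=.
  have dd : d / 2 <= vnorm (z' - z).
    have := vnorm_triangle z' z0' z0; have := vnorm_triangle z z' z0.
    by rewrite (vnormBC z0' z') -/d; lra.
  apply: (le_trans (le_normcB _ _)); apply: (@le_trans _ _ (2 * M)).
    by have := MP z zeta Sz Sz3; have := MP z' zeta Sz' Sz3; lra.
  have d2 : 0 < d / 2 by rewrite divr_gt0.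
  rewrite -[leLHS](@divfK _ (d / 2)) ?(gt_eqF d2)// ler_wpM2l// divr_ge0// ?mulr_ge0//; exact: ltW.
exists C => // zeta z z' Szeta Sz Sz'; exact: (CP (z, z', zeta)).
Qed.

Lemma weight_gt0 z : Omega z -> 0 < k z.
Proof.
move=> Oz; have [r r0 rO] := open_vnormP oO Oz.
by have [c c0 /(_ z rO)] := weight_lower_bound domOmega p1 r0; exact: lt_le_trans.
Qed.

(** [weight_le_energy] bounds the supremum, and the minimizer multiplied by k(z)^(-1/p) has norm 1
    and attains it. *)
Lemma pbergman_kernelE z : Omega z -> pbergman_kernel p Omega z = (k z)^-1.
Proof.
move=> Oz; have k0 := weight_gt0 Oz.
have [Am mz Em _] := minimizer_facts domOmega p1 Oz.
pose c : R := (k z) `^ (- p^-1).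
have cp : c `^ p = (k z)^-1.
  by rewrite -powRrM mulNr mulVf ?gt_eqF// powR_inv1// ltW.
have nc : normc c%:C = c by rewrite normc_real ger0_norm// powR_ge0.
pose f w := c%:C * m z w.
have Af : A2 f by exact: bergmanZ.
have fz : normc (f z) `^ p = (k z)^-1 by rewrite /f mz mulr1 nc.
have Nf : pnorm p Omega f = 1.
  rewrite -energy_powR_inv /f energyZ// nc cp Em mulVf ?gt_eqF//.
  by rewrite powR1.
rewrite /pbergman_kernel; set A := (X in sup X).
have Aub : ubound A (k z)^-1.
  move=> _ [g [Ag Ng] <-].
  have := weight_le_energy domOmega p1 z Ag.
  by rewrite -pnorm_powR// Ng powR1 -ler_pdivlMl// mulr1.
have Af' : A (k z)^-1 by exists f.
apply/eqP; rewrite eq_le; apply/andP; split.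
  by apply: sup_le_ub => //; exists (k z)^-1.
by apply: ub_le_sup => //; exists (k z)^-1.
Qed.

Lemma kernel_lipschitz (S : set V) : compact S -> S `<=` Omega ->
  exists C K : R, [/\ 0 < C, 0 < K,
    forall z, S z -> 0 <= pbergman_kernel p Omega z <= K &
    forall z z', S z -> S z' ->
      `|pbergman_kernel p Omega z' - pbergman_kernel p Omega z| <= C * vnorm (z' - z)].
Proof.
move=> cS SO; have [r r0 rS] := compact_uniform_radius domOmega cS SO.
have [c c0 cP] := weight_lower_bound domOmega p1 r0.
have cS' z : S z -> c <= k z.
  by move=> Sz; apply: cP => w wz; apply: (rS z Sz); rewrite ltr_wpDl// ltW.
have [L L0 LP] := weight_lipschitz domOmega p1 cS SO.
exists (c^-1 * c^-1 * L), c^-1; split; rewrite ?mulr_gt0 ?invr_gt0//.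
  move=> z Sz; rewrite (pbergman_kernelE (SO z Sz)) invr_ge0 ?weight_ge0/=.
  rewrite lef_pV2 ?posrE ?cS'//; exact: lt_le_trans (cS' z Sz).
move=> z z' Sz Sz'; rewrite (pbergman_kernelE (SO z Sz)) (pbergman_kernelE (SO z' Sz')).
have kz := lt_le_trans c0 (cS' z Sz); have kz' := lt_le_trans c0 (cS' z' Sz').
have -> : (k z')^-1 - (k z)^-1 = (k z')^-1 * (k z)^-1 * (k z - k z').
  by field; rewrite !gt_eqF.
rewrite normrM -[leRHS]mulrA; apply: ler_pM => //; last first.
  by rewrite distrC; exact: LP.
rewrite ger0_norm ?mulr_ge0 ?invr_ge0 ?(ltW kz) ?(ltW kz')//.
by apply: ler_pM; rewrite ?invr_ge0 ?(ltW kz) ?(ltW kz')// lef_pV2 ?posrE ?cS'.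
Qed.

End global.

Theorem theorem1p3 (R : realType) (n : nat) (n_gt0 : (0 < n)%N)
    (Omega : set 'rV[R[i]]_n) (domOmega : bounded_domain Omega)
    (p : R) (p_gt1 : 1 < p)
    (S : set 'rV[R[i]]_n) (compactS : compact S) (subS : S `<=` Omega) :
  (exists C : R, 0 < C /\
    forall zeta z z' : 'rV[R[i]]_n, S zeta -> S z -> S z' ->
      Normc.normc (pbergman_offdiag p Omega zeta z
                   - pbergman_offdiag p Omega zeta z') <= C * enorm (z - z'))
  /\
  (exists C : R, 0 < C /\
    forall zeta z z' : 'rV[R[i]]_n, S zeta -> S z -> S z' ->
      Normc.normc (minimizer p Omega zeta z
                   - minimizer p Omega zeta z') <= C * enorm (z - z')).
Proof.
have [C C0 CP] := minimizer_lipschitz domOmega p_gt1 compactS subS.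
split; last first.
  exists C; split => // zeta z z' Szeta Sz Sz'.
  apply: (le_trans (CP zeta z' z Szeta Sz' Sz)).
  by rewrite ler_wpM2l ?vnorm_le_enorm// ltW.
have [M M0 MP] := minimizer_bounded domOmega p_gt1 compactS subS.
have [D [K [D0 K0 KK KP]]] := kernel_lipschitz domOmega p_gt1 compactS subS.
exists (D * M + K * C); split; first by rewrite addr_gt0 ?mulr_gt0.
move=> zeta z z' Szeta Sz Sz'.
have MC := CP zeta z' z Szeta Sz' Sz; have MM := MP z' zeta Sz' Szeta.
have KD := KP z' z Sz' Sz; have /andP[Kz0 KzK] := KK z Sz.
have d0 := vnorm_ge0 (z - z').
apply: (@le_trans _ _ ((D * M + K * C) * vnorm (z - z'))); last first.
  by rewrite ler_wpM2l ?vnorm_le_enorm// addr_ge0 ?mulr_ge0// ltW.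
rewrite /pbergman_offdiag.
have -> (a b : R) (x y : R[i]) : a%:C * x - b%:C * y = (a - b)%:C * y + a%:C * (x - y).
  by rewrite rmorphB; ring.
apply: (le_trans (le_normcD _ _)); rewrite !Normc.normcM !normc_real (ger0_norm Kz0).
rewrite mulrDl; apply: lerD.
  by rewrite mulrAC ler_pM ?normc_ge0.
by rewrite -mulrA ler_pM ?normc_ge0.
Qed.
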